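(* Let $T>0$ and $\beta\in(0,1)$. There exist $\lambda>0$, $s_0>0$, $\varepsilon_0>0$ and a constant $M_0>0$ (all independent of $h$) such that for all $h=1/(N+1)$, $N\in\mathbb N$, all $s\in(s_0,\varepsilon_0/h)$ and all time-dependent discrete functions $v=(v_j(t))_{0\le j\le N+1}$, $t\in(-T,T)$, satisfying $v_0=v_{N+1}=0$ and $v(\pm T)=\partial_tv(\pm T)=0$, $$s\int_{-T}^T\!\int_{(0,1)}|\partial_tv|^2dt+s\int_{-T}^T\!\int_{[0,1)}|\partial_h^+v|^2dt+s^3\int_{-T}^T\!\int_{(0,1)}|v|^2dt+\int_{-T}^T\!\int_{(0,1)}|P_{h,1}v|^2dt+\int_{-T}^T\!\int_{(0,1)}|P_{h,2}v|^2dt$$ $$\le M_0\int_{-T}^T\!\int_{(0,1)}|P_hv|^2dt+M_0s\int_{-T}^T\big|(\partial_h^-v)_{N+1}\big|^2dt+M_0s\int_{-T}^T\!\int_{[0,1)}|h\,\partial_h^+\partial_tv|^2dt .$$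
   Context: For $N\in\mathbb N$ put $h=1/(N+1)$, $x_j=jh$. For discrete functions: $(\Delta_hv)_j=(v_{j+1}-2v_j+v_{j-1})/h^2$, $(\partial_hv)_j=(v_{j+1}-v_{j-1})/(2h)$, $(\partial_h^+v)_j=(\partial_h^-v)_{j+1}=(v_{j+1}-v_j)/h$; $\int_{(0,1)}f=h\sum_{j=1}^Nf_j$, $\int_{[0,1)}f=h\sum_{j=0}^Nf_j$. Continuous functions of $x$ are evaluated at the $x_j$. The function $v$ is twice (weakly) differentiable in time with $\partial_{tt}v_j\in L^2(-T,T)$. Weight functions: fix $x^0<0$ and $C_0>0$ such that $\psi(t,x)=|x-x^0|^2-\beta t^2+C_0$ satisfies $\psi\ge1$ on $[-T,T]\times[0,1]$; $\varphi=e^{\lambda\psi}$ and $\rho=e^{-s\varphi}$. Operators: $P_hv=\frac1\rho(\partial_{tt}-\Delta_h)(\rho v)$, $$P_{h,1}v=\partial_{tt}v-(1+A_0)\Delta_hv+s^2\lambda^2\big[\varphi^2(\partial_t\psi)^2-A_2\big]v,$$ $$P_{h,2}v=-s\lambda^2\big[\varphi|\partial_t\psi|^2-A_3\big]v-2s\lambda\big[\varphi\,\partial_t\psi\,\partial_tv-A_1\partial_hv\big],$$ where $$A_1(t,x)=\tfrac12\int_{-1}^1[\varphi\partial_x\psi](t,x+\sigma h)\frac{\rho(t,x+\sigma h)}{\rho(t,x)}d\sigma,\qquad A_2(t,x)=\int_{-1}^1(1-|\sigma|)[\varphi^2(\partial_x\psi)^2](t,x+\sigma h)\frac{\rho(t,x+\sigma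 h)}{\rho(t,x)}d\sigma,$$ $$A_3(t,x)=\int_{-1}^1(1-|\sigma|)[\varphi(\partial_x\psi)^2](t,x+\sigma h)\frac{\rho(t,x+\sigma h)}{\rho(t,x)}d\sigma,\qquad A_4(t,x)=\int_{-1}^1(1-|\sigma|)[\varphi\partial_{xx}\psi](t,x+\sigma h)\frac{\rho(t,x+\sigma h)}{\rho(t,x)}d\sigma,$$ $$A_0=\frac{h^2}2\big(s^2\lambda^2A_2-s\lambda^2A_3-s\lambda A_4\big).$$ *)

(* Defs.v *)
From HB Require Import structures.
From mathcomp Require Import all_boot all_order all_algebra.
From mathcomp Require Import all_classical all_reals all_analysis.

Set Implicit Arguments.
Unset Strict Implicit.
Unset Printing Implicit Defensive.

Import Order.TTheory GRing.Theory Num.Theory.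
Import numFieldNormedType.Exports.

Local Open Scope ring_scope.
Local Open Scope classical_set_scope.

Definition time_itv (R : realType) (T : R) : set R := `]- T, T[.

(* C^1 test functions with compact support, as in the definition of the
   one-dimensional Sobolev spaces in Brezis, Functional Analysis, Sobolev
   Spaces and Partial Differential Equations, Chapter 8. *)
Definition test_function (R : realType) (T : R) (chi : R -> R) : Prop :=
  [/\ forall t : R, derivable chi t 1,
      continuous (derive1 chi) &
      exists K : set R,
        [/\ compact K, K `<=` time_itv T & forall t : R, ~ K t -> chi t = 0]].

Definition is_weak_derivative (R : realType) (T : R) (f g : R -> R) : Prop :=
  [/\ locally_integrable (time_itv T) f,
      locally_integrable (time_itv T) g &
      forall chi : R -> R, test_function T chi ->
        \int[lebesgue_measure]_(t in time_itv T) (f t * derive1 chi t) =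
        - \int[lebesgue_measure]_(t in time_itv T) (g t * chi t)].

Definition weakly_differentiable (R : realType) (T : R) (f : R -> R) : Prop :=
  exists g : R -> R, is_weak_derivative T f g.

(* A weak derivative is unique up to a null set only: this picks one
   representative. It is only used where almost everywhere equality suffices. *)
Definition weak_derive (R : realType) (T : R) (f : R -> R) : R -> R :=
  xget (fun=> 0) [set g | is_weak_derivative T f g].

Definition square_integrable (R : realType) (T : R) (f : R -> R) : Prop :=
  measurable_fun (time_itv T) f /\
  (\int[lebesgue_measure]_(t in time_itv T) (`|f t| ^+ 2)%:E < +oo)%E.

(* f(-T) = f(T) = 0, read on the representative of f that is continuous up to
   the end points. *)
Definition zero_trace (R : realType) (T : R) (f : R -> R) : Prop :=
  exists g : R -> R,
    [/\ {within `[- T, T], continuous g},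
        f = g %[ae lebesgue_measure in time_itv T],
        g (- T) = 0 & g T = 0].

(* A discrete function is a sequence nat -> R of which only
   the entries 0, ..., N+1 matter; a time-dependent one is v : R -> nat -> R,
   with v t j standing for v_j(t). *)

Definition mesh (R : realType) (N : nat) : R := N.+1%:R^-1.

Definition node (R : realType) (N j : nat) : R := j%:R * mesh R N.

(* Delta_h and partial_h are only meant for 1 <= j <= N, partial_h^+ for
   0 <= j <= N and partial_h^- for 1 <= j <= N+1, so the truncated
   predecessor 0.-1 is never reached. *)
Definition lap_h (R : realType) (N : nat) (u : nat -> R) (j : nat) : R :=
  (u j.+1 - 2 * u j + u j.-1) / mesh R N ^+ 2.

Definition d_h (R : realType) (N : nat) (u : nat -> R) (j : nat) : R :=
  (u j.+1 - u j.-1) / (2 * mesh R N).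

Definition dplus_h (R : realType) (N : nat) (u : nat -> R) (j : nat) : R :=
  (u j.+1 - u j) / mesh R N.

Definition dminus_h (R : realType) (N : nat) (u : nat -> R) (j : nat) : R :=
  (u j - u j.-1) / mesh R N.

(* The paper's integral over (0,1). *)
Definition sum_oo (R : realType) (N : nat) (u : nat -> R) : R :=
  mesh R N * \sum_(1 <= j < N.+1) u j.

(* The paper's integral over [0,1). *)
Definition sum_co (R : realType) (N : nat) (u : nat -> R) : R :=
  mesh R N * \sum_(0 <= j < N.+1) u j.

Definition time_int (R : realType) (T : R) (f : R -> R) : \bar R :=
  (\int[lebesgue_measure]_(t in time_itv T) (f t)%:E)%E.

Definition sq_oo (R : realType) (T : R) (N : nat) (V : R -> nat -> R) : \bar R :=
  time_int T (fun t => sum_oo N (fun j => `|V t j| ^+ 2)).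

Definition sq_co (R : realType) (T : R) (N : nat) (V : R -> nat -> R) : \bar R :=
  time_int T (fun t => sum_co N (fun j => `|V t j| ^+ 2)).

Definition dt (R : realType) (T : R) (v : R -> nat -> R) : R -> nat -> R :=
  fun t j => weak_derive T (v ^~ j) t.

Definition psi (R : realType) (beta x0 C0 : R) (t x : R) : R :=
  `|x - x0| ^+ 2 - beta * t ^+ 2 + C0.

(* The weight w stands for psi. *)
Section Operators.
Context (R : realType).
Context (w : R -> R -> R) (lambda s : R).

Definition phi (t x : R) : R := expR (lambda * w t x).

Definition rho (t x : R) : R := expR (- (s * phi t x)).

Definition dt_w (t x : R) : R := derive1 (w ^~ x) t.

Definition dx_w (t x : R) : R := derive1 (w t) x.

Definition dxx_w (t x : R) : R := derive1n 2 (w t) x.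

Definition A1 (h t x : R) : R :=
  2^-1 * \int[lebesgue_measure]_(sigma in `[-1, 1])
    (phi t (x + sigma * h) * dx_w t (x + sigma * h)
      * (rho t (x + sigma * h) / rho t x)).

Definition A2 (h t x : R) : R :=
  \int[lebesgue_measure]_(sigma in `[-1, 1])
    ((1 - `|sigma|)
      * (phi t (x + sigma * h) ^+ 2 * dx_w t (x + sigma * h) ^+ 2)
      * (rho t (x + sigma * h) / rho t x)).

Definition A3 (h t x : R) : R :=
  \int[lebesgue_measure]_(sigma in `[-1, 1])
    ((1 - `|sigma|)
      * (phi t (x + sigma * h) * dx_w t (x + sigma * h) ^+ 2)
      * (rho t (x + sigma * h) / rho t x)).

Definition A4 (h t x : R) : R :=
  \int[lebesgue_measure]_(sigma in `[-1, 1])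
    ((1 - `|sigma|)
      * (phi t (x + sigma * h) * dxx_w t (x + sigma * h))
      * (rho t (x + sigma * h) / rho t x)).

Definition A0 (h t x : R) : R :=
  h ^+ 2 / 2 * (s ^+ 2 * lambda ^+ 2 * A2 h t x
                - s * lambda ^+ 2 * A3 h t x
                - s * lambda * A4 h t x).

Context (T : R) (N : nat).

Definition P_h (v : R -> nat -> R) (t : R) (j : nat) : R :=
  let rv : R -> nat -> R := fun t i => rho t (node R N i) * v t i in
  (rho t (node R N j))^-1 * (dt T (dt T rv) t j - lap_h N (rv t) j).

Definition P_h1 (v : R -> nat -> R) (t : R) (j : nat) : R :=
  let x := node R N j in let h := mesh R N in
  dt T (dt T v) t j
  - (1 + A0 h t x) * lap_h N (v t) j
  + s ^+ 2 * lambda ^+ 2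
    * (phi t x ^+ 2 * dt_w t x ^+ 2 - A2 h t x) * v t j.

Definition P_h2 (v : R -> nat -> R) (t : R) (j : nat) : R :=
  let x := node R N j in let h := mesh R N in
  - (s * lambda ^+ 2) * (phi t x * `|dt_w t x| ^+ 2 - A3 h t x) * v t j
  - 2 * s * lambda
    * (phi t x * dt_w t x * dt T v t j - A1 h t x * d_h N (v t) j).

End Operators.

(* Main.v *)
(* Up to terms of size O(s) |v|, the operators P_{h,1}, P_{h,2} are the forms
   main1, main2 below and P_h is their sum. All coefficients are explicit: the
   averages A_0, A_1, A_2 integrate to exponentials of the difference quotients of
   phi. For a suitable energy E(t), quadratic in (v, d_t v, d_h v), the sum over the
   nodes of main1 * main2 is E' plus a quadratic form on every cell of the mesh
   plus boundary terms. As s tends to infinity and s h to 0 the cell form tends to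
     2 s k (psi_t d_t v - psi_x d_x v)^2   with k = lambda^2 phi
   plus a positive diagonal form in s |d_t v|^2, s |d_x v|^2, s^3 |v|^2, positivity
   holding for one fixed lambda; what is lost in replacing node values by cell
   averages is s |h d_h^+ d_t v|^2. Expanding |main1 + main2|^2 gives the estimate
   at almost every t with the extra term E', whose time integral is 0 by the zero
   traces. Since v is only weakly differentiable in time, this last step is done on
   absolutely continuous representatives, whose Leibniz rule is Fubini's theorem on
   a triangle. *)

Require Import Defs.
From HB Require Import structures.
From mathcomp Require Import all_boot all_order all_algebra.
From mathcomp Require Import all_classical all_reals all_analysis.
From mathcomp Require Import measurable_realfun ring lra.
Set Implicit Arguments.
Unset Strict Implicit.
Unset Printing Implicit Defensive.
Import Order.TTheory GRing.Theory Num.Theory.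
Import numFieldNormedType.Exports.
Local Open Scope classical_set_scope.
Local Open Scope ring_scope.

(** * Algebra on the mesh *)

(** The sum [P_h1] + [P_h2] differs from [P_h] by a bounded multiple of s v. Such an error is
    harmless, because s^2 |v|^2 is absorbed by s^3 |v|^2 for s large, so the zeroth-order
    coefficient p of [main2] may be changed by any bounded function. This freedom is spent on
    balancing the forms in |d_t v|^2 and |d_x v|^2: both leave the same remainder 2 lambda (1 -
    beta) phi next to the square, positive because beta < 1. The coefficient of s^3 |v|^2 is a
    quadratic polynomial in psi_t^2 - psi_x^2; its positivity rests on lambda and on x0 < 0, which
    keeps psi_x away from 0. On the mesh, s h is small but s is not bounded, so expanding rho in
    powers of h alone is useless. Ratios of neighbouring values of rho are exp(- s h y) with y a
    difference quotient of phi, and everything is expanded in tau = s h with y bounded. Summation by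
    parts also differences the coefficients, so their difference quotients in x must converge too;
    hence Lipschitz bounds of size O(tau) rather than mere bounds. The constants are fixed in the
    order lambda, C, delta, eta. *)

Section CrossTerm.
Context (R : realFieldType) (N : nat) (h s : R).
Context (v w z m p q a b mt pt qt at' bt : nat -> R).

Definition dif (u : nat -> R) (j : nat) : R := (u j.+1 - u j) / h.
Definition cdif (u : nat -> R) (j : nat) : R := (u j.+1 - u j.-1) / (2 * h).
Definition lapl (u : nat -> R) (j : nat) : R :=
  (u j.+1 - 2 * u j + u j.-1) / h ^+ 2.
Definition avg (u : nat -> R) (j : nat) : R := (u j + u j.+1) / 2.

(** In the application w and z are the first and second time derivatives of v, m is 1 + A_0, a is
    phi_t, b tends to phi_x and q to phi_t^2 - phi_x^2. *)
Definition main1 (j : nat) : R := z j - m j * lapl v j + s ^+ 2 * q j * v j.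
Definition main2 (j : nat) : R :=
  - s * p j * v j - 2 * s * (a j * w j - b j * cdif v j).

(** Its derivative collects the products that are exact in time: z times [main2], the term a q v w,
    and, after summation by parts, a m w times the Laplacian of v. *)
Definition energy : R :=
  \sum_(1 <= j < N.+1)
    (- s * p j * v j * w j - s * a j * w j ^+ 2
     + 2 * s * b j * cdif v j * w j - s ^+ 3 * a j * q j * v j ^+ 2)
  - s * \sum_(0 <= j < N.+1) avg (fun i => a i * m i) j * dif v j ^+ 2.

(* The time derivative of [energy] when v' = w, w' = z, m' = mt, and so on. *)
Definition denergy : R :=
  \sum_(1 <= j < N.+1)
    (- s * (pt j * v j * w j + p j * w j ^+ 2 + p j * v j * z j)
     - s * (at' j * w j ^+ 2 + 2 * a j * w j * z j)
     + 2 * s * (bt j * cdif v j * w j + b j * cdif w j * w j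
                + b j * cdif v j * z j)
     - s ^+ 3 * ((at' j * q j + a j * qt j) * v j ^+ 2
                 + 2 * a j * q j * v j * w j))
  - s * \sum_(0 <= j < N.+1)
      (avg (fun i => at' i * m i + a i * mt i) j * dif v j ^+ 2
       + 2 * avg (fun i => a i * m i) j * dif v j * dif w j).

Definition node_form (j : nat) : R :=
  s ^+ 3 * (- (p j * q j) + (at' j * q j + a j * qt j)) * v j ^+ 2
  + s * pt j * v j * w j + s * (p j + at' j) * w j ^+ 2.

(** Discrete Leibniz rules produce products of neighbours, v j * v j.+1 and w j * w j.+1, where the
    continuous computation has squares. *)
Definition cell_form (j : nat) : R :=
  - s * dif v j * (dif (fun i => m i * p i) j * v j.+1 + m j * p j * dif v j)
  - 2 * s * dif v j * dif (fun i => a i * m i) j * avg w j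
  + s * dif v j ^+ 2 * dif (fun i => m i * b i) j
  - s ^+ 3 * dif (fun i => q i * b i) j * v j * v j.+1
  + s * dif b j * w j * w j.+1
  + s * avg (fun i => at' i * m i + a i * mt i) j * dif v j ^+ 2
  - s * dif v j * (bt j * w j + bt j.+1 * w j.+1)
  + (node_form j + node_form j.+1) / 2.

Lemma sum_cell_split (A B : nat -> R) :
  \sum_(1 <= j < N.+1) (A j + B j.-1)
  = \sum_(0 <= j < N.+1) (A j + B j) - A 0%N - B N.
Proof.
rewrite !big_split /= (big_add1 _ _ _ _ _ A) (big_add1 _ _ _ _ _ (fun j => B j.-1)) /=.
rewrite (@big_nat_recl _ _ _ N 0 A) // (@big_nat_recr _ _ _ N 0 B) //=.
ring.
Qed.

(* Every node term of main1 * main2 minus the derivative of the energy splits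
   into a part living on the cell to its right and one on the cell to its
   left, so that summation by parts reduces to an identity on each cell. *)
Lemma cross_term_identity : h != 0 ->
  v 0%N = 0 -> v N.+1 = 0 -> w 0%N = 0 -> w N.+1 = 0 ->
  \sum_(1 <= j < N.+1) main1 j * main2 j
  = denergy + \sum_(0 <= j < N.+1) cell_form j
    + s / h * (m 0%N * b 0%N * dif v 0%N ^+ 2
               - m N.+1 * b N.+1 * dif v N ^+ 2).
Proof.
move=> h0 v0 vN w0 wN.
pose A j := - m j * (dif v j / h) * (- s * p j * v j - 2 * s * a j * w j)
  - s * m j * b j * dif v j ^+ 2 / h + node_form j / 2
  + s ^+ 3 * q j * b j * v j * v j.+1 / h
  - s * bt j * dif v j * w j - s * b j * w j * w j.+1 / h.
pose B k := let j := k.+1 in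
  m j * (dif v k / h) * (- s * p j * v j - 2 * s * a j * w j)
  + s * m j * b j * dif v k ^+ 2 / h + node_form j / 2
  - s ^+ 3 * q j * b j * v j * v k / h
  - s * bt j * dif v k * w j + s * b j * w j * w k / h.
have := sum_cell_split A B.
(* The two ends have one adjacent cell only. With v and w zero there, the part in (dif v)^2 alone
   survives and gives the boundary terms. *)
have -> : A 0%N = - s / h * (m 0%N * b 0%N * dif v 0%N ^+ 2).
  by rewrite /A /node_form v0 w0; field.
have -> : B N = s / h * (m N.+1 * b N.+1 * dif v N ^+ 2).
  by rewrite /B /node_form /= vN wN; field.
move=> sAB.
(* The cell sum inside [denergy] is added back on both sides, so that one identity at each node and
   one on each cell remain. *)
have -> : \sum_(1 <= j < N.+1) main1 j * main2 j
  = \sum_(1 <= j < N.+1) (A j + B j.-1)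
   + (denergy + s * \sum_(0 <= j < N.+1)
      (avg (fun i => at' i * m i + a i * mt i) j * dif v j ^+ 2
       + 2 * avg (fun i => a i * m i) j * dif v j * dif w j)).
  rewrite /denergy subrK -big_split /= !big_nat; apply: eq_bigr => -[//|j] _.
  rewrite /A /B /main1 /main2 /node_form /lapl /cdif /dif /=; field.
  by rewrite h0.
have -> : \sum_(0 <= j < N.+1) cell_form j = \sum_(0 <= j < N.+1) (A j + B j)
  + s * \sum_(0 <= j < N.+1)
      (avg (fun i => at' i * m i + a i * mt i) j * dif v j ^+ 2
       + 2 * avg (fun i => a i * m i) j * dif v j * dif w j).
  rewrite mulr_sumr -big_split /=; apply: eq_bigr => j _.
  by rewrite /A /B /cell_form /node_form /avg /dif /=; field.
rewrite sAB; ring.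
Qed.

End CrossTerm.

(** The cell form is bounded below term by term: exchanging a coefficient for its limit costs e
    U. *)
Lemma mul_close (R : realFieldType) (c c0 X e U : R) :
  `|c - c0| <= e -> `|X| <= U -> c0 * X - e * U <= c * X.
Proof.
move=> hc hX; rewrite -subr_ge0.
have : `|(c - c0) * X| <= e * U by rewrite normrM ler_pM.
by rewrite ler_norml => /andP[+ _]; lra.
Qed.

Lemma normM_le_sqr (R : realFieldType) (x y : R) :
  `|x * y| <= (x ^+ 2 + y ^+ 2) / 2.
Proof.
have := sqr_ge0 (x + y); have := sqr_ge0 (x - y) => h1 h2.
by rewrite ler_norml; apply/andP; split; lra.
Qed.

(** These are the products occurring in [cell_form], measured by the cell energy U. Those in which v
    carries only the weight s, not s^3, gain the factor delta from 1 <= delta * s. *)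
Lemma cell_products (R : realFieldType) (delta s d v0 v1 w0 w1 : R) :
  0 < s -> 0 <= delta -> 1 <= delta * s ->
  let W := (w0 ^+ 2 + w1 ^+ 2) / 2 in let V := (v0 ^+ 2 + v1 ^+ 2) / 2 in
  let U := s * W + s * d ^+ 2 + s ^+ 3 * V in
  [/\ [/\ `|s * d * v1| <= delta * U, `|s * d ^+ 2| <= U &
          `|s * d * ((w0 + w1) / 2)| <= U],
      [/\ `|s ^+ 3 * v0 * v1| <= U, `|s * w0 * w1| <= U,
          `|s * d * w0| <= U & `|s * d * w1| <= U] &
      [/\ `|s ^+ 3 * v0 ^+ 2 / 2| + `|s ^+ 3 * v1 ^+ 2 / 2| <= U,
          `|s * w0 ^+ 2 / 2| + `|s * w1 ^+ 2 / 2| <= U &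
          `|s * w0 * v0 / 2| + `|s * w1 * v1 / 2| <= delta * U]].
Proof.
move=> s0 d0 ds; cbv zeta.
have s20 : 0 < s ^+ 2 by rewrite exprn_gt0.
have s30 : 0 < s ^+ 3 by rewrite exprn_gt0.
pose W := (w0 ^+ 2 + w1 ^+ 2) / 2; pose V := (v0 ^+ 2 + v1 ^+ 2) / 2.
rewrite -/W -/V; set U := s * W + _ + _.
have sq (x : R) : 0 <= x ^+ 2 by rewrite sqr_ge0.
have W0 : 0 <= s * W by rewrite mulr_ge0 ?(ltW s0)// divr_ge0 ?addr_ge0.
have V0 : 0 <= s ^+ 3 * V by rewrite mulr_ge0 ?(ltW s30)// divr_ge0 ?addr_ge0.
have D0 : 0 <= s * d ^+ 2 by rewrite mulr_ge0 ?(ltW s0).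
have UE : U = s * W + s * d ^+ 2 + s ^+ 3 * V by [].
clearbody U.
(* products in which one factor v makes them lower order, as 1 <= delta s *)
have low (x y : R) : `|s * x * y| <= delta * (s * x ^+ 2 + s ^+ 3 * y ^+ 2) / 2.
  have -> : s * x * y = x * (s * y) by ring.
  apply: (le_trans (normM_le_sqr _ _)).
  rewrite ler_pM2r ?invr_gt0 // mulrDr lerD //.
    by rewrite mulrA ler_peMl.
  by have := ler_peMl (mulr_ge0 (ltW s20) (sq y)) ds; lra.
have smul (x y : R) : `|s * x * y| <= s * ((x ^+ 2 + y ^+ 2) / 2).
  by rewrite -mulrA normrM (gtr0_norm s0) ler_pM2l // normM_le_sqr.
have s3mul (x y : R) : `|s ^+ 3 * x * y| <= s ^+ 3 * ((x ^+ 2 + y ^+ 2) / 2).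
  by rewrite -mulrA normrM (gtr0_norm s30) ler_pM2l // normM_le_sqr.
have sw0 := mulr_ge0 (ltW s0) (sq w0); have sw1 := mulr_ge0 (ltW s0) (sq w1).
have sv0 := mulr_ge0 (ltW s30) (sq v0); have sv1 := mulr_ge0 (ltW s30) (sq v1).
have dW := mulr_ge0 d0 W0; have dV := mulr_ge0 d0 V0; have dD := mulr_ge0 d0 D0.
have dw0 := mulr_ge0 d0 sw0; have dw1 := mulr_ge0 d0 sw1.
have dv0 := mulr_ge0 d0 sv0; have dv1 := mulr_ge0 d0 sv1.
have X1 : `|s * d * v1| <= delta * U.
  by apply: (le_trans (low _ _)); rewrite UE /V /W; rewrite /V /W in dW dV;
    clear -dW dV dD dw0 dw1 dv0 dv1; lra.
have X2 : `|s * d ^+ 2| <= U by rewrite ger0_norm // UE; clear -W0 V0 D0; lra.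
have X3 : `|s * d * ((w0 + w1) / 2)| <= U.
  apply: (le_trans (smul _ _)); rewrite UE /W.
  have : s * ((w0 + w1) / 2) ^+ 2 <= s * W.
    by rewrite ler_pM2l // /W; have := sq (w0 - w1); clear; lra.
  by rewrite /W; rewrite /W in W0; clear -W0 V0 D0; lra.
have X5 : `|s ^+ 3 * v0 * v1| <= U.
  by apply: (le_trans (s3mul _ _)); rewrite UE /V /W; rewrite /W in W0;
    clear -W0 V0 D0; lra.
have X6 : `|s * w0 * w1| <= U.
  by apply: (le_trans (smul _ _)); rewrite UE /V /W; rewrite /V in V0;
    clear -V0 D0 sw0 sw1; lra.
have X8 : `|s * d * w0| <= U.
  by apply: (le_trans (smul _ _)); rewrite UE /V /W; rewrite /V in V0;
    clear -V0 D0 sw0 sw1; lra.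
have X8' : `|s * d * w1| <= U.
  by apply: (le_trans (smul _ _)); rewrite UE /V /W; rewrite /V in V0;
    clear -V0 D0 sw0 sw1; lra.
have X9 : `|s ^+ 3 * v0 ^+ 2 / 2| + `|s ^+ 3 * v1 ^+ 2 / 2| <= U.
  by rewrite !ger0_norm ?divr_ge0 // UE /V; rewrite /V /W in V0 W0 *;
    clear -V0 W0 D0; lra.
have X10 : `|s * w0 ^+ 2 / 2| + `|s * w1 ^+ 2 / 2| <= U.
  by rewrite !ger0_norm ?divr_ge0 // UE /V; rewrite /V /W in V0 W0 *;
    clear -V0 W0 D0; lra.
have X11 : `|s * w0 * v0 / 2| + `|s * w1 * v1 / 2| <= delta * U.
  have := low w0 v0; have := low w1 v1.
  rewrite !normrM !(gtr0_norm (_ : 0 < 2^-1)) ?invr_gt0 // UE /V /W.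
  by rewrite /V /W in dV dW; clear -dW dV dD dw0 dw1 dv0 dv1; lra.
by split.
Qed.

Section CellBound.
Context (R : realFieldType) (h s : R).
Context (v w m p q a b mt pt qt at' bt : nat -> R) (j : nat).

Definition cell_energy : R :=
  s * ((w j ^+ 2 + w j.+1 ^+ 2) / 2) + s * dif h v j ^+ 2
  + s ^+ 3 * ((v j ^+ 2 + v j.+1 ^+ 2) / 2).

(* Closeness of the coefficients to their limits: P, AT, AX, BX, QB and K stand
   for p, a_t, a_x = b_t, b_x, (q b)_x and - p q + (a q)_t. *)
Definition coeffs_close (delta C P AT AX BX QB K : R) : Prop :=
  let zc i := - (p i * q i) + (at' i * q i + a i * qt i) in
  [/\ [/\ `|dif h (fun i => m i * p i) j| <= C, `|pt j| <= C & `|pt j.+1| <= C],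
      [/\ `|m j * p j - P| <= delta,
          `|dif h (fun i => a i * m i) j - AX| <= delta,
          `|dif h (fun i => m i * b i) j - BX| <= delta,
          `|dif h (fun i => q i * b i) j - QB| <= delta &
          `|dif h b j - BX| <= delta],
      [/\ `|avg (fun i => at' i * m i + a i * mt i) j - AT| <= delta,
          `|bt j - AX| <= delta & `|bt j.+1 - AX| <= delta],
      [/\ `|p j + at' j - (P + AT)| <= delta &
          `|p j.+1 + at' j.+1 - (P + AT)| <= delta] &
      [/\ `|zc j - K| <= delta & `|zc j.+1 - K| <= delta]].

(** With y1 and y2 standing for psi_t and psi_x, the limit form is a square plus at least 2 c times
    the cell energy. The errors sum to (3 C + 11) delta times that energy: three contributions carry
    C, and the others count eleven with multiplicity. They consume half of 2 c. *)
Lemma cell_form_ge (delta C c k y1 y2 kap P AT AX BX QB K : R) :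
  0 < h -> 0 < s -> 0 <= delta <= 1 -> 1 <= delta * s -> s * h <= delta ->
  0 <= C -> `|BX| <= C -> `|QB| <= C -> 0 <= k ->
  P + AT + BX = 2 * k * y1 ^+ 2 + 2 * kap ->
  - P + AT + BX = 2 * k * y2 ^+ 2 + 2 * kap ->
  AX = k * y1 * y2 ->
  c <= kap -> 2 * c <= K - QB -> (3 * C + 11) * delta <= c ->
  coeffs_close delta C P AT AX BX QB K ->
  c * cell_energy - C * s * (h * dif h w j) ^+ 2
  <= cell_form h s v w m p q a b mt pt qt at' bt j.
Proof.
move=> h0 s0 /andP[d0 d1] ds sh C0 hBX hQB k0 e1 e2 e3 ck cK cd.
move=> [[H1 H2 H3] [H4 H5 H6 H7 H8] [H9 H10 H11] [H12 H13] [H14 H15]].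
rewrite /cell_form /node_form.
set dmp := dif h (fun i => m i * p i) j in H1 *.
set dam := dif h (fun i => a i * m i) j in H5 *.
set dmb := dif h (fun i => m i * b i) j in H6 *.
set dqb := dif h (fun i => q i * b i) j in H7 *.
set db := dif h b j in H8 *.
set am := avg _ j in H9 *.
set z0 := - _ + _ in H14 *; set z1 := - _ + _ in H15 *.
have hn : h != 0 by rewrite gt_eqF.
have hv : v j.+1 = v j + h * dif h v j by rewrite /dif; field.
have hw : w j.+1 = w j + h * dif h w j by rewrite /dif; field.
move: hv hw; rewrite /cell_energy /avg.
move: (dif h v j) (dif h w j) (v j) (v j.+1) (w j) (w j.+1)
  => d e v0 v1 w0 w1 hv hw.
set U := (X in c * X).
have s20 : 0 < s ^+ 2 by rewrite exprn_gt0.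
have s30 : 0 < s ^+ 3 by rewrite exprn_gt0.
pose W := (w0 ^+ 2 + w1 ^+ 2) / 2; pose V := (v0 ^+ 2 + v1 ^+ 2) / 2.
have sq (x : R) : 0 <= x ^+ 2 by rewrite sqr_ge0.
have W0 : 0 <= s * W by rewrite mulr_ge0 ?(ltW s0)// divr_ge0 ?addr_ge0.
have V0 : 0 <= s ^+ 3 * V by rewrite mulr_ge0 ?(ltW s30)// divr_ge0 ?addr_ge0.
have D0 : 0 <= s * d ^+ 2 by rewrite mulr_ge0 ?(ltW s0).
have UE : U = s * W + s * d ^+ 2 + s ^+ 3 * V by [].
clearbody U.
have n0 (x : R) : `|x| <= C -> `|x - 0| <= C by rewrite subr0.
have nN (x y e' : R) : `|x - y| <= e' -> `|- x - - y| <= e'.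
  by rewrite -opprD normrN.
have U0 : 0 <= U by rewrite UE !addr_ge0.
have shd : (s * h) ^+ 2 <= delta.
  have sh0 : 0 <= s * h by rewrite mulr_ge0 // ltW.
  by rewrite expr2 -[delta]mulr1; apply: ler_pM => //; apply: le_trans sh d1.
(* The defect of v0 * v1 against the mean of squares is absorbed: s^3 (h d)^2 is (s h)^2 times s
   d^2. *)
have Z1 : - (C * delta * U) <= QB * (s ^+ 3 * (h * d) ^+ 2 / 2).
  have hh : 0 <= s * d ^+ 2 / 2 by rewrite divr_ge0.
  have E : s ^+ 3 * (h * d) ^+ 2 / 2 = (s * h) ^+ 2 * (s * d ^+ 2 / 2) by ring.
  have /(mul_close (n0 _ hQB)) : `|s ^+ 3 * (h * d) ^+ 2 / 2| <= delta * U.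
    rewrite E ger0_norm; last exact: mulr_ge0.
    by apply: ler_pM => //; rewrite UE; lra.
  by move=> ?; lra.
(* For w no power of s h is gained, so this defect stays as the extra term of the estimate. *)
have Z2 : BX * (s * (h * e) ^+ 2 / 2) <= C * s * (h * e) ^+ 2.
  have -> : C * s * (h * e) ^+ 2 = C * (s * (h * e) ^+ 2) by ring.
  have hh : 0 <= s * (h * e) ^+ 2 by rewrite mulr_ge0 ?(ltW s0).
  apply: (@le_trans _ _ (C * (s * (h * e) ^+ 2 / 2))).
    apply: ler_wpM2r; first by rewrite divr_ge0.
    by move: hBX; rewrite ler_norml => /andP[].
  by apply: ler_wpM2l => //; lra.
(* the principal quadratic form is a square plus a positive diagonal part *)
have main : s * (2 * kap * W + 2 * kap * d ^+ 2) <=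
  s * ((P + AT + BX) * W - 4 * AX * d * ((w0 + w1) / 2)
       + (- P + AT + BX) * d ^+ 2).
  rewrite ler_pM2l // e1 e2 e3.
  have := mulr_ge0 k0 (sq (y1 * ((w0 + w1) / 2) - y2 * d)).
  have := mulr_ge0 (mulr_ge0 k0 (sq y1)) (sq (w0 - w1)).
  by rewrite /W; lra.
have [[X1 X2 X3] [X5 X6 X8 X8'] [X9 X10 X11]] :=
  cell_products d v0 v1 w0 w1 s0 d0 ds.
rewrite -/W -/V -UE in X1 X2 X3 X5 X6 X8 X8' X9 X10 X11.
have T1 := mul_close (nN _ _ _ (n0 _ H1)) X1.
have T2 := mul_close (nN _ _ _ H4) X2.
have T3 := mul_close (nN _ _ _ H5) X3.
have T4 := mul_close H6 X2.
have T5 := mul_close (nN _ _ _ H7) X5.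
have T6 := mul_close H8 X6.
have T7 := mul_close H9 X2.
have T8 := mul_close (nN _ _ _ H10) X8.
have T8' := mul_close (nN _ _ _ H11) X8'.
have T9 := mul_close H14 (lexx `|s ^+ 3 * v0 ^+ 2 / 2|).
have T9' := mul_close H15 (lexx `|s ^+ 3 * v1 ^+ 2 / 2|).
have T10 := mul_close H12 (lexx `|s * w0 ^+ 2 / 2|).
have T10' := mul_close H13 (lexx `|s * w1 ^+ 2 / 2|).
have T11 := mul_close (n0 _ H2) (lexx `|s * w0 * v0 / 2|).
have T11' := mul_close (n0 _ H3) (lexx `|s * w1 * v1 / 2|).
have Y9 := ler_wpM2l d0 X9; have Y10 := ler_wpM2l d0 X10.
have Y11 := ler_wpM2l C0 X11.
have F1 : c * (s * W) <= kap * (s * W) by rewrite ler_wpM2r.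
have F2 : c * (s * d ^+ 2) <= kap * (s * d ^+ 2) by rewrite ler_wpM2r.
have F3 : 2 * c * (s ^+ 3 * V) <= (K - QB) * (s ^+ 3 * V) by rewrite ler_wpM2r.
have F4 : (3 * C + 11) * delta * U <= c * U by rewrite ler_wpM2r.
have ev : s ^+ 3 * v0 * v1 = s ^+ 3 * V - s ^+ 3 * (h * d) ^+ 2 / 2.
  by rewrite /V hv; field.
have ew : s * w0 * w1 = s * W - s * (h * e) ^+ 2 / 2.
  by rewrite /W hw; field.
rewrite ev in T5; rewrite ew in T6.
rewrite -/W -/V in T9 T9' T10 T10' *.
have -> : - s * d * (dmp * v1 + m j * p j * d) - 2 * s * d * dam * ((w0 + w1) / 2)
   + s * d ^+ 2 * dmb - s ^+ 3 * dqb * v0 * v1 + s * db * w0 * w1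
   + s * am * d ^+ 2 - s * d * (bt j * w0 + bt j.+1 * w1)
   + (s ^+ 3 * z0 * v0 ^+ 2 + s * pt j * v0 * w0 + s * (p j + at' j) * w0 ^+ 2
      + (s ^+ 3 * z1 * v1 ^+ 2 + s * pt j.+1 * v1 * w1
         + s * (p j.+1 + at' j.+1) * w1 ^+ 2)) / 2
 = - dmp * (s * d * v1) + - (m j * p j) * (s * d ^+ 2)
   + 2 * (- dam * (s * d * ((w0 + w1) / 2)))
   + dmb * (s * d ^+ 2) + - dqb * (s ^+ 3 * V - s ^+ 3 * (h * d) ^+ 2 / 2)
   + db * (s * W - s * (h * e) ^+ 2 / 2) + am * (s * d ^+ 2)
   + - bt j * (s * d * w0) + - bt j.+1 * (s * d * w1)
   + z0 * (s ^+ 3 * v0 ^+ 2 / 2) + z1 * (s ^+ 3 * v1 ^+ 2 / 2)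
   + (p j + at' j) * (s * w0 ^+ 2 / 2) + (p j.+1 + at' j.+1) * (s * w1 ^+ 2 / 2)
   + pt j * (s * w0 * v0 / 2) + pt j.+1 * (s * w1 * v1 / 2).
  by rewrite -ev -ew; ring.
have VE : s ^+ 3 * V = s ^+ 3 * v0 ^+ 2 / 2 + s ^+ 3 * v1 ^+ 2 / 2.
  by rewrite /V; ring.
have WE : s * W = s * w0 ^+ 2 / 2 + s * w1 ^+ 2 / 2 by rewrite /W; ring.
have KV : K * (s ^+ 3 * v0 ^+ 2 / 2) + K * (s ^+ 3 * v1 ^+ 2 / 2)
  = K * (s ^+ 3 * V) by rewrite VE; ring.
have KW : (P + AT) * (s * w0 ^+ 2 / 2) + (P + AT) * (s * w1 ^+ 2 / 2)
  = (P + AT) * (s * W) by rewrite WE; ring.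
have cU : c * U = c * (s * W) + c * (s * d ^+ 2) + c * (s ^+ 3 * V).
  by rewrite UE; ring.
clear -T1 T2 T3 T4 T5 T6 T7 T8 T8' T9 T9' T10 T10' T11 T11' Y9 Y10 Y11 Z1 Z2
  main F1 F2 F3 F4 KV KW cU.
lra.
Qed.

End CellBound.

Section PointwiseEstimate.
Context (R : realFieldType) (N : nat) (h s : R).
Context (v w z m p q a b mt pt qt at' bt e1 e2 e3 : nat -> R).

Local Notation mn1 := (main1 h s v z m q).
Local Notation mn2 := (main2 h s v w p a b).

Lemma sum_cell_ends (f : nat -> R) : f 0%N = 0 -> f N.+1 = 0 ->
  \sum_(0 <= j < N.+1) (f j + f j.+1) / 2 = \sum_(1 <= j < N.+1) f j.
Proof.
move=> f0 fN; rewrite -mulr_suml big_split /=.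
rewrite (@big_nat_recr _ _ _ N 0 (fun j => f j.+1)) //= fN addr0.
rewrite (@big_ltn _ _ _ 0 N.+1) // f0 add0r -(big_add1 _ _ 0 N.+1 xpredT f) /=.
by field.
Qed.

(** Twice the expansion of |main1 + main2|^2, with the cross term replaced by its identity, leaves 4
    c times the energy. Half of it pays for the residuals: their squares enter with total weight 2 +
    2 + 4 = 8, and 8 Cr^2 s^2 <= 2 c s^3 is the hypothesis on Cr. *)
Lemma pointwise_estimate (c C Cr : R) : 0 < h -> 0 < s -> 0 < c -> 0 <= C ->
  4 * Cr ^+ 2 <= c * s ->
  v 0%N = 0 -> v N.+1 = 0 -> w 0%N = 0 -> w N.+1 = 0 ->
  (forall j, (j <= N)%N -> c * cell_energy h s v w j - C * s * (h * dif h w j) ^+ 2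
     <= cell_form h s v w m p q a b mt pt qt at' bt j) ->
  0 <= m 0%N * b 0%N -> `|m N.+1 * b N.+1| <= C ->
  (forall j, (0 < j <= N)%N -> [/\ `|e1 j| <= Cr, `|e2 j| <= Cr & `|e3 j| <= Cr]) ->
  2 * c * (s * (\sum_(1 <= j < N.+1) w j ^+ 2)
           + s * (\sum_(0 <= j < N.+1) dif h v j ^+ 2)
           + s ^+ 3 * (\sum_(1 <= j < N.+1) v j ^+ 2))
  + \sum_(1 <= j < N.+1) (mn1 j + s * e1 j * v j) ^+ 2
  + \sum_(1 <= j < N.+1) (mn2 j + s * e2 j * v j) ^+ 2
  <= 4 * (\sum_(1 <= j < N.+1) (mn1 j + mn2 j + s * e3 j * v j) ^+ 2)
     + 4 * C * s * (\sum_(0 <= j < N.+1) (h * dif h w j) ^+ 2)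
     + 4 * C * (s / h) * dif h v N ^+ 2
     - 4 * denergy N h s v w z m p q a b mt pt qt at' bt.
Proof.
move=> h0 s0 c0 C0 cs v0 vN w0 wN cell bl br he.
have hn : h != 0 by rewrite gt_eqF.
have I := cross_term_identity s z m p q a b mt pt qt at' bt hn v0 vN w0 wN.
set dE := denergy _ _ _ _ _ _ _ _ _ _ _ _ _ _ _ _ in I *.
set V := \sum_(1 <= j < N.+1) v j ^+ 2; set W := \sum_(1 <= j < N.+1) w j ^+ 2.
set D := \sum_(0 <= j < N.+1) dif h v j ^+ 2.
set HE := \sum_(0 <= j < N.+1) (h * dif h w j) ^+ 2.
have cellS : c * (s * W + s * D + s ^+ 3 * V) - C * s * HE <=
    \sum_(0 <= j < N.+1) cell_form h s v w m p q a b mt pt qt at' bt j.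
  have -> : s * W + s * D + s ^+ 3 * V = \sum_(0 <= j < N.+1) cell_energy h s v w j.
    rewrite /cell_energy !big_split /= -!mulr_sumr; congr (_ * _ + _ * _ + _ * _).
      by rewrite sum_cell_ends ?w0 ?wN // expr0n.
    by rewrite sum_cell_ends ?v0 ?vN // expr0n.
  rewrite mulr_sumr mulr_sumr -sumrB; apply: ler_sum_nat => j /andP[_ jN].
  exact: cell.
have V0 : 0 <= V by apply: sumr_ge0 => j _; exact: sqr_ge0.
have s2 : 4 * Cr ^+ 2 * (s ^+ 2 * V) <= c * (s ^+ 3 * V).
  have -> : c * (s ^+ 3 * V) = c * s * (s ^+ 2 * V) by ring.
  by rewrite ler_wpM2r // mulr_ge0 // sqr_ge0.
have sq (e : nat -> R) : (forall j, (0 < j <= N)%N -> `|e j| <= Cr) ->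
    \sum_(1 <= j < N.+1) (s * e j * v j) ^+ 2 <= Cr ^+ 2 * (s ^+ 2 * V).
  move=> H; rewrite !mulr_sumr; apply: ler_sum_nat => j hj.
  have -> : (s * e j * v j) ^+ 2 = e j ^+ 2 * (s ^+ 2 * v j ^+ 2) by ring.
  apply: ler_wpM2r; first by rewrite mulr_ge0 ?sqr_ge0.
  rewrite -(real_normK (num_real (e j))) lerXn2r ?nnegrE ?H //.
  by apply: le_trans (H j hj).
have q1 := sq e1 (fun j hj => let: And3 x _ _ := he j hj in x).
have q2 := sq e2 (fun j hj => let: And3 _ x _ := he j hj in x).
have q3 := sq e3 (fun j hj => let: And3 _ _ x := he j hj in x).
have sum2 (f g : nat -> R) : \sum_(1 <= j < N.+1) (f j + g j) ^+ 2 <=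
    2 * (\sum_(1 <= j < N.+1) f j ^+ 2) + 2 * (\sum_(1 <= j < N.+1) g j ^+ 2).
  rewrite !mulr_sumr -big_split /=; apply: ler_sum => j _.
  by have := sqr_ge0 (f j - g j); lra.
have b1 := sum2 mn1 (fun j => s * e1 j * v j).
have b2 := sum2 mn2 (fun j => s * e2 j * v j).
have b3 : \sum_(1 <= j < N.+1) (mn1 j + mn2 j) ^+ 2 <=
    2 * (\sum_(1 <= j < N.+1) (mn1 j + mn2 j + s * e3 j * v j) ^+ 2)
    + 2 * (\sum_(1 <= j < N.+1) (s * e3 j * v j) ^+ 2).
  rewrite !mulr_sumr -big_split /=; apply: ler_sum => j _.
  by have := sqr_ge0 (mn1 j + mn2 j + 2 * (s * e3 j * v j)); lra.
have b4 : \sum_(1 <= j < N.+1) (mn1 j + mn2 j) ^+ 2 =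
    \sum_(1 <= j < N.+1) mn1 j ^+ 2 + \sum_(1 <= j < N.+1) mn2 j ^+ 2
    + 2 * (\sum_(1 <= j < N.+1) mn1 j * mn2 j).
  rewrite mulr_sumr -!big_split /=; apply: eq_bigr => j _; ring.
have sh0 : 0 <= s / h by rewrite divr_ge0 ?ltW.
(* The left end contributes with the good sign and is dropped; the right end becomes the observation
   term. *)
have bd : - (C * (s / h) * dif h v N ^+ 2) <=
    s / h * (m 0%N * b 0%N * dif h v 0 ^+ 2 - m N.+1 * b N.+1 * dif h v N ^+ 2).
  have -> : - (C * (s / h) * dif h v N ^+ 2) = s / h * - (C * dif h v N ^+ 2) by ring.
  rewrite ler_wpM2l //.
  have t1 : 0 <= m 0%N * b 0%N * dif h v 0 ^+ 2 by rewrite mulr_ge0 // sqr_ge0.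
  have t2 : m N.+1 * b N.+1 * dif h v N ^+ 2 <= C * dif h v N ^+ 2.
    by rewrite ler_wpM2r ?sqr_ge0 //; apply: le_trans (ler_norm _) br.
  by lra.
have cW : 0 <= c * (s * W).
  by rewrite !mulr_ge0 ?(ltW c0) ?(ltW s0) // sumr_ge0 // => j _; exact: sqr_ge0.
have cD : 0 <= c * (s * D).
  by rewrite !mulr_ge0 ?(ltW c0) ?(ltW s0) // sumr_ge0 // => j _; exact: sqr_ge0.
have cV : 0 <= c * (s ^+ 3 * V).
  by rewrite mulr_ge0 ?(ltW c0) // mulr_ge0 // ltW // exprn_gt0.
move: cW cD cV I cellS s2 q1 q2 q3 b1 b2 b3 b4 bd.
move: (\sum_(0 <= j < N.+1) cell_form _ _ _ _ _ _ _ _ _ _ _ _ _ _ _) => CF.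
move: (s / h * (m 0%N * b 0%N * _ - _)) => B.
move: (\sum_(1 <= j < N.+1) mn1 j * mn2 j) => X.
move: (\sum_(1 <= j < N.+1) mn1 j ^+ 2) (\sum_(1 <= j < N.+1) mn2 j ^+ 2) => X1 X2.
clear; lra.
Qed.

End PointwiseEstimate.

(** * Absolutely continuous functions *)

Section TriangleFubini.
Context {R : realType}.
Local Notation mu := (@lebesgue_measure R).
Variables u1 u2 : R -> R.
Hypothesis i1 : mu.-integrable [set: R] (EFin \o u1).
Hypothesis i2 : mu.-integrable [set: R] (EFin \o u2).

Let m1 : measurable_fun setT u1.
Proof. by move/integrableP : i1 => [/measurable_EFinP]. Qed.

Let m2 : measurable_fun setT u2.
Proof. by move/integrableP : i2 => [/measurable_EFinP]. Qed.

Let K (c : R * R -> bool) (z : R * R) : \bar R :=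
  (if c z then u1 z.1 * u2 z.2 else 0)%:E.

Let mK (c : R * R -> bool) : measurable_fun setT c -> measurable_fun setT (K c).
Proof.
move=> mc; apply/measurable_EFinP; apply: measurable_fun_ifT => //.
by apply: measurable_funM; apply: measurableT_comp => //.
Qed.

(** The cut kernel is dominated by |u1 x| |u2 y|, whose iterated integral is a product of two finite
    integrals. *)
Lemma integrable_cut (c : R * R -> bool) : measurable_fun setT c ->
  (mu \x mu)%E.-integrable setT (K c).
Proof.
move=> mc; apply/integrable12ltyP; first exact: mK.
apply: (@le_lt_trans _ _ (\int[mu]_x ((`|u1 x|)%:E * (\int[mu]_y (`|u2 y|)%:E)))%E).
  apply: ge0_le_integral => //.
  - by move=> x _; exact: integral_ge0.
  - apply: (@measurable_fun_fubini_tonelli_F _ _ _ _ R mu (abse \o K c)) => //.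
      by apply: measurableT_comp => //; exact: mK.
    by move=> z; exact: abse_ge0.
  - apply: emeasurable_funM => //.
    by apply/measurable_EFinP; apply: measurableT_comp.
  - move=> x _; rewrite -ge0_integralZl_EFin //; last first.
      by apply/measurable_EFinP; apply: measurableT_comp.
    apply: ge0_le_integral => //.
    + apply: measurableT_comp => //.
      exact: (measurableT_comp (mK mc) (measurable_pair1 x)).
    + apply: emeasurable_funM => //.
      by apply/measurable_EFinP; apply: measurableT_comp.
    + move=> y _; rewrite /K /= -EFinM lee_fin -normrM.
      by case: ifP => // _; rewrite normr0.
move/integrableP : i1 => [_ f1]; move/integrableP : i2 => [_ f2].
have g2 : (\int[mu]_y (`|u2 y|)%:E)%E \is a fin_num.
  by rewrite ge0_fin_numE //; exact: integral_ge0.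
rewrite -(fineK g2) ge0_integralZr //; last 2 first.
  by apply/measurable_EFinP; apply: measurableT_comp.
  by rewrite lee_fin fine_ge0 // integral_ge0.
rewrite lte_mul_pinfty ?ltry ?integral_ge0 // ge0_fin_numE //.
exact: integral_ge0.
Qed.

Lemma integrable_section (c : R * R -> bool) (x : R) : measurable_fun setT c ->
  mu.-integrable setT (EFin \o fun y => if c (x, y) then u2 y else 0).
Proof.
move=> mc; apply: le_integrable (i2) => //.
  apply/measurable_EFinP; apply: measurable_fun_ifT => //.
  exact: (measurableT_comp mc (measurable_pair1 x)).
by move=> y _ /=; case: ifP => // _; rewrite lee_fin normr0.
Qed.

Let KE (c : R * R -> bool) : measurable_fun setT c ->
  fubini_F mu (K c) =
  EFin \o (fun x => u1 x * \int[mu]_y (if c (x, y) then u2 y else 0)).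
Proof.
move=> mc; apply/funext => x; rewrite /fubini_F /K /=.
rewrite (_ : (fun y => _) = fun y => (u1 x)%:E *
    (if c (x, y) then u2 y else 0)%:E)%E; last first.
  by apply/funext => y; case: ifP => _; rewrite -EFinM // mulr0.
have h := integrable_section x mc.
by rewrite integralZl // EFinM fineK //; exact: integrable_fin_num.
Qed.

Lemma integrable_triangle (c : R * R -> bool) : measurable_fun setT c ->
  mu.-integrable setT
    (EFin \o (fun x => u1 x * \int[mu]_y (if c (x, y) then u2 y else 0))).
Proof.
by move=> mc; rewrite -KE //; apply: integrable_fubini_F; exact: integrable_cut.
Qed.

Lemma Fubini_cut (c : R * R -> bool) : measurable_fun setT c ->
  \int[mu]_x (u1 x * \int[mu]_y (if c (x, y) then u2 y else 0))
  = fine (\int[mu]_y \int[mu]_x K c (x, y))%E.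
Proof.
move=> mc; rewrite -(Fubini (integrable_cut mc)).
by rewrite -/(fubini_F mu (K c)) KE.
Qed.

End TriangleFubini.

Section IntegralProduct.
Context {R : realType}.
Local Notation mu := (@lebesgue_measure R).
Variables u1 u2 : R -> R.
Hypothesis i1 : mu.-integrable [set: R] (EFin \o u1).
Hypothesis i2 : mu.-integrable [set: R] (EFin \o u2).

Lemma Rintegral_cut_swap (c : R * R -> bool) : measurable_fun setT c ->
  \int[mu]_x (u1 x * \int[mu]_y (if c (x, y) then u2 y else 0))
  = \int[mu]_y (u2 y * \int[mu]_x (if c (x, y) then u1 x else 0)).
Proof.
move=> mc; pose c' (z : R * R) := c (z.2, z.1).
have mc' : measurable_fun setT c'.
  by apply: (measurableT_comp mc); exact: measurable_fun_pair.
rewrite (Fubini_cut i1 i2 mc).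
rewrite -(_ : (fun z => u2 z * \int[mu]_x (if c' (z, x) then u1 x else 0))
  = (fun y => u2 y * \int[mu]_x (if c (x, y) then u1 x else 0))) //.
rewrite (Fubini_cut i2 i1 mc'); congr fine.
apply: etrans (Fubini (integrable_cut i2 i1 mc')).
by apply: eq_integral => y _; apply: eq_integral => x _; rewrite /c' /= mulrC.
Qed.

(** The plane is the disjoint union of y <= x and x < y; on the second half the order of integration
    is exchanged. For functions cut off to an interval this is integration by parts of their
    primitives. *)
Lemma Rintegral_mul_triangle :
  (\int[mu]_x u1 x) * (\int[mu]_x u2 x)
  = \int[mu]_x (u1 x * \int[mu]_y (if y <= x then u2 y else 0))
  + \int[mu]_x (u2 x * \int[mu]_y (if y < x then u1 y else 0)).
Proof.
pose c (z : R * R) := z.2 <= z.1; pose c' (z : R * R) := z.1 < z.2.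
have mc : measurable_fun setT c by apply: measurable_fun_ler.
have mc' : measurable_fun setT c' by apply: measurable_fun_ltr.
rewrite -(Rintegral_cut_swap mc') -RintegralD //;
  [|exact: (integrable_triangle i1 i2 mc)|exact: (integrable_triangle i1 i2 mc')].
rewrite -RintegralZr //; apply: eq_Rintegral => x _; rewrite -mulrDr.
rewrite -RintegralD //;
  [|exact: (integrable_section i2 _ mc)|exact: (integrable_section i2 _ mc')].
congr (_ * _); apply: eq_Rintegral => y _.
by rewrite /c /c' /=; case: leP; rewrite ?addr0 ?add0r.
Qed.

End IntegralProduct.

Section IntegrableReal.
Context {R : realType} d (T : measurableType d) (m : {measure set T -> \bar R}).
Implicit Types (D : set T) (f g : T -> R).

Lemma integrableDR D f g : measurable D ->
  m.-integrable D (EFin \o f) -> m.-integrable D (EFin \o g) ->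
  m.-integrable D (EFin \o (fun x => f x + g x)).
Proof. by move=> mD fi gi; have := integrableD mD fi gi. Qed.

Lemma integrableZlR D c f : measurable D ->
  m.-integrable D (EFin \o f) ->
  m.-integrable D (EFin \o (fun x => c * f x)).
Proof. by move=> mD fi; have := integrableZl mD c fi. Qed.

End IntegrableReal.

Section AbsolutelyContinuous.
Context {R : realType}.
Local Notation mu := (@lebesgue_measure R).
Implicit Types (a b t : R) (f g : R -> R).

(* f is absolutely continuous on [a, b] with almost everywhere derivative g. *)
Definition ac_on a b f g : Prop :=
  mu.-integrable `[a, b] (EFin \o g) /\
  forall t, a <= t <= b -> f t = f a + \int[mu]_(x in `[a, t]) g x.

Lemma ac_integrable a b f g t : ac_on a b f g -> t <= b ->
  mu.-integrable `[a, t] (EFin \o g).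
Proof.
move=> [ig _] tb; apply: integrableS ig => //.
by apply: subset_itvl; rewrite bnd_simp.
Qed.

Lemma patch_itvE a t g x : (g \_ `[a, t]) x = if a <= x <= t then g x else 0.
Proof. by rewrite patchE mem_setE in_itv. Qed.

(** Apply [Rintegral_mul_triangle] to g1 and g2 cut off to [a, t]: the inner integrals are f1 - f1 a
    and f2 - f2 a. *)
Lemma ac_mul a b f1 g1 f2 g2 : ac_on a b f1 g1 -> ac_on a b f2 g2 ->
  ac_on a b (fun t => f1 t * f2 t) (fun t => f1 t * g2 t + g1 t * f2 t).
Proof.
move=> ac1 ac2; have [i1 E1] := ac1; have [i2 E2] := ac2.
have ip (g : R -> R) t : mu.-integrable `[a, t] (EFin \o g) ->
    mu.-integrable setT (EFin \o g \_ `[a, t]).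
  by move=> ig; rewrite -restrict_EFin; apply: (proj1 (integrable_mkcond _ _)).
have inner (f g h : R -> R) t (c : R -> R -> bool) : ac_on a b f g -> t <= b ->
    (forall x, a <= x <= t -> \int[mu]_y (if c x y then (g \_ `[a, t]) y else 0)
       = \int[mu]_(y in `[a, x]) g y) ->
    (fun x => (h \_ `[a, t]) x
        * \int[mu]_y (if c x y then (g \_ `[a, t]) y else 0))
    = (fun x => h x * (f x - f a)) \_ `[a, t].
  move=> [_ E] tb H; apply/funext => x; rewrite !patch_itvE.
  case: ifP => [xt|]; last by rewrite mul0r.
  have xb : a <= x <= b by case/andP: (xt) => -> /= xt'; exact: le_trans tb.
  by rewrite H // (E x xb); congr (_ * _); ring.
have in1 t x : a <= x <= t ->
    \int[mu]_y (if y <= x then (g2 \_ `[a, t]) y else 0)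
    = \int[mu]_(y in `[a, x]) g2 y.
  move=> /andP[ax xt]; rewrite [RHS]Rintegral_mkcond; apply: eq_Rintegral => y _.
  rewrite !patch_itvE; case: ifPn => yx; last by rewrite andbF.
  by rewrite (le_trans yx xt).
have in2 t x : t <= b -> a <= x <= t ->
    \int[mu]_y (if y < x then (g1 \_ `[a, t]) y else 0)
    = \int[mu]_(y in `[a, x]) g1 y.
  move=> tb /andP[ax xt].
  rewrite -(Rintegral_itv_bndo_bndc (a := BLeft a) (r := x)); last first.
    apply: integrableS (ac_integrable ac1 (le_trans xt tb)) => //.
    by apply: subset_itvl; rewrite bnd_simp.
  rewrite [RHS]Rintegral_mkcond; apply: eq_Rintegral => y _.
  rewrite patch_itvE patchE mem_setE in_itv /=.
  case: ifPn => yx; last by rewrite andbF.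
  by rewrite (le_trans (ltW yx) xt).
have j1 t : t <= b -> mu.-integrable `[a, t] (EFin \o (fun x => g1 x * (f2 x - f2 a))).
  move=> tb; apply: (proj2 (integrable_mkcond _ _)) => //; rewrite restrict_EFin.
  rewrite -(inner _ _ g1 t (fun x y => y <= x) ac2 tb) ?in1 //; last exact: in1.
  apply: (integrable_triangle (ip _ _ (ac_integrable ac1 tb))
    (ip _ _ (ac_integrable ac2 tb)) (c := fun z => z.2 <= z.1)).
  exact: measurable_fun_ler.
have j2 t : t <= b -> mu.-integrable `[a, t] (EFin \o (fun x => g2 x * (f1 x - f1 a))).
  move=> tb; apply: (proj2 (integrable_mkcond _ _)) => //; rewrite restrict_EFin.
  rewrite -(inner _ _ g2 t (fun x y => y < x) ac1 tb) //; last first.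
    by move=> x; exact: in2.
  apply: (integrable_triangle (ip _ _ (ac_integrable ac2 tb))
    (ip _ _ (ac_integrable ac1 tb)) (c := fun z => z.2 < z.1)).
  exact: measurable_fun_ltr.
have iZ t c (g : R -> R) : mu.-integrable `[a, t] (EFin \o g) ->
    mu.-integrable `[a, t] (EFin \o (fun x => c * g x)).
  exact: integrableZlR.
have iD t (f g : R -> R) : mu.-integrable `[a, t] (EFin \o f) ->
    mu.-integrable `[a, t] (EFin \o g) ->
    mu.-integrable `[a, t] (EFin \o (fun x => f x + g x)).
  exact: integrableDR.
(* Only the primitives vanishing at a come from the triangles, so the constants f1 a and f2 a are
   split off. *)
have dE : (fun t => f1 t * g2 t + g1 t * f2 t) = fun t =>
    (g1 t * (f2 t - f2 a) + g2 t * (f1 t - f1 a)) + (f2 a * g1 t + f1 a * g2 t).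
  by apply/funext => t; ring.
split.
  by rewrite dE; apply: (iD); apply: (iD); [exact: j1|exact: j2|exact: iZ|exact: iZ].
move=> t /andP[a_t tb]; rewrite dE.
have k1 := ac_integrable ac1 tb; have k2 := ac_integrable ac2 tb.
rewrite RintegralD //; [|by apply: (iD); [exact: j1|exact: j2]
                        |by apply: (iD); exact: iZ].
rewrite RintegralD //; [|exact: j1|exact: j2].
rewrite [X in _ + (_ + X)]RintegralD //; [|exact: iZ|exact: iZ].
rewrite !RintegralZl //.
have := Rintegral_mul_triangle (ip _ _ k1) (ip _ _ k2).
rewrite (inner _ _ g1 t (fun x y => y <= x) ac2 tb) //; last exact: in1.
rewrite (inner _ _ g2 t (fun x y => y < x) ac1 tb) //; last first.
  by move=> x; exact: in2.
rewrite -!Rintegral_mkcond.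
rewrite (E1 t) ?a_t // (E2 t) ?a_t // => P.
by rewrite mulrDl !mulrDr P; ring.
Qed.

Lemma ac_add a b f1 g1 f2 g2 : ac_on a b f1 g1 -> ac_on a b f2 g2 ->
  ac_on a b (fun t => f1 t + f2 t) (fun t => g1 t + g2 t).
Proof.
move=> ac1 ac2; have [i1 E1] := ac1; have [i2 E2] := ac2.
split; first exact: integrableDR.
move=> t /andP[a_t tb]; rewrite (E1 t) ?a_t // (E2 t) ?a_t //.
rewrite RintegralD //; [ring|exact: ac_integrable ac1 tb
                            |exact: ac_integrable ac2 tb].
Qed.

Lemma ac_cst a b c : ac_on a b (fun=> c) (fun=> 0).
Proof.
split; first by apply: integrable0.
by move=> t _; rewrite Rintegral_cst // mul0r addr0.
Qed.

Lemma ac_scale a b c f g : ac_on a b f g ->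
  ac_on a b (fun t => c * f t) (fun t => c * g t).
Proof.
move=> h; have := ac_mul (ac_cst a b c) h.
rewrite (_ : (fun t => c * g t + _) = (fun t => c * g t)) //.
by apply/funext => t; rewrite mul0r addr0.
Qed.

Lemma ac_sum a b (s : seq nat) (P : pred nat) (f g : nat -> R -> R) :
  (forall i, P i -> ac_on a b (f i) (g i)) ->
  ac_on a b (fun t => \sum_(i <- s | P i) f i t)
            (fun t => \sum_(i <- s | P i) g i t).
Proof.
move=> h; elim: s => [|i s IH].
  have -> : (fun t => \sum_(i <- [::] | P i) f i t) = fun=> 0.
    by apply/funext => t; rewrite big_nil.
  have -> : (fun t => \sum_(i <- [::] | P i) g i t) = fun=> 0.
    by apply/funext => t; rewrite big_nil.
  exact: ac_cst.
have E (k : nat -> R -> R) : (fun t => \sum_(i <- i :: s | P i) k i t) =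
    if P i then fun t => k i t + \sum_(i <- s | P i) k i t
    else fun t => \sum_(i <- s | P i) k i t.
  by case: ifPn => Pi; apply/funext => t; rewrite big_cons ?Pi ?(negbTE Pi).
by rewrite !E; case: ifPn => // Pi; apply: ac_add => //; exact: h.
Qed.

Lemma ac_sum_nat a b m n (f g : nat -> R -> R) :
  (forall i, (m <= i < n)%N -> ac_on a b (f i) (g i)) ->
  ac_on a b (fun t => \sum_(m <= i < n) f i t)
            (fun t => \sum_(m <= i < n) g i t).
Proof.
move=> h; have := ac_sum (index_iota m n) h.
congr (ac_on _ _ _ _); apply/funext => t; exact/esym/big_nat.
Qed.

Lemma ac_derive a b f g : a < b -> (forall t, is_derive t 1 f (g t)) ->
  continuous g -> ac_on a b f g.
Proof.
move=> ab df cg.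
have cf : continuous f.
  move=> t; apply: differentiable_continuous; apply/derivable1_diffP.
  by have [] := df t.
have ig : forall t, mu.-integrable `[a, t] (EFin \o g).
  move=> t; apply: continuous_compact_integrable; first exact: segment_compact.
  exact: continuous_subspaceT.
split=> // t /andP[]; rewrite le_eqVlt => /predU1P[<- _|a_t tb].
  by rewrite set_itv1 Rintegral_set1 addr0.
rewrite /Rintegral (@continuous_FTC2 _ g f a t a_t) /=.
- by ring.
- exact: continuous_subspaceT.
- split.
  + by move=> x _; have [] := df x.
  + by apply: cvg_at_right_filter; exact: cf.
  + by apply: cvg_at_left_filter; exact: cf.
- by move=> x _; rewrite derive1E; have [_ ->] := df x.
Qed.

Lemma ac_continuous a b f g : a <= b -> ac_on a b f g ->
  {within `[a, b], continuous f}.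
Proof.
move=> ab [ig E].
have c := parameterized_integral_continuous ab ig.
have {}c : {within `[a, b], continuous
    (fun x => f a + parameterized_integral mu a x g)}.
  by move=> x; apply: cvgD; [exact: cvg_cst|exact: c].
apply: (subspace_eq_continuous _ c) => x; rewrite inE /= in_itv /= => h.
exact: esym (E x h).
Qed.

Lemma ac_trace0 a b f g : a <= b -> ac_on a b f g -> f a = 0 -> f b = 0 ->
  \int[mu]_(x in `[a, b]) g x = 0.
Proof.
move=> ab [_ E] fa fb; have := E b; rewrite ab lexx => /(_ isT).
by rewrite fa fb add0r => <-.
Qed.

End AbsolutelyContinuous.

(** * Weak derivatives *)

Section Bump.
Context {R : realType}.

(** A quadratic remainder bound treats the square of the positive part uniformly, including the
    point 0 where two formulas meet. *)
Lemma is_derive_quadratic (f : R -> R) (x l C : R) :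
  (forall h, `|f (x + h) - f x - l * h| <= C * h ^+ 2) -> is_derive x 1 f l.
Proof.
move=> H; have C0 : 0 < C + 1.
  by have := le_trans (normr_ge0 _) (H 1); rewrite expr1n mulr1 => C0; rewrite ltr_wpDl.
have cv : h^-1 *: (f (h *: 1 + x) - f x) @[h --> 0^'] --> l.
  apply/cvgrPdist_le => e e0; near=> h.
  have h0 : h != 0 by near: h; exact: nbhs_dnbhs_neq.
  have nh0 : 0 < `|h| by rewrite normr_gt0.
  have -> : l - h^-1 *: (f (h *: 1 + x) - f x) = - h^-1 * (f (x + h) - f x - l * h).
    rewrite /GRing.scale /= mulr1 [h + x]addrC; field.
    exact: h0.
  rewrite normrM normrN normfV mulrC ler_pdivrMr // (le_trans (H h)) //.
  rewrite -real_normK ?num_real // expr2 mulrA ler_pM2r //.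
  apply: (@le_trans _ _ ((C + 1) * `|h|)); first by rewrite ler_pM2r // lerDl.
  rewrite mulrC -ler_pdivlMr //; near: h; apply: dnbhs0_le.
  by rewrite divr_gt0.
by split; [apply/cvg_ex; exists l|apply/cvg_lim].
Unshelve. all: by end_near. Qed.

Lemma is_derive_sqr_pos (y : R) :
  is_derive y 1 (fun y : R => Num.max 0 y ^+ 2) (2 * Num.max 0 y).
Proof.
apply: (@is_derive_quadratic _ _ _ 1) => h; rewrite mul1r.
have h2 := sqr_ge0 h; have yh2 := sqr_ge0 (y + h).
case: (leP 0 y) => hy; case: (leP 0 (y + h)) => hyh; rewrite ler_norml;
  apply/andP; split; try lra.
- by have := mulr_ge0 hy (_ : 0 <= - (y + h)); rewrite oppr_ge0 => /(_ (ltW hyh)); nra.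
- by have := mulr_ge0 (_ : 0 <= - y) hyh; rewrite oppr_ge0 => /(_ (ltW hy)); nra.
Qed.

Variables (n : nat) (a b : R).

Let q (t : R) : R := Num.max 0 ((t - a) * (b - t)) ^+ 2.
Let dq (t : R) : R := 2 * Num.max 0 ((t - a) * (b - t)) * (a + b - 2 * t).

(** Since q is the square of the positive part of (t - a) (b - t), this is C^1, takes values in
    [0, 1], vanishes off ]a, b[, and tends pointwise to the indicator of ]a, b[ as n grows. *)
Definition bumpf (t : R) : R := n%:R * q t / (1 + n%:R * q t).

Let dbump (t : R) : R := n%:R * dq t / (1 + n%:R * q t) ^+ 2.

Let q_ge0 t : 0 <= q t. Proof. exact: sqr_ge0. Qed.

Let den_gt0 t : 0 < 1 + n%:R * q t.
Proof. by rewrite ltr_pwDl // mulr_ge0. Qed.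

Lemma is_derive_bumpf (t : R) : is_derive t 1 bumpf (dbump t).
Proof.
have dp : is_derive t 1 (fun t : R => (t - a) * (b - t)) (a + b - 2 * t).
  apply: is_derive_eq; rewrite /GRing.scale /=; ring.
have Dq : is_derive t 1 q (dq t).
  have := @is_derive1_comp _ _ (fun t : R => (t - a) * (b - t)) t _ _
    (is_derive_sqr_pos _) dp.
  exact.
have Dd : is_derive t 1 (fun t : R => (1 + n%:R * q t)^-1)
    (- (1 + n%:R * q t) ^- 2 *: (n%:R * dq t)).
  apply: is_deriveV; first by rewrite gt_eqF.
  by apply: is_derive_eq; rewrite /GRing.scale /=; ring.
rewrite /bumpf; apply: is_derive_eq; rewrite /GRing.scale /= /dbump.
have D0 : 1 + n%:R * q t != 0 by rewrite gt_eqF.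
field; exact: D0.
Qed.

Lemma bumpf_ge0 t : 0 <= bumpf t <= 1.
Proof.
have h : 0 <= n%:R * q t by rewrite mulr_ge0.
rewrite /bumpf divr_ge0 //=; last by rewrite addr_ge0.
by rewrite ler_pdivrMr // mul1r lerDr.
Qed.

Lemma bumpf_out t : a <= b -> ~~ (a < t < b) -> bumpf t = 0.
Proof.
move=> ab h; rewrite /bumpf /q; suff -> : Num.max 0 ((t - a) * (b - t)) = 0.
  by rewrite expr0n /= mulr0 mul0r.
apply/max_idPl; move: h; rewrite negb_and -!leNgt => /orP[ta|bt].
  by rewrite mulr_le0_ge0 // ?subr_le0 // subr_ge0 (le_trans ta).
by rewrite mulr_ge0_le0 // ?subr_le0 // subr_ge0 (le_trans ab).
Qed.

Lemma bumpf_in t : a < t < b -> bumpf t = 1 - (1 + n%:R * ((t - a) * (b - t)) ^+ 2)^-1.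
Proof.
move=> /andP[ta tb]; rewrite /bumpf; have := den_gt0 t; rewrite /q.
rewrite (_ : Num.max 0 _ = (t - a) * (b - t)); last first.
  by apply/max_idPr; rewrite mulr_ge0 // subr_ge0 ltW.
by move=> h; field; rewrite gt_eqF.
Qed.

Lemma continuous_dbump : continuous dbump.
Proof.
have cp : continuous (fun t : R => (t - a) * (b - t)).
  by move=> t; apply: cvgM; apply: cvgB; (exact: cvg_id || exact: cvg_cst).
have cq : continuous (fun t : R => Num.max 0 ((t - a) * (b - t))).
  rewrite (_ : (fun t => _) = fun t : R =>
      (0 + (t - a) * (b - t) + `|0 - (t - a) * (b - t)|) / 2); last first.
    by apply/funext => t; rewrite maxr_absE.
  move=> t; apply: cvgM; last exact: cvg_cst.
  apply: cvgD; first by apply: cvgD; [exact: cvg_cst|exact: cp].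
  by apply: cvg_norm; apply: cvgB; [exact: cvg_cst|exact: cp].
have cQ : continuous (fun t => 1 + n%:R * q t).
  move=> t; apply: cvgD; first exact: cvg_cst.
  apply: cvgM; first exact: cvg_cst.
  by rewrite /q; under eq_fun do rewrite expr2; rewrite expr2; apply: cvgM; exact: cq.
move=> t; rewrite /dbump /dq; apply: cvgM.
  apply: cvgM; first exact: cvg_cst.
  apply: cvgM; first by apply: cvgM; [exact: cvg_cst|exact: cq].
  apply: cvgB; first exact: cvg_cst.
  by apply: cvgM; [exact: cvg_cst|exact: cvg_id].
apply: cvgV; first by rewrite expf_neq0 // gt_eqF.
by under eq_fun do rewrite expr2; rewrite expr2; apply: cvgM; exact: cQ.
Qed.

Lemma test_function_bumpf (T : R) : a <= b -> - T < a -> b < T -> test_function T bumpf.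
Proof.
move=> ab Ta bT; split.
- by move=> t; have [] := is_derive_bumpf t.
- have -> : derive1 bumpf = dbump.
    by apply/funext => t; rewrite derive1E; have [_ ->] := is_derive_bumpf t.
  exact: continuous_dbump.
- exists `[a, b]%classic; split; first exact: segment_compact.
    by apply: subset_itv; rewrite bnd_simp.
  move=> t /= ht; apply: bumpf_out => //; apply/negP => /andP[ta tb]; apply: ht.
  by rewrite in_itv /= !ltW.
Qed.

End Bump.

Section WeakDerivative.
Context {R : realType}.
Local Notation mu := (@lebesgue_measure R).
Implicit Types (a b t T : R) (f g h : R -> R).

Lemma ae_imp (P Q : R -> Prop) : (forall t, P t -> Q t) ->
  {ae mu, forall t, P t} -> {ae mu, forall t, Q t}.
Proof.
move=> PQ [A [mA A0 PA]]; exists A; split => //.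
by apply: subset_trans PA => t /= nQ /PQ.
Qed.

Lemma ae_imp2 (P1 P2 Q : R -> Prop) : (forall t, P1 t -> P2 t -> Q t) ->
  {ae mu, forall t, P1 t} -> {ae mu, forall t, P2 t} -> {ae mu, forall t, Q t}.
Proof.
(* The two properties are packed into a sequence, constant from index 1 on, to use the countable
   intersection of full sets. *)
move=> PQ H1 H2; have := ae_foralln (fun n => if n is 0%N return
  {ae mu, forall t, (if n is 0%N then P1 else P2) t} then H1 else H2).
by apply: ae_imp => t H; exact: PQ (H 0%N) (H 1%N).
Qed.

Lemma locally_integrable_itv T h a b : locally_integrable (time_itv T) h ->
  - T < a -> b < T -> mu.-integrable `[a, b] (EFin \o h).
Proof.
move=> [mh _ ih] Ta bT.
have s : `[a, b] `<=` time_itv T by apply: subset_itv; rewrite bnd_simp.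
apply/integrableP; split.
  by apply/measurable_EFinP; apply: measurable_funS mh => //; exact: measurable_itv.
by have := ih _ s (@segment_compact _ a b).
Qed.

Lemma measurable_bumpf n a b (D : set R) : measurable_fun D (bumpf n a b).
Proof.
apply: measurable_funTS; apply: continuous_measurable_fun => t.
apply: differentiable_continuous; apply/derivable1_diffP.
by have [] := is_derive_bumpf n a b t.
Qed.

Lemma cvg_integral_bump a b h : a <= b -> mu.-integrable `[a, b] (EFin \o h) ->
  (\int[mu]_(t in `[a, b]) (h t * bumpf n a b t)%:E)%E @[n --> \oo] -->
  (\int[mu]_(t in `]a, b[) (h t)%:E)%E.
Proof.
move=> ab ih; have mh : measurable_fun `[a, b] h.
  by move/integrableP : ih => [/measurable_EFinP].
have -> : (\int[mu]_(t in `]a, b[) (h t)%:E)%E =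
    (\int[mu]_(t in `[a, b]) ((EFin \o h) \_ `]a, b[ t))%E.
  rewrite -integral_mkcondr; congr (integral _ _ _); apply/esym/setIidr.
  exact: subset_itv_oo_cc.
have mf n : measurable_fun `[a, b] (fun t => (h t * bumpf n a b t)%:E).
  by apply/measurable_EFinP; apply: measurable_funM => //; exact: measurable_bumpf.
have ml : measurable_fun `[a, b] ((EFin \o h) \_ `]a, b[).
  apply/measurable_restrict => //.
  apply: measurable_funS (_ : measurable_fun `[a, b] (EFin \o h)) => //.
  exact/measurable_EFinP.
have cv : {ae mu, forall t, `[a, b]%classic t ->
    (h t * bumpf n a b t)%:E @[n --> \oo] --> ((EFin \o h) \_ `]a, b[) t}.
  apply: aeW => t _; rewrite patchE mem_setE in_itv /=.
  case: ifPn => tab; last first.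
    by under eq_fun do rewrite bumpf_out // mulr0; exact: cvg_cst.
  apply: cvg_EFin; first exact: nearW.
  pose c := ((t - a) * (b - t)) ^+ 2.
  have c0 : 0 < c.
    by case/andP: tab => ? ?; rewrite exprn_gt0 // mulr_gt0 // subr_gt0.
  have c1 : 1 - (1 + n%:R * c)^-1 @[n --> \oo] --> (1 : R).
    rewrite (_ : nbhs (1 : R) = nbhs (1 - 0 : R)); last by rewrite subr0.
    apply: cvgB; first exact: cvg_cst.
    apply/cvgrPdist_le => e e0; near=> n.
    have nc : 0 < 1 + n%:R * c by rewrite ltr_pwDl // mulr_ge0 // ltW.
    rewrite sub0r normrN gtr0_norm ?invr_gt0 // invf_ple // ler_wpDl //.
    by rewrite -ler_pdivrMr //; near: n; exact: nbhs_infty_ger.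
  rewrite (_ : fine \o _ = fun n => h t * (1 - (1 + n%:R * c)^-1)); last first.
    by apply/funext => n; rewrite /= (bumpf_in _ tab).
  rewrite (_ : nbhs (h t) = nbhs (h t * 1)); last by rewrite mulr1.
  by apply: cvgM c1; exact: cvg_cst.
have dom : {ae mu, forall t (n : nat), `[a, b]%classic t ->
    (`|(h t * bumpf n a b t)%:E| <= `|h t|%:E)%E}.
  apply: aeW => t n _; rewrite lee_fin normrM ler_piMr //.
  by have /andP[u0 u1] := bumpf_ge0 n a b t; rewrite ger0_norm.
by have [] := @dominated_convergence _ _ R mu _ (measurable_itv _) _ _ _
  mf ml cv (integrable_norm ih) dom.
Unshelve. all: by end_near. Qed.

Lemma integral_bump_itv T n a b h : a <= b -> - T < a -> b < T ->
  \int[mu]_(t in time_itv T) (h t * bumpf n a b t)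
  = \int[mu]_(t in `[a, b]) (h t * bumpf n a b t).
Proof.
move=> ab Ta bT; rewrite Rintegral_mkcond [RHS]Rintegral_mkcond.
apply: eq_Rintegral => t _; rewrite !patchE !mem_setE !in_itv /=.
case: ifPn; case: ifPn => //.
  move=> h1 _; rewrite bumpf_out ?mulr0 //.
  by apply: contra h1 => /andP[ta tb]; rewrite !ltW.
by move=> /andP[ta tb]; rewrite (lt_le_trans Ta ta) (le_lt_trans tb bT).
Qed.

Lemma bump_null_itv T h a b : locally_integrable (time_itv T) h ->
  a <= b -> - T < a -> b < T ->
  (forall n, \int[mu]_(t in time_itv T) (h t * bumpf n a b t) = 0) ->
  \int[mu]_(t in `[a, b]) h t = 0.
Proof.
move=> lh ab Ta bT H; have ih := locally_integrable_itv lh Ta bT.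
have ihb n : mu.-integrable `[a, b] (fun t => (h t * bumpf n a b t)%:E).
  apply: (le_integrable _ _ _ ih) => //.
    apply/measurable_EFinP; apply: measurable_funM; last exact: measurable_bumpf.
    by move/integrableP : ih => [/measurable_EFinP].
  move=> t _; rewrite lee_fin normrM ler_piMr //.
  by have /andP[u0 u1] := bumpf_ge0 n a b t; rewrite ger0_norm.
have := cvg_integral_bump ab ih.
under eq_fun => n.
  rewrite (_ : (\int[_]_(_ in _) _)%E = 0%E); first over.
  rewrite -[LHS]fineK; last exact: integrable_fin_num.
  by have := H n; rewrite (integral_bump_itv n h ab Ta bT) /Rintegral => ->.
move=> c0; have E := cvg_unique _ c0 (cvg_cst _).
rewrite -(@Rintegral_itv_obnd_cbnd _ a (BRight b)); last first.
  by apply: integrableS ih => //; apply: subset_itvr; rewrite bnd_simp.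
rewrite -(@Rintegral_itv_bndo_bndc _ (BRight a)); last first.
  by apply: integrableS ih => //; exact: subset_itv_oo_cc.
by rewrite /Rintegral E.
Qed.

(** Letting n grow in the bumps shows that h has zero integral over [a, c] for every c. The
    primitive of h is then zero, and Lebesgue differentiation gives h = 0 almost everywhere. *)
Lemma bumpf_null_ae_itv T h a b : locally_integrable (time_itv T) h ->
  - T < a -> b < T ->
  (forall n c, a <= c < b ->
    \int[mu]_(t in time_itv T) (h t * bumpf n a c t) = 0) ->
  {ae mu, forall t, a < t < b -> h t = 0}.
Proof.
move=> lh Ta bT H; pose f := h \_ `[a, b].
have ih := locally_integrable_itv lh Ta bT.
have if_ y : mu.-integrable [set` Interval (BLeft a) (BRight y)] (EFin \o f).
  have : mu.-integrable setT (EFin \o f).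
    by rewrite -restrict_EFin; apply: (proj1 (integrable_mkcond _ _)).
  by apply: integrableS.
have := FTC1 if_ (integrable_locally (measurable_itv _) ih).
apply: ae_imp => x /= + /andP[ax xb]; rewrite lte_fin => /(_ ax) [_].
have F0 : \forall y \near x, (fun=> 0 : R) y = \int[mu]_(t in `[a, y]) f t.
  near=> y; have ay : a < y by near: y; exact: lt_nbhsr.
  have yb : y < b by near: y; exact: lt_nbhsl.
  rewrite -(@bump_null_itv T h a y lh (ltW ay) Ta (lt_trans yb bT)); last first.
    by move=> n; apply: H; rewrite ltW.
  apply: eq_Rintegral => t; rewrite inE /= in_itv /= => /andP[a_t ty].
  by rewrite /f patchE mem_setE in_itv /= a_t (le_trans ty (ltW yb)).
rewrite derive1E -(near_eq_derive _ F0) ?oner_eq0 // derive_cst => ->.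
by rewrite /f patchE mem_setE in_itv /= !ltW.
Unshelve. all: by end_near. Qed.

Lemma bumpf_null_ae T h : locally_integrable (time_itv T) h ->
  (forall n a b, a <= b -> - T < a -> b < T ->
    \int[mu]_(t in time_itv T) (h t * bumpf n a b t) = 0) ->
  {ae mu, forall t, time_itv T t -> h t = 0}.
Proof.
move=> lh H.
have K n : {ae mu, forall t, - T + n.+1%:R^-1 < t < T - n.+1%:R^-1 -> h t = 0}.
  apply: (bumpf_null_ae_itv lh); rewrite ?ltrDl ?ltrBlDr ?invr_gt0 //.
    by rewrite ltrDl invr_gt0.
  move=> m c /andP[nc cn]; apply: H => //; first by rewrite ltrDl invr_gt0.
  by rewrite (lt_trans cn) // ltrBlDr ltrDl invr_gt0.
have := ae_foralln K.
apply: ae_imp => t /= {}K.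
rewrite /time_itv /= in_itv /= => /andP[Tt tT].
have m0 : 0 < Num.min (T - t) (T + t).
  by rewrite lt_min !subr_gt0 tT -ltrBlDl sub0r.
have [n _ /(_ n (leqnn n))] := near_infty_natSinv_lt (PosNum m0).
rewrite /= lt_min => /andP[n1 n2].
have {K} := K n; move: (n.+1%:R^-1 : R) n1 n2 => r n1 n2; apply.
by apply/andP; split; lra.
Qed.

End WeakDerivative.

(** * Weakly differentiable functions as primitives *)

Section WeakRepresentation.
Context {R : realType}.
Local Notation mu := (@lebesgue_measure R).
Implicit Types (a b t T : R) (f g h k : R -> R).

Lemma integrableBR (D : set R) f g : measurable D ->
  mu.-integrable D (EFin \o f) -> mu.-integrable D (EFin \o g) ->
  mu.-integrable D (EFin \o (fun x => f x - g x)).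
Proof.
move=> mD fi gi; apply: integrableDR => //.
rewrite (_ : _ \o _ = EFin \o (fun x => -1 * g x)).
  exact: integrableZlR.
by apply/funext => x /=; rewrite mulN1r.
Qed.

Lemma locally_integrable_mul T f k a b (M : R) : locally_integrable (time_itv T) f ->
  - T < a -> b < T -> measurable_fun setT k -> (forall t, `|k t| <= M) ->
  (forall t, ~~ (a <= t <= b) -> k t = 0) ->
  mu.-integrable (time_itv T) (EFin \o (fun t => f t * k t)).
Proof.
move=> lf Ta bT mk kM k0; have fi := locally_integrable_itv lf Ta bT.
have i1 : mu.-integrable `[a, b] (EFin \o (fun t => f t * k t)).
  have M0 : 0 <= M by apply: le_trans (kM 0).
  apply: (le_integrable _ _ _ (integrableZlR M _ fi)) => //.
    apply/measurable_EFinP; apply: measurable_funM; last exact: measurable_funTS.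
    by move/integrableP : fi => [/measurable_EFinP].
  by move=> t _ /=; rewrite lee_fin !normrM mulrC (ger0_norm M0) ler_wpM2r.
apply: (proj2 (integrable_mkcond _ _)); first exact: measurable_itv.
have /(_ (measurable_itv _)) := fun m => proj1 (integrable_mkcond _ m) i1.
rewrite (_ : (_ \_ _) = (EFin \o (fun t => f t * k t)) \_ (time_itv T)) //; last first.
apply/funext => t; rewrite !patchE !mem_setE /time_itv !in_itv /=.
case: ifPn => h1; case: ifPn => h2 //=.
- case/andP: h1 => h3 h4.
  by move: h2; rewrite (lt_le_trans Ta h3) (le_lt_trans h4 bT).
- by rewrite k0 // mulr0.
Qed.

Lemma primitive_ac T g : 0 <= T -> mu.-integrable (time_itv T) (EFin \o g) ->
  let G t := \int[mu]_(x in `[- T, t]) g x in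
  G (- T) = 0 /\ ac_on (- T) T G g.
Proof.
move=> T0 ig G.
have GT : G (- T) = 0 by rewrite /G set_itv1 Rintegral_set1.
split=> //; split; last by move=> t _; rewrite GT add0r.
apply/integrableP; move/integrableP : ig => [/measurable_EFinP mg fg].
have mc : measurable_fun `[- T, T] g by apply: measurable_fun_itv_cc mg.
have mo : measurable_fun `]- T, T] g by apply: measurable_fun_itv_oc mg.
split; first exact/measurable_EFinP.
move: fg; rewrite /time_itv integral_itv_bndo_bndc; last first.
  by apply: measurableT_comp => //; apply/measurable_EFinP.
rewrite integral_itv_obnd_cbnd //.
by apply: measurableT_comp => //; apply/measurable_EFinP.
Qed.

Lemma Rintegral_time_itv T g : 0 <= T -> mu.-integrable (time_itv T) (EFin \o g) ->
  \int[mu]_(x in time_itv T) g x = \int[mu]_(x in `[- T, T]) g x.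
Proof.
move=> T0 ig; have [_ [ig' _]] := primitive_ac T0 ig.
rewrite /time_itv Rintegral_itv_bndo_bndc // Rintegral_itv_obnd_cbnd //.
by apply: integrableS ig' => //; apply: subset_itvr; rewrite bnd_simp.
Qed.

Lemma integrable_bumpf T f n a b : locally_integrable (time_itv T) f ->
  a <= b -> - T < a -> b < T ->
  mu.-integrable (time_itv T) (EFin \o (fun t => f t * bumpf n a b t)).
Proof.
move=> lf ab Ta bT; apply: (locally_integrable_mul (M := 1) lf Ta bT).
- exact: measurable_bumpf.
- by move=> t; have /andP[u0 u1] := bumpf_ge0 n a b t; rewrite ger0_norm.
- move=> t h; apply: bumpf_out => //; apply: contra h => /andP[ta tb].
  by rewrite !ltW.
Qed.

Lemma weak_derivative_unique T f g1 g2 :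
  is_weak_derivative T f g1 -> is_weak_derivative T f g2 ->
  {ae mu, forall t, time_itv T t -> g1 t = g2 t}.
Proof.
move=> [_ l1 E1] [_ l2 E2].
have l12 := locally_integrableB l1 l2.
have := bumpf_null_ae l12.
have H n a b : a <= b -> - T < a -> b < T ->
    \int[mu]_(t in time_itv T) ((g1 \- g2) t * bumpf n a b t) = 0.
  move=> ab Ta bT; have tb := test_function_bumpf n ab Ta bT.
  under eq_Rintegral do rewrite mulrBl.
  rewrite RintegralB //; [|exact: measurable_itv|exact: integrable_bumpf|exact: integrable_bumpf].
  by apply/eqP; rewrite subr_eq0 -eqr_opp -(E1 _ tb) -(E2 _ tb).
move=> /(_ H); apply: ae_imp => t h Dt.
by apply/eqP; rewrite -subr_eq0; apply/eqP; exact: h.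
Qed.

Lemma weak_deriveP T f g : is_weak_derivative T f g ->
  is_weak_derivative T f (weak_derive T f).
Proof. by move=> fg; apply: (@xgetPex _ _ [set g | is_weak_derivative T f g]); exists g. Qed.

(** The integrals tend to b - a. Such a bump serves to normalise means in
    [weak_derivative_primitive]. *)
Lemma bumpf_integral_neq0 a b : a < b ->
  exists n, \int[mu]_(t in `[a, b]) bumpf n a b t <> 0.
Proof.
move=> ab; apply/existsNP => H.
have i1 : mu.-integrable `[a, b] (EFin \o (fun=> 1)).
  by apply: continuous_compact_integrable; [exact: segment_compact|
     apply: continuous_subspaceT => x; exact: cst_continuous].
have := cvg_integral_bump (ltW ab) i1.
under eq_fun => n.
  rewrite (_ : (\int[_]_(_ in _) _)%E = 0%E); first over.
  under eq_integral do rewrite mul1r.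
  have ib : mu.-integrable `[a, b] (EFin \o bumpf n a b).
    apply: (le_integrable _ _ _ i1) => //.
      by apply/measurable_EFinP; exact: measurable_bumpf.
    move=> t _ /=; rewrite lee_fin normr1.
    by have /andP[u0 u1] := bumpf_ge0 n a b t; rewrite ger0_norm.
  rewrite -[LHS]fineK; last exact: integrable_fin_num.
  by move: (H n); rewrite /Rintegral => ->.
move=> c0; have E := cvg_unique _ c0 (cvg_cst _).
have : (\int[mu]_(t in `]a, b[) 1%:E = 0)%E by rewrite E.
rewrite integral_cst //= mul1e lebesgue_measure_itv /= lte_fin ab.
rewrite -EFinD => -[] /eqP; rewrite subr_eq0 => /eqP ba.
by move: ab; rewrite ba ltxx.
Qed.

Lemma derivable_continuous k : (forall t, derivable k t 1) -> continuous k.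
Proof.
by move=> dk t; apply: differentiable_continuous; apply/derivable1_diffP.
Qed.

Lemma compact_support_bounded a b k : continuous k ->
  (forall t, ~~ (a <= t <= b) -> k t = 0) -> exists M, forall t, `|k t| <= M.
Proof.
move=> ck k0; have [ab|ba] := leP a b; last first.
  exists 0 => t; rewrite k0 ?normr0 //; apply/negP => /andP[ta tb].
  by move: (le_lt_trans (le_trans ta tb) ba); rewrite ltxx.
have cn : {within `[a, b], continuous (fun t => `|k t|)}.
  by apply: continuous_subspaceT => t; apply: cvg_norm; exact: ck.
have [c _ hc] := EVT_max ab cn; exists `|k c| => t.
have [tab|tab] := boolP (a <= t <= b); first by apply: hc; rewrite in_itv.
by rewrite (k0 t) // normr0.
Qed.

Lemma compact_support_integrable a b k : continuous k ->
  (forall t, ~~ (a <= t <= b) -> k t = 0) ->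
  mu.-integrable setT (EFin \o k) /\
  \int[mu]_(t in setT) k t = \int[mu]_(t in `[a, b]) k t.
Proof.
move=> ck k0; have E : k \_ `[a, b] = k.
  by apply/funext => t; rewrite patch_itvE; case: ifPn => // /k0.
split; last by rewrite [RHS]Rintegral_mkcond E.
rewrite -E -restrict_EFin; apply: (proj1 (integrable_mkcond _ _)) => //.
apply: continuous_compact_integrable; first exact: segment_compact.
exact: continuous_subspaceT.
Qed.

(** The primitive from -oo vanishes to the left of a, and zero mean makes it vanish to the right of
    b. *)
Lemma zero_mean_primitive T a b k : - T < a -> b < T -> continuous k ->
  (forall t, ~~ (a <= t <= b) -> k t = 0) -> \int[mu]_(t in setT) k t = 0 ->
  exists chi, [/\ test_function T chi, derive1 chi = k &
    forall t, ~~ (a <= t <= b) -> chi t = 0].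
Proof.
move=> Ta bT ck k0 ik0; have [ik _] := compact_support_integrable ck k0.
pose chi t := \int[mu]_(x in `]-oo, t]) k x.
have D t : derivable chi t 1 /\ derive1 chi t = k t.
  apply: (@continuous_FTC1 _ _ -oo%O t (t + 1)) => //.
  - by rewrite ltrDl.
  - by apply: integrableS ik.
  - by rewrite ltNyr.
  - exact: ck.
have chi0 t : ~~ (a <= t <= b) -> chi t = 0.
  rewrite negb_and -!ltNge => /orP[ta|bt].
    rewrite /chi (@eq_Rintegral _ _ _ _ _ (fun=> 0)) ?Rintegral_cst ?mul0r //.
    move=> x; rewrite inE /= in_itv /= => xt; rewrite k0 //.
    by rewrite negb_and -ltNge (le_lt_trans xt ta).
  rewrite /chi Rintegral_mkcond -ik0; apply: eq_Rintegral => x _.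
  rewrite patchE mem_setE in_itv /=; case: ifPn => //; rewrite -ltNge => tx.
  by rewrite k0 // negb_and -!ltNge (lt_trans bt tx) orbT.
have dE : derive1 chi = k by apply/funext => t; have [_] := D t.
exists chi; split => //; split; first by move=> t; have [] := D t.
  by rewrite dE.
exists `[a, b]%classic; split; first exact: segment_compact.
  by apply: subset_itv; rewrite bnd_simp.
by move=> t /negP h; apply: chi0; move: h; rewrite in_itv.
Qed.

Lemma continuous_bumpf n a b : continuous (bumpf n a b).
Proof.
move=> t; apply: differentiable_continuous; apply/derivable1_diffP.
by have [] := is_derive_bumpf n a b t.
Qed.

(** The argument of du Bois-Reymond: f - G annihilates derivatives of test functions, hence
    continuous compactly supported functions of mean zero, and therefore acts on every bump as a
    constant does. *)
Lemma weak_derivative_primitive T f g : 0 < T -> is_weak_derivative T f g ->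
  mu.-integrable (time_itv T) (EFin \o g) ->
  exists c, {ae mu, forall t, time_itv T t ->
    f t = c + \int[mu]_(x in `[- T, t]) g x}.
Proof.
move=> T0 [lf lg fg] ig.
pose G t := \int[mu]_(x in `[- T, t]) g x.
have [GT acG] := primitive_ac (ltW T0) ig.
have TT : - T <= T by rewrite ge0_cp // ltW.
have cG := ac_continuous TT acG.
have lG : locally_integrable (time_itv T) G.
  apply: open_integrable_locally; first exact: interval_open.
  apply: integrableS (_ : mu.-integrable `[- T, T] (EFin \o G)) => //.
    exact: measurable_itv.
    by rewrite /time_itv; exact: subset_itv_oo_cc.
  by apply: continuous_compact_integrable => //; exact: segment_compact.
have lw := locally_integrableB lf lG.
(* integration by parts against the primitive G of g *)
have IBP chi a b : test_function T chi -> - T < a -> b < T ->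
    (forall t, ~~ (a <= t <= b) -> chi t = 0 /\ derive1 chi t = 0) ->
    \int[mu]_(t in time_itv T) ((f \- G) t * derive1 chi t) = 0.
  move=> tc Ta bT c0; have [dc cc _] := tc.
  have [M1 hM1] := compact_support_bounded (derivable_continuous dc)
    (fun t (o : ~~ _) => proj1 (c0 t o)).
  have [M2 hM2] := compact_support_bounded cc (fun t (o : ~~ _) => proj2 (c0 t o)).
  have Dc t : is_derive t 1 chi (derive1 chi t).
    by apply: DeriveDef => //; rewrite derive1E.
  have acc := ac_derive (gtrN T0) Dc cc.
  have acp := ac_mul acG acc.
  have := ac_trace0 TT acp.
  have [-> _] : chi T = 0 /\ derive1 chi T = 0.
    by apply: c0; rewrite negb_and -!ltNge bT orbT.
  rewrite GT mul0r mulr0 => /(_ erefl erefl).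
  have ip : mu.-integrable (time_itv T)
      (EFin \o (fun t => G t * derive1 chi t + g t * chi t)).
    apply: integrableS (ac_integrable acp (lexx T)) => //; first exact: measurable_itv.
    by rewrite /time_itv; exact: subset_itv_oo_cc.
  rewrite -Rintegral_time_itv // ?ltW //.
  have mc : measurable_fun setT chi.
    by apply: continuous_measurable_fun; exact: derivable_continuous.
  have mc' : measurable_fun setT (derive1 chi) by apply: continuous_measurable_fun.
  have j1 := locally_integrable_mul lG Ta bT mc' hM2 (fun t (o : ~~ _) => proj2 (c0 t o)).
  have j2 := locally_integrable_mul lg Ta bT mc hM1 (fun t (o : ~~ _) => proj1 (c0 t o)).
  have j3 := locally_integrable_mul lf Ta bT mc' hM2 (fun t (o : ~~ _) => proj2 (c0 t o)).
  rewrite RintegralD //; last exact: measurable_itv.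
  under [X in _ -> X = _]eq_Rintegral do rewrite mulrBl.
  rewrite RintegralB //; last exact: measurable_itv.
  by rewrite (fg _ tc) => h; lra.
pose a0 := - T / 2; pose b0 := T / 2.
have ab0 : a0 < b0 by rewrite /a0 /b0; lra.
have Ta0 : - T < a0 by rewrite /a0; lra.
have bT0 : b0 < T by rewrite /b0; lra.
have [n0] := bumpf_integral_neq0 ab0.
set I0 := (X in X <> _) => I0n.
(* The constant is the weighted mean of f - G against one fixed bump. *)
pose c := (\int[mu]_(t in time_itv T) ((f \- G) t * bumpf n0 a0 b0 t)) / I0.
have lc : locally_integrable (time_itv T) (fun=> c).
  apply: open_integrable_locally; first exact: interval_open.
  apply: integrableS (_ : mu.-integrable `[- T, T] (EFin \o (fun=> c))) => //.
    exact: measurable_itv.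
    by rewrite /time_itv; exact: subset_itv_oo_cc.
  apply: continuous_compact_integrable; first exact: segment_compact.
  by apply: continuous_subspaceT => x; exact: cst_continuous.
have := bumpf_null_ae (locally_integrableB lw lc).
have H n a b : a <= b -> - T < a -> b < T ->
    \int[mu]_(t in time_itv T) (((f \- G) \- (fun=> c)) t * bumpf n a b t) = 0.
  move=> ab Ta bT.
  pose I := \int[mu]_(t in `[a, b]) bumpf n a b t.
  (* The factor I / I0 makes the mean of eta zero, so eta is the derivative of a test function. *)
  pose eta t := bumpf n a b t - I / I0 * bumpf n0 a0 b0 t.
  have z1 t : ~~ (a <= t <= b) -> bumpf n a b t = 0.
    move=> h; apply: bumpf_out => //; apply: contra h => /andP[ta tb].
    by rewrite !ltW.
  have z0 t : ~~ (a0 <= t <= b0) -> bumpf n0 a0 b0 t = 0.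
    move=> h; apply: bumpf_out; first exact: ltW.
    by apply: contra h => /andP[ta tb]; rewrite !ltW.
  have [i1 e1] := compact_support_integrable (@continuous_bumpf n a b) z1.
  have [i0 e0] := compact_support_integrable (@continuous_bumpf n0 a0 b0) z0.
  have ce : continuous eta.
    move=> t; apply: cvgB; first exact: continuous_bumpf.
    by apply: cvgM; [exact: cvg_cst|exact: continuous_bumpf].
  have e_0 t : ~~ (Num.min a a0 <= t <= Num.max b b0) -> eta t = 0.
    rewrite ge_min le_max => h; rewrite /eta z1 ?z0 ?mulr0 ?subr0 //.
      by apply: contra h => /andP[-> ->]; rewrite !orbT.
    by apply: contra h => /andP[-> ->].
  have ie : \int[mu]_(t in setT) eta t = 0.
    rewrite RintegralB //; last exact: integrableZlR.
    by rewrite RintegralZl // e1 e0 -/I0 -/I divfK ?subrr //; apply/eqP.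
  have Ta' : - T < Num.min a a0 by rewrite lt_min Ta.
  have bT' : Num.max b b0 < T by rewrite gt_max bT.
  have [chi [tchi dchi chi0]] := zero_mean_primitive Ta' bT' ce e_0 ie.
  have := IBP chi _ _ tchi Ta' bT'.
  rewrite dchi => /(_ (fun t (o : ~~ _) => conj (chi0 t o) (e_0 t o))).
  have k1 := integrable_bumpf n lw ab Ta bT.
  have k0 := integrable_bumpf n0 lw (ltW ab0) Ta0 bT0.
  have kc := integrable_bumpf n lc ab Ta bT.
  have mD : measurable (time_itv T) by exact: measurable_itv.
  have -> : (fun t => (f \- G) t * eta t) = fun t => (f \- G) t * bumpf n a b t
      - I / I0 * ((f \- G) t * bumpf n0 a0 b0 t).
    by apply/funext => t; rewrite /eta mulrBr; congr (_ - _); rewrite mulrCA.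
  rewrite RintegralB //; last exact: integrableZlR.
  rewrite RintegralZl //.
  under [X in _ -> X = _]eq_Rintegral do rewrite /= mulrBl.
  rewrite RintegralB // => h.
  rewrite (integral_bump_itv n (fun=> c) ab Ta bT) RintegralZl //; last first.
    exact: integrableS i1.
  rewrite -/I /c; apply/eqP; rewrite subr_eq0; apply/eqP.
  move/eqP: h; rewrite subr_eq0 => /eqP ->; ring.
move=> /(_ H) ae; exists c; move: ae; apply: ae_imp => t h Dt.
have /eqP := h Dt; rewrite /= subr_eq0 subr_eq => /eqP ->.
by rewrite /G.
Qed.

End WeakRepresentation.

(** * Traces and the Leibniz rule for weak derivatives *)

Section WeakCalculus.
Context {R : realType}.
Local Notation mu := (@lebesgue_measure R).
Implicit Types (a b t T : R) (f g k r : R -> R).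

Lemma ae_itv_exists a b (P : R -> Prop) : a < b -> {ae mu, forall t, P t} ->
  exists2 t, a < t < b & P t.
Proof.
move=> ab [A [mA A0 PA]]; apply: contrapT => H.
have sA : `]a, b[ `<=` A.
  move=> t /=; rewrite in_itv /= => tab; apply: PA => /= Pt.
  by apply: H; exists t.
have : (mu `]a, b[ <= mu A)%E by apply: le_measure; rewrite ?inE.
by rewrite A0 lebesgue_measure_itv /= lte_fin ab -EFinD lee_fin leNgt subr_gt0 ab.
Qed.

(** A nonzero value at an endpoint would persist on an interval next to it, which is not a null
    set. *)
Lemma ae_zero_endpoints a b k : a < b -> {within `[a, b], continuous k} ->
  {ae mu, forall t, a < t < b -> k t = 0} -> k a = 0 /\ k b = 0.
Proof.
move=> ab /(continuous_within_itvP _ ab)[_ ka kb] ae.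
split; apply/eqP; apply/negPn/negP; rewrite -normr_gt0 => kn.
- have : \forall x \near a^'+, `|k a - k x| < `|k a|.
    by move/cvgrPdist_lt : ka; apply.
  move=> [e /= e0 He].
  have ae' : a < Num.min b (a + e) by rewrite lt_min ab ltrDl e0.
  have [t /andP[a_t]] := ae_itv_exists ae' ae.
  rewrite lt_min => /andP[tb te] /(_ _)h.
  have : `|k a - k t| < `|k a|.
    by apply: He => //=; rewrite distrC ger0_norm ?subr_ge0 ?(ltW a_t) //; lra.
  by rewrite h ?a_t // subr0 ltxx.
- have : \forall x \near b^'-, `|k b - k x| < `|k b|.
    by move/cvgrPdist_lt : kb; apply.
  move=> [e /= e0 He].
  have be' : Num.max a (b - e) < b by rewrite gt_max ab ltrBlDr ltrDl e0.
  have [t /andP[+ tb]] := ae_itv_exists be' ae.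
  rewrite gt_max => /andP[a_t te] /(_ _)h.
  have : `|k b - k t| < `|k b|.
    by apply: He => //=; rewrite ger0_norm ?subr_ge0 ?(ltW tb) //; lra.
  by rewrite h ?a_t // subr0 ltxx.
Qed.

(** The representative given by [zero_trace] and the primitive c + G are continuous up to the end
    points and equal almost everywhere, so their end values agree: c = 0 and G T = 0. *)
Lemma trace_primitive T f g : 0 < T -> is_weak_derivative T f g ->
  mu.-integrable (time_itv T) (EFin \o g) -> zero_trace T f ->
  exists F, [/\ ac_on (- T) T F g, F (- T) = 0, F T = 0 &
    {ae mu, forall t, time_itv T t -> f t = F t}].
Proof.
move=> T0 fg ig [k [ck fk kT0 kT1]].
have [c fc] := weak_derivative_primitive T0 fg ig.
pose G t := \int[mu]_(x in `[- T, t]) g x.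
have [GT acG] := primitive_ac (ltW T0) ig.
have TT : - T < T by rewrite gtrN.
have cG := ac_continuous (ltW TT) acG.
have [] := @ae_zero_endpoints (- T) T (fun t => k t - (c + G t)) TT.
- move=> x; apply: cvgB; first exact: ck.
  by apply: cvgD; [exact: cvg_cst|exact: cG].
- apply: ae_imp2 fk fc => t h1 h2 ht.
  have Dt : time_itv T t by rewrite /time_itv /= in_itv.
  by rewrite -h1 // h2 // subrr.
rewrite kT0 kT1 /G GT => /eqP; rewrite addr0 sub0r oppr_eq0 => /eqP c0.
rewrite c0 !add0r => /eqP; rewrite oppr_eq0 => /eqP GT1.
exists G; split => //.
by apply: ae_imp fc => t h Dt; rewrite h // c0 add0r.
Qed.

Lemma Rintegral_ae T f g :
  measurable_fun (time_itv T) f -> measurable_fun (time_itv T) g ->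
  {ae mu, forall t, time_itv T t -> f t = g t} ->
  \int[mu]_(t in time_itv T) f t = \int[mu]_(t in time_itv T) g t.
Proof.
move=> mf mg fg; congr fine; apply: ae_eq_integral.
- exact: measurable_itv.
- exact/measurable_EFinP.
- exact/measurable_EFinP.
- by apply: ae_imp fg => t h Dt; rewrite h.
Qed.

Lemma weak_derivative_ae T f1 f2 g : is_weak_derivative T f1 g ->
  locally_integrable (time_itv T) f2 ->
  {ae mu, forall t, time_itv T t -> f1 t = f2 t} -> is_weak_derivative T f2 g.
Proof.
move=> [[m1 o1 l1] lg fg] l2 ae; split => // chi tc; rewrite -fg //.
have [m2 _ _] := l2; have [dc cc _] := tc.
have mc : measurable_fun (time_itv T) (derive1 chi).
  by apply: measurable_funTS; exact: continuous_measurable_fun.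
apply: Rintegral_ae.
- exact: measurable_funM.
- exact: measurable_funM.
- by apply: ae_imp ae => t h Dt; rewrite h.
Qed.

Lemma locally_integrable_mulr T r f : continuous r ->
  locally_integrable (time_itv T) f ->
  locally_integrable (time_itv T) (fun t => r t * f t).
Proof.
move=> cr [mf oD lf].
have mr : measurable_fun (time_itv T) r.
  by apply: measurable_funTS; exact: continuous_measurable_fun.
split=> //; first exact: measurable_funM.
move=> K KD cK; have mK := compact_measurable cK.
have cK' : compact ((fun t => `|r t|) @` K).
  apply: continuous_compact => //; apply: continuous_subspaceT => t.
  by apply: cvg_norm; exact: cr.
have [M [_ hM]] := compact_bounded cK'.
have HM t : K t -> `|r t| <= M + 1.
  move=> Kt; have MM : M < M + 1 by rewrite ltrDl.
  by have := hM _ MM `|r t| (ex_intro2 _ _ t Kt erefl); rewrite /= normr_id.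
apply: (@le_lt_trans _ _ (\int[mu]_(x in K) ((`|M + 1|)%:E * `|f x|%:E))%E).
  apply: ge0_le_integral => //.
  - apply/measurable_EFinP; apply: measurableT_comp => //.
    by apply: measurable_funM; [apply: measurable_funS mr|apply: measurable_funS mf];
      rewrite // /time_itv; exact: measurable_itv.
  - apply/measurable_EFinP; apply: measurable_funM => //.
    apply: measurableT_comp => //; apply: measurable_funS mf => //.
    exact: measurable_itv.
  - move=> t Kt; rewrite -EFinM lee_fin normrM ler_wpM2r //.
    exact: le_trans (HM t Kt) (ler_norm _).
rewrite ge0_integralZl_EFin //; last first.
  apply/measurable_EFinP; apply: measurableT_comp => //.
  by apply: measurable_funS mf => //; exact: measurable_itv.
rewrite lte_mul_pinfty ?lee_fin // ?integral_ge0 //.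
exact: lf.
Qed.

Lemma compact_time_itv T (K : set R) : compact K -> K `<=` time_itv T ->
  exists a b, [/\ - T < a, b < T & K `<=` `[a, b]].
Proof.
move=> cK KD; have [->|K0] := eqVneq K set0.
  by exists (- T + 1), (T - 1); split; [rewrite ltrDl|rewrite ltrBlDr ltrDl|].
have ci : {within K, continuous (fun t : R => t)}.
  by apply: continuous_subspaceT => t; exact: cvg_id.
move/set0P : K0 => K0.
have [a aK ha] := compact_EVT_min K0 cK ci.
have [b bK hb] := compact_EVT_max K0 cK ci.
have := KD _ (set_mem aK); have := KD _ (set_mem bK).
rewrite /time_itv /= !in_itv /= => /andP[_ bT] /andP[Ta _].
exists a, b; split => // t Kt /=; rewrite in_itv /=.
by rewrite ha ?hb // mem_set.
Qed.

Lemma test_function_integrable T f chi : locally_integrable (time_itv T) f ->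
  test_function T chi ->
  mu.-integrable (time_itv T) (EFin \o (fun t => f t * chi t)) /\
  mu.-integrable (time_itv T) (EFin \o (fun t => f t * derive1 chi t)).
Proof.
move=> lf [dc cc [K [cK KD K0]]].
have ccn := derivable_continuous dc.
have [a [b [Ta bT Kab]]] := compact_time_itv cK KD.
have c0 t : ~~ (a <= t <= b) -> chi t = 0.
  by move=> h; apply: K0 => /Kab /=; rewrite in_itv /= (negbTE h).
have c0' t : ~~ (a <= t <= b) -> derive1 chi t = 0.
  move=> h; rewrite derive1E.
  have : \forall u \near t, (fun=> 0 : R) u = chi u.
    move: h; rewrite negb_and -!ltNge => /orP[ta|bt]; near=> u.
    - rewrite c0 // negb_and -ltNge; apply/orP; left; near: u.
      exact: lt_nbhsl.
    - rewrite c0 // negb_and -!ltNge; apply/orP; right; near: u.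
      exact: lt_nbhsr.
  by move=> /near_eq_derive <-; rewrite ?oner_eq0 // derive_cst.
have [M1 hM1] := compact_support_bounded ccn c0.
have [M2 hM2] := compact_support_bounded cc c0'.
have mc : measurable_fun setT chi by exact: continuous_measurable_fun.
have mc' : measurable_fun setT (derive1 chi) by exact: continuous_measurable_fun.
by split; [exact: locally_integrable_mul lf Ta bT mc hM1 c0
          |exact: locally_integrable_mul lf Ta bT mc' hM2 c0'].
Unshelve. all: by end_near. Qed.

Lemma weak_derivative_add T f1 g1 f2 g2 :
  is_weak_derivative T f1 g1 -> is_weak_derivative T f2 g2 ->
  is_weak_derivative T (fun t => f1 t + f2 t) (fun t => g1 t + g2 t).
Proof.
move=> [lf1 lg1 H1] [lf2 lg2 H2].
split; [exact: locally_integrableD|exact: locally_integrableD|move=> chi tc].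
have [_ i1] := test_function_integrable lf1 tc.
have [_ i2] := test_function_integrable lf2 tc.
have [j1 _] := test_function_integrable lg1 tc.
have [j2 _] := test_function_integrable lg2 tc.
under eq_Rintegral do rewrite mulrDl.
rewrite RintegralD //; last exact: measurable_itv.
under [X in _ = - X]eq_Rintegral do rewrite mulrDl.
rewrite RintegralD //; last exact: measurable_itv.
by rewrite H1 // H2 // opprD.
Qed.

(** The product r chi is again a C^1 test function, so the definition for f can be applied to it. *)
Lemma weak_derivative_mul T r r' f g : (forall t : R, is_derive t 1 r (r' t)) ->
  continuous r' -> is_weak_derivative T f g ->
  is_weak_derivative T (fun t => r t * f t) (fun t => r' t * f t + r t * g t).
Proof.
move=> dr cr' [lf lg fg].
have cr : continuous r by apply: derivable_continuous => t; have [] := dr t.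
have lrf := locally_integrable_mulr cr lf.
have lrg := locally_integrable_mulr cr lg.
have lr'f := locally_integrable_mulr cr' lf.
split=> //; first exact: locally_integrableD.
move=> chi tc; have [dc cc [K [cK KD K0]]] := tc.
have ccn := derivable_continuous dc.
have Drc t : is_derive t 1 (fun t => r t * chi t) (r t * derive1 chi t + r' t * chi t).
  have dct : is_derive t 1 chi (derive1 chi t).
    by apply: DeriveDef => //; rewrite derive1E.
  by apply: is_derive_eq; rewrite /GRing.scale /=; ring.
have dE : derive1 (fun t => r t * chi t) = fun t => r t * derive1 chi t + r' t * chi t.
  by apply/funext => t; rewrite derive1E; have [_ ->] := Drc t.
have trc : test_function T (fun t => r t * chi t).
  split; first by move=> t; have [] := Drc t.
    rewrite dE => t; apply: cvgD; apply: cvgM; [exact: cr|exact: cc|exact: cr'|exact: ccn].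
  by exists K; split => // t Kt; rewrite K0 ?mulr0.
have := fg _ trc; rewrite dE.
have [_ j1] := test_function_integrable lrf tc.
have [j2 _] := test_function_integrable lr'f tc.
have [j3 _] := test_function_integrable lrg tc.
have -> : (fun t => f t * (r t * derive1 chi t + r' t * chi t)) =
    fun t => r t * f t * derive1 chi t + r' t * f t * chi t.
  by apply/funext => t; ring.
have -> : (fun t => g t * (r t * chi t)) = fun t => r t * g t * chi t.
  by apply/funext => t; ring.
have -> : (fun t => (r' t * f t + r t * g t) * chi t) =
    fun t => r' t * f t * chi t + r t * g t * chi t.
  by apply/funext => t; ring.
rewrite RintegralD //; last exact: measurable_itv.
by rewrite [X in _ -> _ = - X]RintegralD //; [lra|exact: measurable_itv].
Qed.

(* [weak_derive T (fun t => r t * f t)] is only determined almost everywhere. *)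
Lemma weak_derive2_mul T r r' r'' f g k :
  (forall t : R, is_derive t 1 r (r' t)) -> (forall t : R, is_derive t 1 r' (r'' t)) ->
  continuous r'' -> is_weak_derivative T f g -> is_weak_derivative T g k ->
  let rf2 := weak_derive T (weak_derive T (fun t => r t * f t)) in
  measurable_fun (time_itv T) rf2 /\
  {ae mu, forall t, time_itv T t ->
    rf2 t = r'' t * f t + 2 * r' t * g t + r t * k t}.
Proof.
move=> dr dr' cr'' fg gk rf2.
have cr' : continuous r' by apply: derivable_continuous => t; have [] := dr' t.
have D1 := weak_derivative_mul dr cr' fg.
have D1' := weak_deriveP D1.
have E1 := weak_derivative_unique D1 D1'.
have D2 := weak_derivative_add (weak_derivative_mul dr' cr'' fg)
  (weak_derivative_mul dr cr' gk).
have [_ l1 _] := D1'.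
have D2' := weak_derivative_ae D2 l1 E1.
have D2'' := weak_deriveP D2'.
split; first by have [_ [m _ _] _] := D2''.
apply: ae_imp (weak_derivative_unique D2' D2'') => t h Dt.
by rewrite /rf2 -(h Dt); ring.
Qed.

End WeakCalculus.

(** * Coefficients for s large and s h small *)

Section UniformLimits.
Context {R : realType} (T : R).
Implicit Types (s h t x delta M : R) (F : R -> R -> R -> R -> R) (f : R -> R -> R).

(* The regime s large, s h small. *)
Definition eventually_sh (P : R -> R -> Prop) : Prop :=
  exists2 eta, 0 < eta & forall s h, eta^-1 < s -> 0 < h -> s * h < eta -> P s h.

Definition box t x : Prop := - T <= t <= T /\ 0 <= x <= 1.

Definition ucv F f : Prop := forall delta, 0 < delta ->
  eventually_sh (fun s h => forall t x, box t x -> `|F s h t x - f t x| <= delta).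

Definition ubounded F : Prop := exists M,
  eventually_sh (fun s h => forall t x, box t x -> `|F s h t x| <= M).

Definition bounded_box f : Prop := exists M, forall t x, box t x -> `|f t x| <= M.

Lemma eventually_and (P Q : R -> R -> Prop) :
  eventually_sh P -> eventually_sh Q -> eventually_sh (fun s h => P s h /\ Q s h).
Proof.
move=> [e1 e10 H1] [e2 e20 H2].
have m0 : 0 < Num.min e1 e2 by rewrite lt_min e10.
exists (Num.min e1 e2) => // s h es h0; rewrite lt_min => /andP[sh1 sh2].
by split; [apply: H1|apply: H2] => //; apply: le_lt_trans es; rewrite lef_pV2 ?posrE //
  ge_min lexx ?orbT.
Qed.

Lemma eventually_imp (P Q : R -> R -> Prop) : (forall s h, P s h -> Q s h) ->
  eventually_sh P -> eventually_sh Q.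
Proof. by move=> PQ [e e0 H]; exists e => // s h *; apply: PQ; apply: H. Qed.

Lemma eventually_imp2 (P1 P2 Q : R -> R -> Prop) :
  (forall s h, P1 s h -> P2 s h -> Q s h) ->
  eventually_sh P1 -> eventually_sh P2 -> eventually_sh Q.
Proof.
move=> PQ H1 H2; apply: eventually_imp (eventually_and H1 H2) => s h [].
exact: PQ.
Qed.

Lemma eventually_small delta : 0 < delta ->
  eventually_sh (fun s h => [/\ 0 < s, 0 < h, s * h <= delta, h <= delta & 1 <= delta * s]).
Proof.
move=> d0; have m0 : 0 < Num.min delta 1 by rewrite lt_min d0 ltr01.
exists (Num.min delta 1) => // s h es h0 sh.
have s0 : 0 < s by apply: lt_trans es; rewrite invr_gt0.
have [ed e1] : Num.min delta 1 <= delta /\ Num.min delta 1 <= 1.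
  by split; rewrite ge_min lexx ?orbT.
have es1 : 1 < Num.min delta 1 * s by rewrite mulrC -ltr_pdivrMr // div1r.
(* The minimum with 1 forces s >= 1, so that h <= s h is small as well. *)
have s1 : 1 <= s by nra.
split => //.
- exact: le_trans (ltW sh) ed.
- by apply: le_trans ed; apply: le_trans (ltW sh); rewrite ler_peMl // ltW.
- by apply: le_trans (ltW es1) _; rewrite ler_pM2r.
Qed.

Lemma ucv_ext F F' f : (forall s h t x, 0 < s -> 0 < h -> F s h t x = F' s h t x) ->
  ucv F f -> ucv F' f.
Proof.
move=> E H d d0; apply: eventually_imp2 (eventually_small ltr01) (H d d0).
by move=> s h [s0 h0 _ _ _] H' t x tx; rewrite -E //; exact: H'.
Qed.

Lemma ucv_limit F f f' : (forall t x, f t x = f' t x) -> ucv F f -> ucv F f'.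
Proof.
move=> E H d d0; apply: eventually_imp (H d d0) => s h H' t x tx.
by rewrite -E; exact: H'.
Qed.

Lemma ucv_const f : ucv (fun _ _ => f) f.
Proof.
move=> d d0; apply: eventually_imp (eventually_small ltr01) => s h _ t x _.
by rewrite subrr normr0 ltW.
Qed.

Lemma ucv_ubounded F f : bounded_box f -> ucv F f -> ubounded F.
Proof.
move=> [M HM] H; exists (M + 1); apply: eventually_imp (H 1 ltr01) => s h H' t x tx.
rewrite -(subrK (f t x) (F s h t x)) (le_trans (ler_normD _ _)) // addrC lerD //.
  exact: HM.
exact: H'.
Qed.

Lemma ucvD F f F' f' : ucv F f -> ucv F' f' ->
  ucv (fun s h t x => F s h t x + F' s h t x) (fun t x => f t x + f' t x).
Proof.
move=> H H' d d0; have d2 : 0 < d / 2 by rewrite divr_gt0.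
apply: eventually_imp2 (H _ d2) (H' _ d2) => s h K K' t x tx.
rewrite opprD addrACA (le_trans (ler_normD _ _)) // [d]splitr lerD //.
  exact: K.
exact: K'.
Qed.

Lemma ucvM F f F' f' : bounded_box f -> bounded_box f' -> ucv F f -> ucv F' f' ->
  ucv (fun s h t x => F s h t x * F' s h t x) (fun t x => f t x * f' t x).
Proof.
move=> bf [M' HM'] H H' d d0; have [M HM] := ucv_ubounded bf H.
have d2 : 0 < d / 2 by rewrite divr_gt0.
pose A := `|M| + 1; pose A' := `|M'| + 1.
have A0 : 0 < A by rewrite ltr_wpDl.
have A'0 : 0 < A' by rewrite ltr_wpDl.
apply: eventually_imp2 (eventually_imp2 (fun s h a b => conj a b) HM
  (H _ (divr_gt0 d2 A'0))) (H' _ (divr_gt0 d2 A0)) => s h [K1 K2] K3 t x tx.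
have -> : F s h t x * F' s h t x - f t x * f' t x =
  F s h t x * (F' s h t x - f' t x) + (F s h t x - f t x) * f' t x by ring.
rewrite (le_trans (ler_normD _ _)) // [d]splitr !normrM lerD //.
- rewrite -(divfK (lt0r_neq0 A0) (d / 2)) mulrC ler_pM //; first exact: K3.
  by apply: le_trans (K1 t x tx) _; rewrite (le_trans (ler_norm _)) // lerDl.
- rewrite -(divfK (lt0r_neq0 A'0) (d / 2)) ler_pM //; first exact: K2.
  by apply: le_trans (HM' t x tx) _; rewrite (le_trans (ler_norm _)) // lerDl.
Qed.

Lemma bounded_boxD f f' : bounded_box f -> bounded_box f' ->
  bounded_box (fun t x => f t x + f' t x).
Proof.
move=> [M HM] [M' HM']; exists (M + M') => t x tx.
by rewrite (le_trans (ler_normD _ _)) // lerD ?HM ?HM'.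
Qed.

Lemma bounded_boxM f f' : bounded_box f -> bounded_box f' ->
  bounded_box (fun t x => f t x * f' t x).
Proof.
move=> [M HM] [M' HM']; exists (M * M') => t x tx.
by rewrite normrM ler_pM ?HM ?HM'.
Qed.

Lemma bounded_box_cst M : bounded_box (fun _ _ => M).
Proof. by exists `|M|. Qed.

(** A Lipschitz constant of size O(tau), rather than a bound, makes both L (s h) (F) and its
    difference quotients in x tend to 0. *)
Definition small_lipschitz (L : R -> R -> R) : Prop := forall M, exists2 C, 0 <= C &
  forall tau y y', 0 < tau <= 1 -> `|y| <= M -> `|y'| <= M ->
    `|L tau y - L tau y'| <= C * tau * `|y - y'|.

Lemma ucv_lipschitz (L : R -> R -> R) F f : small_lipschitz L ->
  (forall tau, L tau 0 = 0) -> bounded_box f -> ucv F f ->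
  ucv (fun s h t x => L (s * h) (F s h t x)) (fun _ _ => 0).
Proof.
move=> hL L0 bf H d d0; have [M HM] := ucv_ubounded bf H.
have [C C_ge0 hC] := hL `|M|; pose A := `|C| * `|M| + 1.
have A0 : 0 < A by rewrite ltr_wpDl // mulr_ge0.
have e0 : 0 < Num.min 1 (d / A) by rewrite lt_min ltr01 divr_gt0.
apply: eventually_imp2 (eventually_small e0) HM => s h [s0 h0 sh _ _] K t x tx.
move: sh; rewrite le_min => /andP[sh1 shd].
have tau0 : 0 < s * h by rewrite mulr_gt0.
have FM : `|F s h t x| <= `|M| by rewrite (le_trans (K t x tx)) // ler_norm.
have := hC (s * h) (F s h t x) 0; rewrite tau0 sh1 FM normr0 normr_ge0 L0 !subr0.
move=> /(_ isT isT isT) h1; rewrite (le_trans h1) //.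
rewrite -mulrA (@le_trans _ _ (`|C| * ((s * h) * `|M|))) //.
  apply: (@le_trans _ _ (`|C| * (s * h * `|F s h t x|))).
    by rewrite ler_wpM2r ?ler_norm // mulr_ge0 // ltW.
  by rewrite ler_wpM2l // ler_wpM2l // ltW.
rewrite mulrCA (@le_trans _ _ (s * h * A)) //.
  by rewrite ler_wpM2l ?(ltW tau0) // lerDl.
by rewrite -ler_pdivlMr.
Qed.

Lemma ucv_lipschitz_dif (L : R -> R -> R) F F' f f' g : small_lipschitz L ->
  bounded_box f -> bounded_box f' -> bounded_box g -> ucv F f -> ucv F' f' ->
  ucv (fun s h t x => (F' s h t x - F s h t x) / h) g ->
  ucv (fun s h t x => (L (s * h) (F' s h t x) - L (s * h) (F s h t x)) / h)
      (fun _ _ => 0).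
Proof.
move=> hL bf bf' bg H H' HD d d0; have [M HM] := ucv_ubounded bf H.
have [M' HM'] := ucv_ubounded bf' H'; have [M'' HM''] := ucv_ubounded bg HD.
pose B := Num.max `|M| `|M'|; have [C C_ge0 hC] := hL B; pose A := `|C| * `|M''| + 1.
have A0 : 0 < A by rewrite ltr_wpDl // mulr_ge0.
have e0 : 0 < Num.min 1 (d / A) by rewrite lt_min ltr01 divr_gt0.
apply: eventually_imp2 (eventually_small e0) (eventually_and HM (eventually_and HM' HM'')).
move=> s h [s0 h0 sh _ _] [K [K' K'']] t x tx.
move: sh; rewrite le_min => /andP[sh1 shd].
have tau0 : 0 < s * h by rewrite mulr_gt0.
have FM : `|F s h t x| <= B.
  by rewrite (le_trans (K t x tx)) // le_max ler_norm.
have FM' : `|F' s h t x| <= B.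
  by rewrite (le_trans (K' t x tx)) // le_max ler_norm orbT.
have := hC (s * h) (F' s h t x) (F s h t x); rewrite tau0 sh1 FM FM'.
move=> /(_ isT isT isT) h1; rewrite subr0 normrM normfV (gtr0_norm h0).
rewrite ler_pdivrMr // (le_trans h1) //.
have := K'' t x tx; rewrite normrM normfV (gtr0_norm h0) ler_pdivrMr // => h2.
have M''0 : 0 <= M'' by apply: le_trans (K'' t x tx).
rewrite (@le_trans _ _ (`|C| * (s * h) * (M'' * h))) //.
  apply: (@le_trans _ _ (`|C| * (s * h) * `|F' s h t x - F s h t x|)).
    by rewrite ler_wpM2r // ler_wpM2r ?ler_norm // ltW.
  by rewrite ler_wpM2l // mulr_ge0 // ltW.
rewrite mulrA ler_pM2r // mulrAC.
rewrite (@le_trans _ _ (A * (s * h))) //; last by rewrite mulrC -ler_pdivlMr.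
rewrite ler_wpM2r ?(ltW tau0) // /A (ger0_norm M''0) ler_wpDr //.
Qed.

End UniformLimits.

(** * Exponential remainders in the variable tau = s h *)

Section ExponentialPerturbation.
Context {R : realType}.
Implicit Types (f : R -> R) (y a b tau M : R).

Lemma mean_value f f' a b : (forall y, is_derive y 1 f (f' y)) -> a <= b ->
  exists2 c, a <= c <= b & f b - f a = f' c * (b - a).
Proof.
move=> df ab.
have cf : {within `[a, b], continuous f}.
  apply: continuous_subspaceT; apply: derivable_continuous => t.
  by have [] := df t.
have [c cab E] := MVT_segment ab (fun x _ => df x) cf.
by exists c => //; move: cab; rewrite in_itv.
Qed.

Lemma mean_value_norm f f' M K y y' : (forall y, is_derive y 1 f (f' y)) ->
  (forall y, `|y| <= M -> `|f' y| <= K) -> `|y| <= M -> `|y'| <= M ->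
  `|f y - f y'| <= K * `|y - y'|.
Proof.
move=> df hK; wlog yy' : y y' / y' <= y.
  move=> W hy hy'; have [h|h] := leP y' y; first exact: W.
  by rewrite distrC [`|y - _|]distrC; apply: W => //; exact: ltW.
move=> hy hy'; have [c /andP[c1 c2] ->] := mean_value df yy'.
rewrite normrM ler_wpM2r //; apply: hK.
move: hy hy'; rewrite !ler_norml => /andP[_ h2] /andP[h1 _].
by rewrite (le_trans h1 c1) (le_trans c2 h2).
Qed.

(** For tau = s h and y a difference quotient of phi, [Eexp] is a ratio of neighbouring values of
    rho; [E1] and [E2] are its normalised Taylor remainders, tending to y and y^2 / 2. As [E2]
    differentiates to [E1] and [E1] to [Eexp], the Lipschitz bounds pass from one to the next. *)
Definition Eexp (tau y : R) : R := expR (- (tau * y)).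
Definition E1 (tau y : R) : R := (1 - Eexp tau y) / tau.
Definition E2 (tau y : R) : R := (Eexp tau y - 1 + tau * y) / tau ^+ 2.

Lemma is_derive_Eexp tau y : is_derive y 1 (Eexp tau) (- tau * Eexp tau y).
Proof.
rewrite /Eexp; apply: is_derive_eq; rewrite /GRing.scale /=; ring.
Qed.

Lemma is_derive_E1 tau y : tau != 0 -> is_derive y 1 (E1 tau) (Eexp tau y).
Proof.
move=> t0; have D := is_derive_Eexp tau y.
by rewrite /E1; apply: is_derive_eq; rewrite /GRing.scale /=; field.
Qed.

Lemma is_derive_E2 tau y : tau != 0 -> is_derive y 1 (E2 tau) (E1 tau y).
Proof.
move=> t0; have D := is_derive_Eexp tau y.
by rewrite /E2 /E1; apply: is_derive_eq; rewrite /GRing.scale /=; field.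
Qed.

Lemma Eexp0 tau : Eexp tau 0 = 1.
Proof. by rewrite /Eexp mulr0 oppr0 expR0. Qed.

Lemma E10 tau : E1 tau 0 = 0.
Proof. by rewrite /E1 Eexp0 subrr mul0r. Qed.

Lemma E20 tau : E2 tau 0 = 0.
Proof. by rewrite /E2 Eexp0 subrr mulr0 addr0 mul0r. Qed.

Lemma Eexp_le tau y M : 0 < tau <= 1 -> `|y| <= M -> Eexp tau y <= expR M.
Proof.
move=> /andP[t0 t1] yM; rewrite /Eexp ler_expR.
rewrite (le_trans (ler_norm _)) // normrN normrM (gtr0_norm t0).
by rewrite (le_trans _ yM) // ler_piMl.
Qed.

Lemma small_lipschitz_Eexp : small_lipschitz (fun tau y => Eexp tau y - 1).
Proof.
move=> M; exists (expR M) => [|tau y y' t01 hy hy']; first by rewrite ltW ?expR_gt0.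
have [t0 t1] := andP t01.
rewrite [expR M * _]mulrC.
apply: (@mean_value_norm (fun y => Eexp tau y - 1)
  (fun y => - tau * Eexp tau y)) hy hy' => [z|z hz].
  have D := is_derive_Eexp tau z.
  by apply: is_derive_eq; rewrite subr0.
rewrite mulNr normrN normrM (gtr0_norm t0) ler_pM2l // ger0_norm ?expR_ge0 //.
exact: Eexp_le.
Qed.

Lemma small_lipschitz_E1 : small_lipschitz (fun tau y => E1 tau y - y).
Proof.
move=> M; have [C C0 HC] := small_lipschitz_Eexp M.
exists (C * `|M|) => [|tau y y' t01 hy hy']; first by rewrite mulr_ge0.
have [t0 t1] := andP t01.
have tn : tau != 0 by rewrite gt_eqF.
apply: (@mean_value_norm (fun y => E1 tau y - y)
  (fun y => Eexp tau y - 1)) hy hy' => [z|z hz].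
  have D := is_derive_E1 z tn.
  by apply: is_derive_eq.
have M0 : 0 <= M by apply: le_trans hz.
have := HC tau z 0 t01 hz; rewrite normr0 => /(_ M0).
rewrite Eexp0 subrr !subr0 => h; rewrite (le_trans h) // mulrAC.
by rewrite ler_wpM2r ?(ltW t0) // ler_wpM2l // (le_trans hz) // ler_norm.
Qed.

Lemma small_lipschitz_E2 : small_lipschitz (fun tau y => E2 tau y - y ^+ 2 / 2).
Proof.
move=> M; have [C C0 HC] := small_lipschitz_E1 M.
exists (C * `|M|) => [|tau y y' t01 hy hy']; first by rewrite mulr_ge0.
have [t0 t1] := andP t01.
have tn : tau != 0 by rewrite gt_eqF.
apply: (@mean_value_norm (fun y => E2 tau y - y ^+ 2 / 2)
  (fun y => E1 tau y - y)) hy hy' => [z|z hz].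
  have D := is_derive_E2 z tn.
  by apply: is_derive_eq; rewrite /GRing.scale /=; field.
have M0 : 0 <= M by apply: le_trans hz.
have := HC tau z 0 t01 hz; rewrite normr0 => /(_ M0).
rewrite E10 subrr !subr0 => h; rewrite (le_trans h) // mulrAC.
by rewrite ler_wpM2r ?(ltW t0) // ler_wpM2l // (le_trans hz) // ler_norm.
Qed.

End ExponentialPerturbation.

Section SeparatedWeight.
Context {R : realType}.
Implicit Types (f : R -> R) (s h t x y z : R).

Lemma continuous_bounded f M : continuous f ->
  exists2 K, 0 <= K & forall y, `|y| <= M -> `|f y| <= K.
Proof.
move=> cf; have [M0|M0] := leP 0 M; last first.
  by exists 0 => // y hy; move: (le_lt_trans (le_trans (normr_ge0 _) hy) M0); rewrite ltxx.
have MM : - M <= M by rewrite ge0_cp.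
have cn : {within `[- M, M], continuous (fun t => `|f t|)}.
  by apply: continuous_subspaceT => t; apply: cvg_norm; exact: cf.
have [c _ hc] := EVT_max MM cn; exists `|f c| => // y hy.
by apply: hc; rewrite in_itv /= -ler_norml.
Qed.

Lemma bounded_box_fst T f : continuous f -> bounded_box T (fun t _ => f t).
Proof.
move=> cf; have [K _ hK] := continuous_bounded T cf.
by exists K => t x [tT _]; apply: hK; rewrite ler_norml.
Qed.

Lemma bounded_box_snd T f : continuous f -> bounded_box T (fun _ x => f x).
Proof.
move=> cf; have [K _ hK] := continuous_bounded 1 cf.
exists K => t x [_ /andP[x0 x1]]; apply: hK; rewrite ler_norml x1 andbT.
by rewrite (le_trans _ x0) // oppr_le0.
Qed.

(** The difference quotients used below equal a derivative at a point within 3 h of x, by the mean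
    value theorem. That point may leave [0, 1], whence the bounds on |y| <= 4. *)
Lemma ucv_near T f f' (F : R -> R -> R -> R -> R) :
  (forall y, is_derive y 1 f (f' y)) -> continuous f' ->
  (forall s h t x, 0 < h -> exists2 c, `|c - x| <= 3 * h & F s h t x = f c) ->
  ucv T F (fun _ x => f x).
Proof.
move=> df cf' HF d d0; have [K K0 hK] := continuous_bounded 4 cf'.
have e0 : 0 < Num.min 1 (d / (3 * K + 1)).
  by rewrite lt_min ltr01 divr_gt0 // ltr_wpDl // mulr_ge0.
apply: eventually_imp (eventually_small e0) => s h [_ h0 _ + _] t x [_ /andP[x0 x1]].
rewrite le_min => /andP[h1 hd]; have [c cx ->] := HF s h t x h0.
have x4 : `|x| <= 4 by rewrite ger0_norm //; lra.
have c4 : `|c| <= 4.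
  rewrite -(subrK x c) (le_trans (ler_normD _ _)) // (ger0_norm x0).
  by rewrite (le_trans (lerD cx x1)) //; lra.
rewrite (le_trans (mean_value_norm df hK c4 x4)) //.
rewrite (le_trans (ler_wpM2l K0 cx)) //.
move: hd; rewrite ler_pdivlMr ?ltr_wpDl ?mulr_ge0 // => hd.
by apply: le_trans hd; rewrite mulrCA mulrA [h * _]mulrC ler_pM2r // mulrC lerDl.
Qed.

Variables (T beta x0 C0 lam : R).

(** As psi is a function of t plus a function of x, phi is [theta] t times [gauss] x. Time
    derivatives and space differences thus act on separate factors; the numbered functions are the
    successive derivatives. *)
Definition theta t : R := expR (lam * (C0 - beta * t ^+ 2)).
Definition theta1 t : R := - 2 * beta * lam * t * theta t.
Definition theta2 t : R :=
  (4 * beta ^+ 2 * lam ^+ 2 * t ^+ 2 - 2 * beta * lam) * theta t.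
Definition theta3 t : R :=
  (12 * beta ^+ 2 * lam ^+ 2 * t - 8 * beta ^+ 3 * lam ^+ 3 * t ^+ 3) * theta t.

Definition gauss x : R := expR (lam * (x - x0) ^+ 2).
Definition gauss1 x : R := 2 * lam * (x - x0) * gauss x.
Definition gauss2 x : R := (2 * lam + 4 * lam ^+ 2 * (x - x0) ^+ 2) * gauss x.
Definition gauss3 x : R :=
  (12 * lam ^+ 2 * (x - x0) + 8 * lam ^+ 3 * (x - x0) ^+ 3) * gauss x.
Definition gauss4 x : R :=
  (12 * lam ^+ 2 + 48 * lam ^+ 3 * (x - x0) ^+ 2
   + 16 * lam ^+ 4 * (x - x0) ^+ 4) * gauss x.

Lemma is_derive_theta t : is_derive t 1 theta (theta1 t).
Proof.
rewrite /theta1 /theta; apply: is_derive_eq; rewrite /GRing.scale /=; ring.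
Qed.

Lemma is_derive_theta1 t : is_derive t 1 theta1 (theta2 t).
Proof.
have D := is_derive_theta t.
by rewrite /theta1; apply: is_derive_eq; rewrite /theta1 /theta2 /GRing.scale /=; ring.
Qed.

Lemma is_derive_theta2 t : is_derive t 1 theta2 (theta3 t).
Proof.
have D := is_derive_theta t.
by rewrite /theta2; apply: is_derive_eq; rewrite /theta1 /theta3 /GRing.scale /=; ring.
Qed.

Lemma is_derive_gauss x : is_derive x 1 gauss (gauss1 x).
Proof.
rewrite /gauss1 /gauss; apply: is_derive_eq; rewrite /GRing.scale /=; ring.
Qed.

Lemma is_derive_gauss1 x : is_derive x 1 gauss1 (gauss2 x).
Proof.
have D := is_derive_gauss x.
by rewrite /gauss1; apply: is_derive_eq; rewrite /gauss1 /gauss2 /GRing.scale /=; ring.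
Qed.

Lemma is_derive_gauss2 x : is_derive x 1 gauss2 (gauss3 x).
Proof.
have D := is_derive_gauss x.
by rewrite /gauss2; apply: is_derive_eq; rewrite /gauss1 /gauss3 /GRing.scale /=; ring.
Qed.

Lemma is_derive_gauss3 x : is_derive x 1 gauss3 (gauss4 x).
Proof.
have D := is_derive_gauss x.
by rewrite /gauss3; apply: is_derive_eq; rewrite /gauss1 /gauss4 /GRing.scale /=; ring.
Qed.

Lemma is_derive_continuous f f' : (forall y, is_derive y 1 f (f' y)) -> continuous f.
Proof. by move=> df; apply: derivable_continuous => y; have [] := df y. Qed.

End SeparatedWeight.

Section BoundedLimits.
Context {R : realType} (T : R).
Implicit Types (s h t x delta M : R) (F : R -> R -> R -> R -> R) (f : R -> R -> R).

(** Boundedness of the limit is carried along because convergence of products requires it. *)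
Definition ucvb F f : Prop := bounded_box T f /\ ucv T F f.

Lemma ucvb_ext F' F f' f : (forall s h t x, 0 < s -> 0 < h -> F' s h t x = F s h t x) ->
  (forall t x, f' t x = f t x) -> ucvb F' f' -> ucvb F f.
Proof.
move=> EF Ef [[M bf] uf]; split.
  by exists M => t x tx; rewrite -Ef bf.
exact: (ucv_limit Ef (ucv_ext EF uf)).
Qed.

Lemma ucvbD F F' f f' : ucvb F f -> ucvb F' f' ->
  ucvb (fun s h t x => F s h t x + F' s h t x) (fun t x => f t x + f' t x).
Proof. by move=> [? ?] [? ?]; split; [exact: bounded_boxD|exact: ucvD]. Qed.

Lemma ucvbM F F' f f' : ucvb F f -> ucvb F' f' ->
  ucvb (fun s h t x => F s h t x * F' s h t x) (fun t x => f t x * f' t x).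
Proof. by move=> [? ?] [? ?]; split; [exact: bounded_boxM|exact: ucvM]. Qed.

Lemma ucvb_cst c : ucvb (fun _ _ _ _ => c) (fun _ _ => c).
Proof. by split; [exact: bounded_box_cst|exact: ucv_const]. Qed.

Lemma ucvbZ c F f : ucvb F f ->
  ucvb (fun s h t x => c * F s h t x) (fun t x => c * f t x).
Proof. exact: ucvbM (ucvb_cst c). Qed.

Lemma ucvbB F F' f f' : ucvb F f -> ucvb F' f' ->
  ucvb (fun s h t x => F s h t x - F' s h t x) (fun t x => f t x - f' t x).
Proof.
move=> H /(ucvbZ (-1)) H'; apply: ucvb_ext (ucvbD H H') => *; ring.
Qed.

Lemma ucvb_step : ucvb (fun s h _ _ => s * h) (fun _ _ => 0).
Proof.
split=> [|d d0]; first exact: bounded_box_cst.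
apply: eventually_imp (eventually_small d0) => s h [s0 h0 sh _ _] t x _.
by rewrite subr0 ger0_norm // mulr_ge0 // ltW.
Qed.

Lemma ucvb_lipschitz (L : R -> R -> R) F f : small_lipschitz L ->
  (forall tau, L tau 0 = 0) -> ucvb F f ->
  ucvb (fun s h t x => L (s * h) (F s h t x)) (fun _ _ => 0).
Proof.
by move=> hL L0 [bf H]; split; [exact: bounded_box_cst|exact: (ucv_lipschitz hL L0 bf)].
Qed.

Lemma ucvb_lipschitz_dif (L : R -> R -> R) F F' f f' g : small_lipschitz L ->
  ucvb F f -> ucvb F' f' ->
  ucvb (fun s h t x => (F' s h t x - F s h t x) / h) g ->
  ucvb (fun s h t x => (L (s * h) (F' s h t x) - L (s * h) (F s h t x)) / h)
      (fun _ _ => 0).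
Proof.
move=> hL [bf H] [bf' H'] [bg Hg]; split; first exact: bounded_box_cst.
exact: ucv_lipschitz_dif hL bf bf' bg H H' Hg.
Qed.

Lemma ucvb_Eexp F f : ucvb F f ->
  ucvb (fun s h t x => Eexp (s * h) (F s h t x)) (fun _ _ => 1).
Proof.
move=> H; have H1 := ucvb_lipschitz (@small_lipschitz_Eexp R) _ H.
apply: ucvb_ext (ucvbD (H1 _) (ucvb_cst 1)) => *; rewrite ?Eexp0; ring.
Qed.

Lemma ucvb_E1 F f : ucvb F f ->
  ucvb (fun s h t x => E1 (s * h) (F s h t x)) f.
Proof.
move=> H; have H1 := ucvb_lipschitz (@small_lipschitz_E1 R) _ H.
apply: ucvb_ext (ucvbD (H1 _) H) => *; rewrite ?E10; ring.
Qed.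

Lemma ucvb_E2 F f : ucvb F f ->
  ucvb (fun s h t x => E2 (s * h) (F s h t x)) (fun t x => f t x ^+ 2 / 2).
Proof.
move=> H; have H1 := ucvb_lipschitz (@small_lipschitz_E2 R) _ H.
by apply: ucvb_ext (ucvbD (H1 _) (ucvbZ 2^-1 (ucvbM H H))) => *;
  rewrite ?E20 ?expr0n /= ?mul0r ?subr0 //; ring.
Qed.

Section Differences.
Variables (F F' : R -> R -> R -> R -> R) (f g : R -> R -> R).
Hypotheses (H : ucvb F f) (H' : ucvb F' f).
Hypothesis D : ucvb (fun s h t x => (F' s h t x - F s h t x) / h) g.

Lemma ucvb_Eexp_dif : ucvb (fun s h t x =>
  (Eexp (s * h) (F' s h t x) - Eexp (s * h) (F s h t x)) / h) (fun _ _ => 0).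
Proof.
apply: ucvb_ext (ucvb_lipschitz_dif (@small_lipschitz_Eexp R) H H' D) => *; ring.
Qed.

Lemma ucvb_E1_dif : ucvb (fun s h t x =>
  (E1 (s * h) (F' s h t x) - E1 (s * h) (F s h t x)) / h) g.
Proof.
apply: ucvb_ext (ucvbD (ucvb_lipschitz_dif (@small_lipschitz_E1 R) H H' D) D) => *; ring.
Qed.

Lemma ucvb_E2_dif : ucvb (fun s h t x =>
  (E2 (s * h) (F' s h t x) - E2 (s * h) (F s h t x)) / h) (fun t x => f t x * g t x).
Proof.
apply: ucvb_ext (ucvbD (ucvb_lipschitz_dif (@small_lipschitz_E2 R) H H' D)
  (ucvbM (ucvbZ 2^-1 (ucvbD H H')) D)) => *;
  field; rewrite ?gt_eqF //.
Qed.

End Differences.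

Lemma ucvb_dif_mul F F' K K' f df k dk : ucvb F f -> ucvb K' k ->
  ucvb (fun s h t x => (F' s h t x - F s h t x) / h) df ->
  ucvb (fun s h t x => (K' s h t x - K s h t x) / h) dk ->
  ucvb (fun s h t x => (F' s h t x * K' s h t x - F s h t x * K s h t x) / h)
       (fun t x => df t x * k t x + f t x * dk t x).
Proof.
move=> HF HK HdF HdK; apply: ucvb_ext (ucvbD (ucvbM HdF HK) (ucvbM HF HdK)) => * //.
ring.
Qed.

End BoundedLimits.

(** * The explicit coefficients and their limits *)

Section Coefficients.
Context {R : realType} (T beta x0 C0 lam : R).
Local Notation th := (theta beta C0 lam).
Local Notation th1 := (theta1 beta C0 lam).
Local Notation th2 := (theta2 beta C0 lam).
Local Notation th3 := (theta3 beta C0 lam).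
Local Notation g0 := (gauss x0 lam).
Local Notation g1 := (gauss1 x0 lam).
Local Notation g2 := (gauss2 x0 lam).
Local Notation g3 := (gauss3 x0 lam).
Local Notation g4 := (gauss4 x0 lam).
Local Notation ucvb := (ucvb T).

Definition dgauss (h x : R) : R := (g0 (x + h) - g0 x) / h.

(* (phi (x + h) - phi x) / h and (phi (x - h) - phi x) / h *)
Definition gright (h t x : R) : R := th t * dgauss h x.
Definition gleft (h t x : R) : R := - (th t * dgauss h (x - h)).

(** This is 1 + A_0, [coef_b] is lambda A_1, and [coef_q] is lambda^2 (phi^2 psi_t^2 - A_2) without
    its part of order 1 / s. *)
Definition coef_m (s h t x : R) : R :=
  (Eexp (s * h) (gright h t x) + Eexp (s * h) (gleft h t x)) / 2.
Definition coef_b (s h t x : R) : R :=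
  (E1 (s * h) (gright h t x) - E1 (s * h) (gleft h t x)) / 2.
Definition coef_q (s h t x : R) : R :=
  (th1 t * g0 x) ^+ 2
  - (E2 (s * h) (gright h t x) + E2 (s * h) (gleft h t x)).
Definition coef_a (t x : R) : R := th1 t * g0 x.
(* The term 2 lam (1 + beta) phi is chosen so that, at h = 0, p + a_t + b_x and
   - p + a_t + b_x are 2 lam^2 phi times the square of a first derivative of psi
   plus one and the same positive function 2 lam (1 - beta) phi. *)
Definition coef_p (t x : R) : R :=
  th2 t * g0 x - th t * g2 x + 2 * lam * (1 + beta) * (th t * g0 x).

Definition gright_t (h t x : R) : R := th1 t * dgauss h x.
Definition gleft_t (h t x : R) : R := - (th1 t * dgauss h (x - h)).
Definition coef_mt (s h t x : R) : R :=
  - (s * h) * (Eexp (s * h) (gright h t x) * gright_t h t x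
               + Eexp (s * h) (gleft h t x) * gleft_t h t x) / 2.
Definition coef_bt (s h t x : R) : R :=
  (Eexp (s * h) (gright h t x) * gright_t h t x
   - Eexp (s * h) (gleft h t x) * gleft_t h t x) / 2.
Definition coef_qt (s h t x : R) : R :=
  2 * (th1 t * g0 x) * (th2 t * g0 x)
  - (E1 (s * h) (gright h t x) * gright_t h t x
     + E1 (s * h) (gleft h t x) * gleft_t h t x).
Definition coef_at (t x : R) : R := th2 t * g0 x.
Definition coef_pt (t x : R) : R :=
  th3 t * g0 x - th1 t * g2 x + 2 * lam * (1 + beta) * (th1 t * g0 x).

Let cth := is_derive_continuous (is_derive_theta beta C0 lam).
Let cth1 := is_derive_continuous (is_derive_theta1 beta C0 lam).
Let cth2 := is_derive_continuous (is_derive_theta2 beta C0 lam).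
Let cg1 := is_derive_continuous (is_derive_gauss1 x0 lam).
Let cg2 := is_derive_continuous (is_derive_gauss2 x0 lam).
Let cg3 := is_derive_continuous (is_derive_gauss3 x0 lam).

Let cth3 : continuous th3.
Proof.
apply: derivable_continuous => t; have D := is_derive_theta beta C0 lam t.
rewrite /theta3; exact: ex_derive.
Qed.

Let cg4 : continuous g4.
Proof.
apply: derivable_continuous => t; have D := is_derive_gauss x0 lam t.
rewrite /gauss4; exact: ex_derive.
Qed.

Let Uth (f : R -> R) : continuous f -> ucvb (fun _ _ t _ => f t) (fun t _ => f t).
Proof. by move=> cf; split; [exact: bounded_box_fst|exact: ucv_const]. Qed.

Let Unear (f f' : R -> R) F : (forall y : R, is_derive y 1 f (f' y)) -> continuous f' ->
  (forall s h t x : R, 0 < h -> exists2 c, `|c - x| <= 3 * h & F s h t x = f c) ->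
  ucvb F (fun _ x => f x).
Proof.
move=> df cf' H; split; last exact: ucv_near df cf' H.
by apply: bounded_box_snd; exact: is_derive_continuous df.
Qed.

Let Ushift (f f' : R -> R) e : (forall y : R, is_derive y 1 f (f' y)) -> continuous f' ->
  0 <= e <= 1 -> ucvb (fun _ h _ x => f (x + e * h)) (fun _ x => f x).
Proof.
move=> df cf' /andP[e0 e1]; apply: (Unear df cf') => _ h _ x h0; exists (x + e * h) => //.
by rewrite addrAC subrr add0r ger0_norm ?mulr_ge0 ?(ltW h0) // ler_wpM2r ?(ltW h0) //; lra.
Qed.

Let Udif (f f' f'' : R -> R) z : (forall y : R, is_derive y 1 f (f' y)) ->
  (forall y : R, is_derive y 1 f' (f'' y)) -> continuous f'' -> - 1 <= z <= 1 ->
  ucvb (fun _ h _ x => (f (x + z * h + h) - f (x + z * h)) / h) (fun _ x => f' x).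
Proof.
move=> df df' cf'' /andP[z0 z1]; apply: (Unear df' cf'') => _ h _ x h0.
have hle : x + z * h <= x + z * h + h by rewrite lerDl ltW.
have [c /andP[c1 c2] E] := mean_value df hle.
exists c; last by rewrite E addrAC subrr add0r mulfK // gt_eqF.
rewrite ler_norml; apply/andP; split; nra.
Qed.

Let e01 (e : R) : 0 <= e <= 1 -> - 1 <= e - 1 <= 1 /\ - 1 <= e <= 1.
Proof. by move=> /andP[? ?]; split; apply/andP; split; lra. Qed.

Let Udg z : - 1 <= z <= 1 ->
  ucvb (fun _ h _ x => dgauss h (x + z * h)) (fun _ x => g1 x).
Proof.
by move=> hz; exact: (Udif (is_derive_gauss x0 lam) (is_derive_gauss1 x0 lam) cg2 hz).
Qed.

Let Ugr e : 0 <= e <= 1 -> ucvb (fun _ h t x => gright h t (x + e * h))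
  (fun t x => th t * g1 x).
Proof. by move=> /e01[_ he]; exact: ucvbM (Uth cth) (Udg he). Qed.

Let Ugl e : 0 <= e <= 1 -> ucvb (fun _ h t x => gleft h t (x + e * h))
  (fun t x => - (th t * g1 x)).
Proof.
move=> /e01[he _]; apply: ucvb_ext (ucvbZ (-1) (ucvbM (Uth cth) (Udg he))) => *.
  by rewrite mulN1r /gleft mulrBl mul1r addrA.
by rewrite mulN1r.
Qed.

Let Ugrt e : 0 <= e <= 1 -> ucvb (fun _ h t x => gright_t h t (x + e * h))
  (fun t x => th1 t * g1 x).
Proof. by move=> /e01[_ he]; exact: ucvbM (Uth cth1) (Udg he). Qed.

Let Uglt e : 0 <= e <= 1 -> ucvb (fun _ h t x => gleft_t h t (x + e * h))
  (fun t x => - (th1 t * g1 x)).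
Proof.
move=> /e01[he _]; apply: ucvb_ext (ucvbZ (-1) (ucvbM (Uth cth1) (Udg he))) => *.
  by rewrite mulN1r /gleft_t mulrBl mul1r addrA.
by rewrite mulN1r.
Qed.

(** The values e = 0 and e = 1 are the two ends of a cell; the same shift is used for every
    coefficient. *)
Lemma ucvb_m e : 0 <= e <= 1 ->
  ucvb (fun s h t x => coef_m s h t (x + e * h)) (fun _ _ => 1).
Proof.
move=> he; apply: ucvb_ext
  (ucvbZ 2^-1 (ucvbD (ucvb_Eexp (Ugr he)) (ucvb_Eexp (Ugl he)))) => *.
  by rewrite /coef_m mulrC.
by field.
Qed.

Lemma ucvb_b e : 0 <= e <= 1 ->
  ucvb (fun s h t x => coef_b s h t (x + e * h)) (fun t x => th t * g1 x).
Proof.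
move=> he; apply: ucvb_ext
  (ucvbZ 2^-1 (ucvbB (ucvb_E1 (Ugr he)) (ucvb_E1 (Ugl he)))) => *.
  by rewrite /coef_b mulrC.
by field.
Qed.

Lemma ucvb_q e : 0 <= e <= 1 ->
  ucvb (fun s h t x => coef_q s h t (x + e * h))
       (fun t x => (th1 t * g0 x) ^+ 2 - (th t * g1 x) ^+ 2).
Proof.
move=> he; have G := Ushift (is_derive_gauss x0 lam) cg1 he.
apply: ucvb_ext (ucvbB (ucvbM (ucvbM (Uth cth1) G) (ucvbM (Uth cth1) G))
  (ucvbD (ucvb_E2 (Ugr he)) (ucvb_E2 (Ugl he)))) => *.
  by rewrite /coef_q expr2.
by field.
Qed.

Lemma ucvb_mt e : 0 <= e <= 1 ->
  ucvb (fun s h t x => coef_mt s h t (x + e * h)) (fun _ _ => 0).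
Proof.
move=> he; apply: ucvb_ext (ucvbM (ucvbZ (- 2^-1) (ucvb_step T))
  (ucvbD (ucvbM (ucvb_Eexp (Ugr he)) (Ugrt he))
         (ucvbM (ucvb_Eexp (Ugl he)) (Uglt he)))) => *.
  by rewrite /coef_mt; ring.
by ring.
Qed.

Lemma ucvb_bt e : 0 <= e <= 1 ->
  ucvb (fun s h t x => coef_bt s h t (x + e * h)) (fun t x => th1 t * g1 x).
Proof.
move=> he; apply: ucvb_ext (ucvbZ 2^-1
  (ucvbB (ucvbM (ucvb_Eexp (Ugr he)) (Ugrt he))
         (ucvbM (ucvb_Eexp (Ugl he)) (Uglt he)))) => *.
  by rewrite /coef_bt; ring.
by field.
Qed.

Lemma ucvb_qt e : 0 <= e <= 1 ->
  ucvb (fun s h t x => coef_qt s h t (x + e * h))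
       (fun t x => 2 * (th1 t * g0 x) * (th2 t * g0 x)
                   - 2 * (th t * g1 x) * (th1 t * g1 x)).
Proof.
move=> he; have G := Ushift (is_derive_gauss x0 lam) cg1 he.
apply: ucvb_ext (ucvbB
  (ucvbM (ucvbZ 2 (ucvbM (Uth cth1) G)) (ucvbM (Uth cth2) G))
  (ucvbD (ucvbM (ucvb_E1 (Ugr he)) (Ugrt he))
         (ucvbM (ucvb_E1 (Ugl he)) (Uglt he)))) => *.
  by rewrite /coef_qt.
by ring.
Qed.

Lemma ucvb_a e : 0 <= e <= 1 ->
  ucvb (fun _ h t x => coef_a t (x + e * h)) (fun t x => th1 t * g0 x).
Proof.
by move=> he; exact: ucvbM (Uth cth1) (Ushift (is_derive_gauss x0 lam) cg1 he).
Qed.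

Lemma ucvb_at e : 0 <= e <= 1 ->
  ucvb (fun _ h t x => coef_at t (x + e * h)) (fun t x => th2 t * g0 x).
Proof.
by move=> he; exact: ucvbM (Uth cth2) (Ushift (is_derive_gauss x0 lam) cg1 he).
Qed.

Lemma ucvb_p e : 0 <= e <= 1 ->
  ucvb (fun _ h t x => coef_p t (x + e * h)) coef_p.
Proof.
move=> he; have G := Ushift (is_derive_gauss x0 lam) cg1 he.
have G2 := Ushift (is_derive_gauss2 x0 lam) cg3 he.
exact: ucvbD (ucvbB (ucvbM (Uth cth2) G) (ucvbM (Uth cth) G2))
  (ucvbZ _ (ucvbM (Uth cth) G)).
Qed.

Lemma ucvb_pt e : 0 <= e <= 1 ->
  ucvb (fun _ h t x => coef_pt t (x + e * h)) coef_pt.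
Proof.
move=> he; have G := Ushift (is_derive_gauss x0 lam) cg1 he.
have G2 := Ushift (is_derive_gauss2 x0 lam) cg3 he.
exact: ucvbD (ucvbB (ucvbM (Uth cth3) G) (ucvbM (Uth cth1) G2))
  (ucvbZ _ (ucvbM (Uth cth1) G)).
Qed.

(** Two applications of the mean value theorem, first to [dgauss] h and then to the first derivative
    of [gauss]. The shifts z = 0 and z = -1 serve [gright] and [gleft]. *)
Let Udg2 z : - 1 <= z <= 0 ->
  ucvb (fun _ h _ x => (dgauss h (x + z * h + h) - dgauss h (x + z * h)) / h)
       (fun _ x => g2 x).
Proof.
move=> /andP[z0 z1].
apply: (Unear (is_derive_gauss2 x0 lam) cg3) => _ h _ x h0.
have hn : h != 0 by rewrite gt_eqF.
have hle (y : R) : y <= y + h by rewrite lerDl ltW.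
have Dd (y : R) : is_derive y 1 (dgauss h) ((g1 (y + h) - g1 y) / h).
  have D0 := is_derive_gauss x0 lam y.
  have Dh : is_derive y 1 (fun y : R => g0 (y + h)) (g1 (y + h)).
    have D2 : is_derive y 1 (fun y : R => y + h) 1.
      by apply: is_derive_eq; rewrite addr0.
    have := @is_derive1_comp _ g0 (fun y : R => y + h) y _ _
      (is_derive_gauss x0 lam (y + h)) D2.
    by rewrite mulr1.
  by rewrite /dgauss; apply: is_derive_eq; rewrite /GRing.scale /=; field.
have [c1 /andP[a1 b1] E1] := mean_value Dd (hle (x + z * h)).
have [c2 /andP[a2 b2] E2] := mean_value (is_derive_gauss1 x0 lam) (hle c1).
exists c2; first by rewrite ler_norml; apply/andP; split; nra.
rewrite E1 E2; field; exact: hn.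
Qed.

Let Ugr_dif : ucvb (fun _ h t x => (gright h t (x + h) - gright h t x) / h)
  (fun t x => th t * g2 x).
Proof.
have hz : - 1 <= (0 : R) <= 0 by rewrite lexx lerN10.
apply: ucvb_ext (ucvbM (Uth cth) (Udg2 hz)) => * //.
rewrite /gright mul0r addr0; ring.
Qed.

Let Ugl_dif : ucvb (fun _ h t x => (gleft h t (x + h) - gleft h t x) / h)
  (fun t x => - (th t * g2 x)).
Proof.
have hz : - 1 <= (- 1 : R) <= 0 by rewrite lexx lerN10.
apply: ucvb_ext (ucvbZ (-1) (ucvbM (Uth cth) (Udg2 hz))) => [s h t x *|*].
  rewrite /gleft (_ : x + -1 * h = x - h); last by ring.
  by rewrite subrK addrK; ring.
by rewrite mulN1r.
Qed.

Let h0 : 0 <= (0 : R) <= 1. Proof. by rewrite lexx ler01. Qed.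
Let h1 : 0 <= (1 : R) <= 1. Proof. by rewrite lexx ler01. Qed.

Let at0 (F : R -> R -> R -> R -> R) f :
  ucvb (fun s h t x => F s h t (x + 0 * h)) f -> ucvb F f.
Proof. by move=> H; apply: ucvb_ext H => * //; rewrite mul0r addr0. Qed.

Let at1 (F : R -> R -> R -> R -> R) f :
  ucvb (fun s h t x => F s h t (x + 1 * h)) f ->
  ucvb (fun s h t x => F s h t (x + h)) f.
Proof. by move=> H; apply: ucvb_ext H => * //; rewrite mul1r. Qed.

Let Ugr0 := at0 (F := fun=> gright) (Ugr h0).
Let Ugl0 := at0 (F := fun=> gleft) (Ugl h0).
Let Ugr1 := at1 (F := fun=> gright) (Ugr h1).
Let Ugl1 := at1 (F := fun=> gleft) (Ugl h1).

Lemma ucvb_m_dif :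
  ucvb (fun s h t x => (coef_m s h t (x + h) - coef_m s h t x) / h) (fun _ _ => 0).
Proof.
apply: ucvb_ext (ucvbZ 2^-1 (ucvbD (ucvb_Eexp_dif Ugr0 Ugr1 Ugr_dif)
  (ucvb_Eexp_dif Ugl0 Ugl1 Ugl_dif))) => *; rewrite ?addr0 ?mulr0 //.
by rewrite /coef_m; ring.
Qed.

Lemma ucvb_b_dif :
  ucvb (fun s h t x => (coef_b s h t (x + h) - coef_b s h t x) / h)
       (fun t x => th t * g2 x).
Proof.
apply: ucvb_ext (ucvbZ 2^-1 (ucvbB (ucvb_E1_dif Ugr0 Ugr1 Ugr_dif)
  (ucvb_E1_dif Ugl0 Ugl1 Ugl_dif))) => *; last by field.
by rewrite /coef_b; ring.
Qed.

Let Ugauss_dif : ucvb (fun _ h _ x => (g0 (x + h) - g0 x) / h) (fun _ x => g1 x).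
Proof.
apply: ucvb_ext (Udg (_ : - 1 <= (0 : R) <= 1)) => * //; last by rewrite lerN10 ler01.
by rewrite /dgauss mul0r addr0.
Qed.

Let Ugauss2_dif : ucvb (fun _ h _ x => (g2 (x + h) - g2 x) / h) (fun _ x => g3 x).
Proof.
have hz : - 1 <= (0 : R) <= 1 by rewrite lerN10 ler01.
apply: ucvb_ext (Udif (is_derive_gauss2 x0 lam) (is_derive_gauss3 x0 lam) cg4 hz) => * //.
by rewrite mul0r addr0.
Qed.

Lemma ucvb_a_dif :
  ucvb (fun _ h t x => (coef_a t (x + h) - coef_a t x) / h) (fun t x => th1 t * g1 x).
Proof.
by apply: ucvb_ext (ucvbM (Uth cth1) Ugauss_dif) => * //; rewrite /coef_a; ring.
Qed.

Lemma ucvb_p_dif : ucvb (fun _ h t x => (coef_p t (x + h) - coef_p t x) / h)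
  (fun t x => th2 t * g1 x - th t * g3 x + 2 * lam * (1 + beta) * (th t * g1 x)).
Proof.
apply: ucvb_ext (ucvbD (ucvbB (ucvbM (Uth cth2) Ugauss_dif)
  (ucvbM (Uth cth) Ugauss2_dif)) (ucvbZ (2 * lam * (1 + beta))
  (ucvbM (Uth cth) Ugauss_dif))) => * //.
by rewrite /coef_p; ring.
Qed.

Lemma ucvb_q_dif :
  ucvb (fun s h t x => (coef_q s h t (x + h) - coef_q s h t x) / h)
       (fun t x => 2 * (th1 t * g0 x) * (th1 t * g1 x)
                   - 2 * (th t * g1 x) * (th t * g2 x)).
Proof.
have A := ucvb_dif_mul (at0 (F := fun _ _ => coef_a) (ucvb_a h0))
  (at1 (F := fun _ _ => coef_a) (ucvb_a h1)) ucvb_a_dif ucvb_a_dif.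
apply: ucvb_ext (ucvbB A (ucvbD (ucvb_E2_dif Ugr0 Ugr1 Ugr_dif)
  (ucvb_E2_dif Ugl0 Ugl1 Ugl_dif))) => *; last by ring.
by rewrite /coef_q /coef_a; ring.
Qed.

Lemma ucvb_laplace : ucvb (fun _ h t x => (gright h t x + gleft h t x) / h)
  (fun t x => th t * g2 x).
Proof.
have hz : - 1 <= (- 1 : R) <= 0 by rewrite lexx lerN10.
apply: ucvb_ext (ucvbM (Uth cth) (Udg2 hz)) => [s h t x *|//].
rewrite /gleft /gright (_ : x + -1 * h = x - h); last by ring.
by rewrite subrK; ring.
Qed.

Lemma bounded_coef_p : bounded_box T coef_p.
Proof. by have [] := at0 (F := fun _ _ => coef_p) (ucvb_p h0). Qed.

(* The limits of QB and K in [coeffs_close]. *)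
Definition limQB (t x : R) : R :=
  (2 * (th1 t * g0 x) * (th1 t * g1 x) - 2 * (th t * g1 x) * (th t * g2 x))
    * (th t * g1 x)
  + ((th1 t * g0 x) ^+ 2 - (th t * g1 x) ^+ 2) * (th t * g2 x).

Definition limK (t x : R) : R :=
  let q := (th1 t * g0 x) ^+ 2 - (th t * g1 x) ^+ 2 in
  - (coef_p t x * q) + (th2 t * g0 x * q + th1 t * g0 x *
    (2 * (th1 t * g0 x) * (th2 t * g0 x) - 2 * (th t * g1 x) * (th1 t * g1 x))).

Lemma eventually_bound (F : R -> R -> R -> R -> R) f : ucvb F f ->
  exists M, forall C, M <= C ->
  eventually_sh (fun s h => forall t x, box T t x -> `|F s h t x| <= C).
Proof.
move=> [bf uf]; have [M HM] := ucv_ubounded bf uf; exists M => C MC.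
by apply: eventually_imp HM => s h K t x tx; apply: le_trans MC; exact: K.
Qed.

(** C comes before delta: the later choice of delta depends on C through (3 C + 11) delta <= c. *)
Lemma coeffs_eventually_close : exists2 C, 0 < C &
  [/\ forall t x, box T t x -> `|th t * g2 x| <= C /\ `|limQB t x| <= C,
      eventually_sh (fun s h => forall t x, box T t x ->
        `|coef_m s h t (x + h) * coef_b s h t (x + h)| <= C) &
      forall delta, 0 < delta ->
  eventually_sh (fun s h => forall t (j : nat), box T t (j%:R * h) ->
  let x := j%:R * h in
  coeffs_close h (fun i => coef_m s h t (i%:R * h)) (fun i => coef_p t (i%:R * h))
    (fun i => coef_q s h t (i%:R * h)) (fun i => coef_a t (i%:R * h))
    (fun i => coef_b s h t (i%:R * h)) (fun i => coef_mt s h t (i%:R * h))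
    (fun i => coef_pt t (i%:R * h)) (fun i => coef_qt s h t (i%:R * h))
    (fun i => coef_at t (i%:R * h)) (fun i => coef_bt s h t (i%:R * h)) j
    delta C (coef_p t x) (th2 t * g0 x) (th1 t * g1 x) (th t * g2 x)
    (limQB t x) (limK t x))].
Proof.
pose m0 := at0 (F := coef_m) (ucvb_m h0); pose m1 := at1 (F := coef_m) (ucvb_m h1).
pose b0 := at0 (F := coef_b) (ucvb_b h0); pose b1 := at1 (F := coef_b) (ucvb_b h1).
pose q0 := at0 (F := coef_q) (ucvb_q h0); pose q1 := at1 (F := coef_q) (ucvb_q h1).
pose a0 := at0 (F := fun _ _ => coef_a) (ucvb_a h0).
pose a1 := at1 (F := fun _ _ => coef_a) (ucvb_a h1).
pose p0 := at0 (F := fun _ _ => coef_p) (ucvb_p h0).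
pose p1 := at1 (F := fun _ _ => coef_p) (ucvb_p h1).
pose mt0 := at0 (F := coef_mt) (ucvb_mt h0); pose mt1 := at1 (F := coef_mt) (ucvb_mt h1).
pose bt0 := at0 (F := coef_bt) (ucvb_bt h0); pose bt1 := at1 (F := coef_bt) (ucvb_bt h1).
pose qt0 := at0 (F := coef_qt) (ucvb_qt h0); pose qt1 := at1 (F := coef_qt) (ucvb_qt h1).
pose aat0 := at0 (F := fun _ _ => coef_at) (ucvb_at h0).
pose aat1 := at1 (F := fun _ _ => coef_at) (ucvb_at h1).
pose pt0 := at0 (F := fun _ _ => coef_pt) (ucvb_pt h0).
pose pt1 := at1 (F := fun _ _ => coef_pt) (ucvb_pt h1).
have [M1 H1] := eventually_bound (ucvb_dif_mul m0 p1 ucvb_m_dif ucvb_p_dif).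
have [M2 H2] := eventually_bound pt0; have [M3 H3] := eventually_bound pt1.
have [M4 H4] := eventually_bound (ucvbM m1 b1).
have dqb := ucvb_dif_mul q0 b1 ucvb_q_dif ucvb_b_dif.
have [[M5 H5] _] := ucvb_b_dif; have [[M6 H6] _] := dqb.
pose C := `|M1| + `|M2| + `|M3| + `|M4| + `|M5| + `|M6| + 1.
have [n1 n2 n3] := And3 (normr_ge0 M1) (normr_ge0 M2) (normr_ge0 M3).
have [n4 n5 n6] := And3 (normr_ge0 M4) (normr_ge0 M5) (normr_ge0 M6).
have [l1 l2 l3] := And3 (ler_norm M1) (ler_norm M2) (ler_norm M3).
have [l4 l5 l6] := And3 (ler_norm M4) (ler_norm M5) (ler_norm M6).
have [c1 c2 c3] : [/\ M1 <= C, M2 <= C & M3 <= C] by rewrite /C; split; lra.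
have [c4 c5 c6] : [/\ M4 <= C, M5 <= C & M6 <= C] by rewrite /C; split; lra.
exists C; first by rewrite /C; lra.
split.
- move=> t x tx; split; first exact: le_trans (H5 t x tx) c5.
  exact: le_trans (H6 t x tx) c6.
- exact: H4.
move=> d d0.
have mp := ucvbM m0 p0.
have dam := ucvb_dif_mul a0 m1 ucvb_a_dif ucvb_m_dif.
have dmb := ucvb_dif_mul m0 b1 ucvb_m_dif ucvb_b_dif.
have atm := ucvbZ 2^-1 (ucvbD (ucvbD (ucvbM aat0 m0) (ucvbM a0 mt0))
  (ucvbD (ucvbM aat1 m1) (ucvbM a1 mt1))).
have pa0 := ucvbD p0 aat0; have pa1 := ucvbD p1 aat1.
have z0 := ucvbD (ucvbZ (-1) (ucvbM p0 q0)) (ucvbD (ucvbM aat0 q0) (ucvbM a0 qt0)).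
have z1 := ucvbD (ucvbZ (-1) (ucvbM p1 q1)) (ucvbD (ucvbM aat1 q1) (ucvbM a1 qt1)).
have E1 := eventually_and (H1 C c1) (eventually_and (H2 C c2) (H3 C c3)).
have E2 := eventually_and (eventually_and (mp.2 d d0) (dam.2 d d0))
  (eventually_and (eventually_and (dmb.2 d d0) (dqb.2 d d0)) (ucvb_b_dif.2 d d0)).
have E3 := eventually_and (atm.2 d d0) (eventually_and (bt0.2 d d0) (bt1.2 d d0)).
have E4 := eventually_and (eventually_and (pa0.2 d d0) (pa1.2 d d0))
  (eventually_and (z0.2 d d0) (z1.2 d d0)).
apply: eventually_imp2 (eventually_and E1 E2) (eventually_and E3 E4) => s h.
move=> [[K1 [K2 K3]] [[K4 K5] [[K6 K7] K8]]] [[K9 [K10 K11]] [[K12 K13] [K14 K15]]].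
move=> t j bx x; rewrite /coeffs_close /dif /avg.
have jS : j.+1%:R * h = x + h by rewrite -natr1 mulrDl mul1r.
rewrite jS -/x.
move: {K1 K2 K3} (K1 t x bx) (K2 t x bx) (K3 t x bx) => K1 K2 K3.
move: {K4 K5 K6} (K4 t x bx) (K5 t x bx) (K6 t x bx) => K4 K5 K6.
move: {K7 K8 K9} (K7 t x bx) (K8 t x bx) (K9 t x bx) => K7 K8 K9.
move: {K10 K11} (K10 t x bx) (K11 t x bx) => K10 K11.
move: {K12 K13} (K12 t x bx) (K13 t x bx) => K12 K13.
move: {K14 K15} (K14 t x bx) (K15 t x bx) => K14 K15.
split; split => //.
- by move: K4; rewrite mul1r.
- by move: K5; rewrite mulr0 mulr1 addr0.
- by move: K6; rewrite mul0r mul1r add0r.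
- move: K9; rewrite !(mulr1, mulr0, addr0) mulrC.
  by have -> : 2^-1 * (th2 t * g0 x + th2 t * g0 x) = th2 t * g0 x by field.
- by move: K14; rewrite !mulN1r.
- by move: K15; rewrite !mulN1r.
Qed.

End Coefficients.

(** * The conjugated operators *)

Section TaylorKernel.
Context {R : realType}.
Local Notation mu := (@lebesgue_measure R).
Implicit Types (r : R -> R) (x h sigma a b : R).

Lemma is_derive_affine r r' x h sigma : (forall y : R, is_derive y 1 r (r' y)) ->
  is_derive sigma 1 (fun u : R => r (x + u * h)) (r' (x + sigma * h) * h).
Proof.
move=> dr; have D : is_derive sigma 1 (fun u : R => x + u * h) h.
  by apply: is_derive_eq; rewrite /GRing.scale /=; ring.
exact: (@is_derive1_comp _ r (fun u : R => x + u * h) sigma _ _ (dr _) D).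
Qed.

Lemma continuous_affine r x h : continuous r -> continuous (fun u : R => r (x + u * h)).
Proof.
move=> cr u; apply: (@continuous_comp _ _ _ (fun u : R => x + u * h) r); last exact: cr.
by apply: cvgD; [exact: cvg_cst|apply: cvgM; [exact: cvg_id|exact: cvg_cst]].
Qed.

Lemma Rintegral_derive (f g : R -> R) a b : a < b ->
  (forall t : R, is_derive t 1 f (g t)) -> continuous g ->
  \int[mu]_(t in `[a, b]) g t = f b - f a.
Proof.
move=> ab df cg; have [_ E] := ac_derive ab df cg.
by rewrite (E b) ?lexx ?ltW // addrAC subrr add0r.
Qed.

Lemma integrable_continuous (f : R -> R) a b : continuous f ->
  mu.-integrable `[a, b] (EFin \o f).
Proof.
move=> cf; apply: continuous_compact_integrable; first exact: segment_compact.
exact: continuous_subspaceT.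
Qed.

Lemma centered_difference_integral r r' x h : h != 0 ->
  (forall y : R, is_derive y 1 r (r' y)) -> continuous r' ->
  \int[mu]_(u in `[- 1, 1]) r' (x + u * h) = (r (x + h) - r (x - h)) / h.
Proof.
move=> hn dr cr'.
have D (u : R) : is_derive u 1 (fun u : R => h^-1 * r (x + u * h)) (r' (x + u * h)).
  have D1 := is_derive_affine x h u dr.
  by apply: is_derive_eq; rewrite /GRing.scale /=; field.
rewrite (Rintegral_derive _ D) ?ltrN10 //; last exact: continuous_affine.
  by rewrite mul1r mulN1r; ring.
Qed.

(** Here 1 - |u| is the Peano kernel of the second difference, so this is Taylor's formula with
    integral remainder on both sides of x. *)
Lemma second_difference_integral r r' r'' x h : h != 0 ->
  (forall y : R, is_derive y 1 r (r' y)) -> (forall y : R, is_derive y 1 r' (r'' y)) ->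
  continuous r'' ->
  \int[mu]_(u in `[- 1, 1]) ((1 - `|u|) * r'' (x + u * h))
  = (r (x + h) - 2 * r x + r (x - h)) / h ^+ 2.
Proof.
move=> hn dr dr' cr''.
have ca := @continuous_affine r'' x h cr''.
have cn : continuous (fun u : R => (1 - `|u|) * r'' (x + u * h)).
  move=> u; apply: cvgM; last exact: ca.
  by apply: cvgB; [exact: cvg_cst|apply: cvg_norm; exact: cvg_id].
have in_ := integrable_continuous (- 1) 1 cn.
have := @Rintegral_itvB _ _ (BLeft (- 1)) (BRight 1) 0 in_.
rewrite !bnd_simp lerN10 ler01 => /(_ isT isT) /eqP.
rewrite subr_eq => /eqP ->.
rewrite Rintegral_itv_obnd_cbnd; last first.
  apply: integrableS in_ => //; apply: subset_itvr.
  by rewrite bnd_simp lerN10.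
(* Explicit primitives from an integration by parts, one for each sign of u. *)
have Dr (u : R) : is_derive u 1 (fun u : R => h^-1 * ((1 - u) * r' (x + u * h))
    + h ^- 2 * r (x + u * h)) ((1 - u) * r'' (x + u * h)).
  have D1 := is_derive_affine x h u dr; have D2 := is_derive_affine x h u dr'.
  by apply: is_derive_eq; rewrite /GRing.scale /=; field.
have Dl (u : R) : is_derive u 1 (fun u : R => h^-1 * ((1 + u) * r' (x + u * h))
    - h ^- 2 * r (x + u * h)) ((1 + u) * r'' (x + u * h)).
  have D1 := is_derive_affine x h u dr; have D2 := is_derive_affine x h u dr'.
  by apply: is_derive_eq; rewrite /GRing.scale /=; field.
rewrite (@eq_Rintegral _ _ _ mu `[0, 1] (fun u => (1 - u) * r'' (x + u * h))); last first.
  by move=> u; rewrite inE /= in_itv /= => /andP[u0 _]; rewrite ger0_norm.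
rewrite (@eq_Rintegral _ _ _ mu `[- 1, 0] (fun u => (1 + u) * r'' (x + u * h))); last first.
  by move=> u; rewrite inE /= in_itv /= => /andP[_ u0]; rewrite ler0_norm // opprK.
rewrite (Rintegral_derive _ Dr) ?ltr01 //; last first.
  by move=> u; apply: cvgM; [apply: cvgB; [exact: cvg_cst|exact: cvg_id]|exact: ca].
rewrite (Rintegral_derive _ Dl) ?ltrN10 //; last first.
  by move=> u; apply: cvgM; [apply: cvgD; [exact: cvg_cst|exact: cvg_id]|exact: ca].
rewrite !(mul0r, mul1r, mulN1r, addr0); field.
exact: hn.
Qed.

End TaylorKernel.

(** * The averages A_0, A_1, A_2 in terms of ratios of rho *)

Section WeightIntegrals.
Context {R : realType} (T beta x0 C0 lam : R).
Local Notation mu := (@lebesgue_measure R).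
Local Notation w := (psi beta x0 C0).
Local Notation th := (theta beta C0 lam).
Local Notation g0 := (gauss x0 lam).
Local Notation g1 := (gauss1 x0 lam).
Local Notation g2 := (gauss2 x0 lam).
Implicit Types (s h t x y : R).

Lemma phiE t x : phi w lam t x = th t * g0 x.
Proof.
by rewrite /phi /theta /gauss -expRD /psi real_normK ?num_real //; congr expR; ring.
Qed.

Lemma dt_wE t x : dt_w w t x = - 2 * beta * t.
Proof.
rewrite /dt_w derive1E; have D : is_derive t 1 (w ^~ x) (- 2 * beta * t).
  by rewrite /psi; apply: is_derive_eq; rewrite /GRing.scale /=; ring.
by have [_ ->] := D.
Qed.

Let psiE t : w t = fun x => (x - x0) ^+ 2 - beta * t ^+ 2 + C0.
Proof. by apply/funext => x; rewrite /psi real_normK ?num_real. Qed.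

Let derive1_psi t : derive1 (w t) = fun x => 2 * (x - x0).
Proof.
apply/funext => x; rewrite derive1E psiE.
have D : is_derive x 1 (fun x => (x - x0) ^+ 2 - beta * t ^+ 2 + C0) (2 * (x - x0)).
  by apply: is_derive_eq; rewrite /GRing.scale /=; ring.
by have [_ ->] := D.
Qed.

Lemma dx_wE t x : dx_w w t x = 2 * (x - x0).
Proof. by rewrite /dx_w derive1_psi. Qed.

Lemma dxx_wE t x : dxx_w w t x = 2.
Proof.
rewrite /dxx_w /= derive1_psi derive1E.
have D : is_derive x 1 (fun x => 2 * (x - x0)) 2.
  by apply: is_derive_eq; rewrite /GRing.scale /=; ring.
by have [_ ->] := D.
Qed.

Variables (s h t x : R).
Hypotheses (lam0 : 0 < lam) (s0 : 0 < s) (h0 : 0 < h).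

Local Notation r := (rho w lam s t).
Let r1 y := - (s * (th t * g1 y)) * r y.
Let r2 y := ((s * (th t * g1 y)) ^+ 2 - s * (th t * g2 y)) * r y.

Let rE : r = fun y => expR (- (s * (th t * g0 y))).
Proof. by apply/funext => y; rewrite /rho phiE. Qed.

Let rx0 y : r y != 0.
Proof. by rewrite /rho gt_eqF // expR_gt0. Qed.

Let Dr y : is_derive y 1 r (r1 y).
Proof.
rewrite /r1 rE; have D := is_derive_gauss x0 lam y.
by apply: is_derive_eq; rewrite /GRing.scale /=; ring.
Qed.

Let Dr1 y : is_derive y 1 r1 (r2 y).
Proof.
rewrite /r1 /r2; have D := is_derive_gauss1 x0 lam y; have D2 := Dr y.
by apply: is_derive_eq; rewrite /r1 /GRing.scale /=; ring.
Qed.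

Let cr1 : continuous r1.
Proof. exact: is_derive_continuous Dr1. Qed.

Let cr2 : continuous r2.
Proof.
apply: derivable_continuous => y; rewrite /r2.
have D := is_derive_gauss1 x0 lam y; have D2 := Dr y.
have D3 := is_derive_gauss2 x0 lam y.
exact: ex_derive.
Qed.

Let hn : h != 0. Proof. by rewrite gt_eqF. Qed.
Let sn : s != 0. Proof. by rewrite gt_eqF. Qed.
Let ln : lam != 0. Proof. by rewrite gt_eqF. Qed.

Lemma rho_right : r (x + h) / r x = Eexp (s * h) (gright beta x0 C0 lam h t x).
Proof.
rewrite rE /Eexp /gright /dgauss -expRN -expRD; congr expR; field; exact: hn.
Qed.

Lemma rho_left : r (x - h) / r x = Eexp (s * h) (gleft beta x0 C0 lam h t x).
Proof.
rewrite rE /Eexp /gleft /dgauss subrK -expRN -expRD; congr expR; field; exact: hn.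
Qed.

(** The integrand phi psi_x rho is a multiple of rho_x, so A_1 is a centered difference of rho
    divided by rho. *)
Lemma A1E : lam * A1 w lam s h t x = coef_b beta x0 C0 lam s h t x.
Proof.
have cI := centered_difference_integral x hn Dr cr1.
rewrite /A1 /coef_b /E1 -rho_right -rho_left.
have -> : (fun u => phi w lam t (x + u * h) * dx_w w t (x + u * h)
    * (r (x + u * h) / r x)) = fun u => (- (s * lam * r x)^-1) * r1 (x + u * h).
  apply/funext => u; rewrite phiE dx_wE /r1 /gauss1.
  by field; rewrite rx0 sn ln.
rewrite RintegralZl //; last first.
  apply: integrable_continuous; exact: continuous_affine cr1.
rewrite cI; field.
by rewrite hn sn rx0 ln.
Qed.

Let k2 y := phi w lam t y ^+ 2 * dx_w w t y ^+ 2.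
Let k3 y := phi w lam t y * dx_w w t y ^+ 2.
Let k4 y := phi w lam t y * dxx_w w t y.

Let k2E : k2 = fun y => (th t * g0 y) ^+ 2 * (2 * (y - x0)) ^+ 2.
Proof. by apply/funext => y; rewrite /k2 phiE dx_wE. Qed.

Let k3E : k3 = fun y => (th t * g0 y) * (2 * (y - x0)) ^+ 2.
Proof. by apply/funext => y; rewrite /k3 phiE dx_wE. Qed.

Let k4E : k4 = fun y => (th t * g0 y) * 2.
Proof. by apply/funext => y; rewrite /k4 phiE dxx_wE. Qed.

Let cont_kernel (k : R -> R) : continuous k ->
  continuous (fun u : R => (1 - `|u|) * k (x + u * h) * (r (x + u * h) / r x)).
Proof.
move=> ck u; apply: cvgM; first apply: cvgM.
- by apply: cvgB; [exact: cvg_cst|apply: cvg_norm; exact: cvg_id].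
- exact: continuous_affine ck _.
- apply: cvgM; last exact: cvg_cst.
  exact: continuous_affine (is_derive_continuous Dr) _.
Qed.

Let ck2 : continuous k2.
Proof.
rewrite k2E; apply: derivable_continuous => y.
have D := is_derive_gauss x0 lam y; exact: ex_derive.
Qed.

Let ck3 : continuous k3.
Proof.
rewrite k3E; apply: derivable_continuous => y.
have D := is_derive_gauss x0 lam y; exact: ex_derive.
Qed.

Let ck4 : continuous k4.
Proof.
rewrite k4E; apply: derivable_continuous => y.
have D := is_derive_gauss x0 lam y; exact: ex_derive.
Qed.

(** The three integrands combine to rho_xx / rho, since rho_xx is (s^2 lam^2 phi^2 psi_x^2 - s lam^2
    phi psi_x^2 - s lam phi psi_xx) rho. *)
Lemma second_difference_rho :
  s ^+ 2 * lam ^+ 2 * A2 w lam s h t x - s * lam ^+ 2 * A3 w lam s h t x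
    - s * lam * A4 w lam s h t x
  = (r (x + h) / r x - 2 + r (x - h) / r x) / h ^+ 2.
Proof.
have cI := second_difference_integral x hn Dr Dr1 cr2.
have i2 := integrable_continuous (- 1) 1 (cont_kernel ck2).
have i3 := integrable_continuous (- 1) 1 (cont_kernel ck3).
have i4 := integrable_continuous (- 1) 1 (cont_kernel ck4).
rewrite /A2 /A3 /A4 -!RintegralZl //.
rewrite -RintegralB //; [|exact: integrableZlR|exact: integrableZlR].
rewrite -RintegralB //; [|apply: integrableBR => //; exact: integrableZlR
                         |exact: integrableZlR].
transitivity (\int[mu]_(u in `[- 1, 1]) ((r x)^-1 * ((1 - `|u|) * r2 (x + u * h)))).
  apply: eq_Rintegral => u _.
  rewrite phiE dx_wE dxx_wE /r2 /gauss1 /gauss2.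
  by field; rewrite rx0.
rewrite RintegralZl //; last first.
  apply: integrable_continuous => u; apply: cvgM.
    by apply: cvgB; [exact: cvg_cst|apply: cvg_norm; exact: cvg_id].
  exact: continuous_affine cr2 _.
rewrite cI; field.
by rewrite hn rx0.
Qed.

Lemma A0E : 1 + A0 w lam s h t x = coef_m beta x0 C0 lam s h t x.
Proof.
rewrite /A0 second_difference_rho /coef_m -rho_right -rho_left; field.
by rewrite hn rx0.
Qed.

(** A_2 is reached through the combination above; the difference quotients and the averages A_3, A_4
    that accompany it are of order s only and go to the residual. *)
Lemma A2E : s ^+ 2 * lam ^+ 2 * A2 w lam s h t x =
  s ^+ 2 * (E2 (s * h) (gright beta x0 C0 lam h t x)
            + E2 (s * h) (gleft beta x0 C0 lam h t x))
  - s * ((gright beta x0 C0 lam h t x + gleft beta x0 C0 lam h t x) / h)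
  + s * lam ^+ 2 * A3 w lam s h t x + s * lam * A4 w lam s h t x.
Proof.
have := second_difference_rho; rewrite rho_right rho_left => E.
have -> : s ^+ 2 * lam ^+ 2 * A2 w lam s h t x =
  (s ^+ 2 * lam ^+ 2 * A2 w lam s h t x - s * lam ^+ 2 * A3 w lam s h t x
    - s * lam * A4 w lam s h t x)
  + s * lam ^+ 2 * A3 w lam s h t x + s * lam * A4 w lam s h t x by ring.
rewrite E /E2; field.
by rewrite hn sn.
Qed.

Lemma kernel_integral_le (k : R -> R) B : continuous k ->
  (forall u, -1 <= u <= 1 -> `|k (x + u * h)| * (r (x + u * h) / r x) <= B) ->
  `|\int[mu]_(u in `[- 1, 1]) ((1 - `|u|) * k (x + u * h) * (r (x + u * h) / r x))|
   <= B * 2.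
Proof.
move=> ck H; have i := integrable_continuous (- 1) 1 (cont_kernel ck).
rewrite (le_trans (le_normr_Rintegral _ i)) //.
have -> : B * 2 = \int[mu]_(u in `[- 1, 1]) B.
  rewrite Rintegral_cst //= lebesgue_measure_itv /= lte_fin.
  by rewrite gtrN // -EFinD /=; congr (_ * _); ring.
apply: le_Rintegral => //.
- exact: integrable_norm.
- by apply: integrable_continuous => u; exact: cvg_cst.
move=> u; rewrite /= in_itv /= => hu; rewrite (le_trans _ (H u hu)) // !normrM.
rewrite ler_pM ?mulr_ge0 //.
  rewrite ler_piMl // ger0_norm; first by rewrite lerBlDr lerDl.
  by rewrite subr_ge0 ler_norml.
by rewrite -normrM ger0_norm // mulr_ge0 ?invr_ge0 // /rho expR_ge0.
Qed.

End WeightIntegrals.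

Section KernelBounds.
Context {R : realType} (T beta x0 C0 lam : R).
Local Notation mu := (@lebesgue_measure R).
Local Notation w := (psi beta x0 C0).
Local Notation th := (theta beta C0 lam).
Local Notation g0 := (gauss x0 lam).
Implicit Types (s h t x y : R).

Lemma theta_ge0 t : 0 <= th t. Proof. exact: expR_ge0. Qed.
Lemma gauss_ge0 x : 0 <= g0 x. Proof. exact: expR_ge0. Qed.

(** Over a distance h the exponent s phi changes by at most s h M K1 <= M K1, so the ratios of rho
    stay bounded. *)
Lemma kernel_eventually_bounded (k : R -> R) : continuous k -> exists2 C, 0 <= C &
  eventually_sh (fun s h => forall t x, box T t x ->
    `|\int[mu]_(u in `[- 1, 1]) ((1 - `|u|) * (th t * k (x + u * h))
        * (rho w lam s t (x + u * h) / rho w lam s t x))| <= C).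
Proof.
move=> ck.
have [M M0 hM] := continuous_bounded T (is_derive_continuous (is_derive_theta beta C0 lam)).
have [K K0 hK] := continuous_bounded 2 ck.
have [K1 K10 hK1] := continuous_bounded 2 (is_derive_continuous (is_derive_gauss1 x0 lam)).
exists (M * K * expR (M * K1) * 2); first by rewrite !mulr_ge0 // expR_ge0.
apply: eventually_imp (eventually_small ltr01) => s h [s0 h0 sh h1 _] t x [tT /andP[x_0 x_1]].
have tT' : `|t| <= T by rewrite ler_norml.
apply: (kernel_integral_le (k := fun y => th t * k y)).
  by move=> y; apply: cvgM; [exact: cvg_cst|exact: ck].
move=> u u1.
have u1' : `|u| <= 1 by rewrite ler_norml.
have uh : `|u * h| <= h by rewrite normrM (gtr0_norm h0) ler_piMl // ltW.
have y2 : `|x + u * h| <= 2.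
  by rewrite (le_trans (ler_normD _ _)) // (ger0_norm x_0); lra.
have x2 : `|x| <= 2 by rewrite ger0_norm //; lra.
apply: ler_pM; rewrite ?divr_ge0 ?expR_ge0 //.
  by rewrite normrM ler_pM // ?hM ?hK.
rewrite /rho !phiE -expRN -expRD ler_expR.
rewrite (_ : - _ - - _ = - (s * th t) * (g0 (x + u * h) - g0 x)); last by ring.
rewrite (le_trans (ler_norm _)) // normrM normrN normrM (gtr0_norm s0).
have G := mean_value_norm (is_derive_gauss x0 lam) hK1 y2 x2.
rewrite (@le_trans _ _ (s * M * (K1 * h))) //.
  apply: ler_pM => //; rewrite ?mulr_ge0 ?(ltW s0) //.
    by rewrite ler_wpM2l ?(ltW s0) // hM.
  rewrite (le_trans G) // ler_wpM2l // addrAC subrr add0r //.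
rewrite (_ : s * M * (K1 * h) = s * h * (M * K1)); last by ring.
by rewrite ler_piMl // mulr_ge0.
Qed.

Lemma A3_A4_eventually_bounded : exists2 C, 0 <= C &
  eventually_sh (fun s h => forall t x, box T t x ->
    `|A3 w lam s h t x| <= C /\ `|A4 w lam s h t x| <= C).
Proof.
have cg := is_derive_continuous (is_derive_gauss x0 lam).
have c3 : continuous (fun y => g0 y * (2 * (y - x0)) ^+ 2).
  apply: derivable_continuous => y; have D := is_derive_gauss x0 lam y.
  exact: ex_derive.
have c4 : continuous (fun y => g0 y * 2).
  by move=> y; apply: cvgM; [exact: cg|exact: cvg_cst].
have [C3 C30 H3] := kernel_eventually_bounded c3.
have [C4 C40 H4] := kernel_eventually_bounded c4.
exists (C3 + C4); first exact: addr_ge0.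
apply: eventually_imp2 H3 H4 => s h K3 K4 t x tx; split.
- apply: (@le_trans _ _ C3); last by rewrite lerDl.
  have -> : A3 w lam s h t x = \int[mu]_(u in `[- 1, 1]) ((1 - `|u|) *
      (th t * (g0 (x + u * h) * (2 * (x + u * h - x0)) ^+ 2))
        * (rho w lam s t (x + u * h) / rho w lam s t x)).
    by apply: eq_Rintegral => u _; rewrite phiE dx_wE mulrA.
  exact: K3.
- apply: (@le_trans _ _ C4); last by rewrite lerDr.
  have -> : A4 w lam s h t x = \int[mu]_(u in `[- 1, 1]) ((1 - `|u|) *
      (th t * (g0 (x + u * h) * 2))
        * (rho w lam s t (x + u * h) / rho w lam s t x)).
    by apply: eq_Rintegral => u _; rewrite phiE dxx_wE mulrA.
  exact: K4.
Qed.

Let mcont (f : R -> R) : continuous f -> measurable_fun setT f.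
Proof. exact: continuous_measurable_fun. Qed.

(** Measurability in t is that of a Tonelli marginal; the sign of k makes the integrand
    nonnegative. *)
Lemma measurable_kernel_integral (k : R -> R) s h x : continuous k ->
  (forall y, 0 <= k y) ->
  measurable_fun setT (fun t => \int[mu]_(u in `[- 1, 1])
    ((1 - `|u|) * (th t * k (x + u * h))
        * (rho w lam s t (x + u * h) / rho w lam s t x))).
Proof.
move=> ck k0.
pose F (z : R * R) := if (- 1 <= z.2) && (z.2 <= 1) then
   (1 - `|z.2|) * (th z.1 * k (x + z.2 * h)) *
     expR (- (s * (th z.1 * g0 (x + z.2 * h))) + s * (th z.1 * g0 x))
  else 0.
suff mm : measurable_fun setT (fine \o fubini_F mu (EFin \o F)).
  apply: eq_measurable_fun mm => t _ /=.
  rewrite /fubini_F /Rintegral [in RHS]integral_mkcond; congr fine.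
  apply: eq_integral => u _; rewrite /= /F patchE mem_setE in_itv /=.
  by case: ifP => // _; rewrite /rho !phiE -expRN -expRD opprK.
have mF : measurable_fun setT F.
  have mth := mcont (is_derive_continuous (is_derive_theta beta C0 lam)).
  have mg := mcont (is_derive_continuous (is_derive_gauss x0 lam)).
  have m1 : measurable_fun setT (fun z : R * R => th z.1) by apply: measurableT_comp.
  have ma : measurable_fun setT (fun z : R * R => x + z.2 * h).
    by apply: measurable_funD => //; apply: measurable_funM.
  have mk : measurable_fun setT (fun z : R * R => k (x + z.2 * h)).
    by apply: measurableT_comp => //; exact: mcont.
  have mgg : measurable_fun setT (fun z : R * R => g0 (x + z.2 * h)).
    exact: measurableT_comp.
  apply: measurable_fun_ifT => //.
    by apply: measurable_and; apply: measurable_fun_ler.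
  apply: measurable_funM; first apply: measurable_funM.
  - by apply: measurable_funB => //; apply: measurableT_comp.
  - exact: measurable_funM.
  - apply: measurableT_comp; first exact: measurable_expR.
    apply: measurable_funD.
      apply: measurableT_comp => //; apply: measurable_funM => //.
      exact: measurable_funM.
    by apply: measurable_funM => //; exact: measurable_funM.
apply: measurableT_comp => //.
apply: (@measurable_fun_fubini_tonelli_F _ _ _ _ R mu (EFin \o F)) => //.
  exact/measurable_EFinP.
move=> z /=; rewrite lee_fin /F; case: ifP => // /andP[z1 z2].
rewrite !mulr_ge0 ?expR_ge0 ?theta_ge0 ?k0 //.
by rewrite subr_ge0 ler_norml z1.
Qed.

Lemma measurable_A3 s h x : measurable_fun setT (fun t => A3 w lam s h t x).
Proof.
apply: eq_measurable_fun (measurable_kernel_integral s h x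
  (k := fun y => g0 y * (2 * (y - x0)) ^+ 2) _ _) => [t _||y].
- by apply: eq_Rintegral => u _; rewrite phiE dx_wE mulrA.
- apply: derivable_continuous => y; have D := is_derive_gauss x0 lam y.
  exact: ex_derive.
- by rewrite mulr_ge0 ?gauss_ge0 // sqr_ge0.
Qed.

Lemma measurable_A4 s h x : measurable_fun setT (fun t => A4 w lam s h t x).
Proof.
apply: eq_measurable_fun (measurable_kernel_integral s h x
  (k := fun y => g0 y * 2) _ _) => [t _||y].
- by apply: eq_Rintegral => u _; rewrite phiE dxx_wE mulrA.
- have cg := is_derive_continuous (is_derive_gauss x0 lam).
  by move=> y; apply: cvgM; [exact: cg|exact: cvg_cst].
- by rewrite mulr_ge0 ?gauss_ge0.
Qed.

End KernelBounds.

Section Residuals.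
Context {R : realType} (T beta x0 C0 lam : R).
Local Notation w := (psi beta x0 C0).
Local Notation th := (theta beta C0 lam).
Local Notation th1 := (theta1 beta C0 lam).
Local Notation th2 := (theta2 beta C0 lam).
Local Notation g0 := (gauss x0 lam).
Local Notation gr := (gright beta x0 C0 lam).
Local Notation gl := (gleft beta x0 C0 lam).
Local Notation cm := (coef_m beta x0 C0 lam).
Local Notation cp := (coef_p beta x0 C0 lam).
Local Notation cq := (coef_q beta x0 C0 lam).
Local Notation ca := (coef_a beta x0 C0 lam).
Local Notation cb := (coef_b beta x0 C0 lam).

(** [res1], [res2], [res3] are the coefficients of s v left over when [P_h1], [P_h2], [P_h] are
    replaced by [main1], [main2] and their sum. *)
Definition res1 (s h t x : R) : R :=
  (gr h t x + gl h t x) / h - lam ^+ 2 * A3 w lam s h t x - lam * A4 w lam s h t x.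
Definition res2 (s h t x : R) : R :=
  cp t x - lam ^+ 2 * (th t * g0 x * (2 * beta * t) ^+ 2)
  + lam ^+ 2 * A3 w lam s h t x.
Definition res3 (s h t x : R) : R :=
  - (th2 t * g0 x) + (gr h t x + gl h t x) / h + cp t x.

Hypothesis lam0 : 0 < lam.

Lemma residuals_bounded : exists2 C, 0 <= C &
  eventually_sh (fun s h => forall t x, box T t x ->
    [/\ `|res1 s h t x| <= C, `|res2 s h t x| <= C & `|res3 s h t x| <= C]).
Proof.
have [C1 C10 H1] := A3_A4_eventually_bounded T beta x0 C0 lam.
have [M2 H2] := eventually_bound (ucvb_laplace T beta x0 C0 lam).
have [M3 H3] := bounded_coef_p T beta x0 C0 lam.
have Bth := bounded_box_fst T (is_derive_continuous (is_derive_theta beta C0 lam)).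
have Bg := bounded_box_snd T (is_derive_continuous (is_derive_gauss x0 lam)).
have cth2 : continuous th2 := is_derive_continuous (is_derive_theta2 beta C0 lam).
have Bth2 := bounded_box_fst T cth2.
have cpoly : continuous (fun t : R => (2 * beta * t) ^+ 2).
  apply: derivable_continuous => t; exact: ex_derive.
have [M4 H4] := bounded_boxM (bounded_boxM Bth Bg) (bounded_box_fst T cpoly).
have [M5 H5] := bounded_boxM Bth2 Bg.
pose L := lam ^+ 2; have L0 : 0 <= L by rewrite sqr_ge0.
have [n2 n3 n4 n5] := And4 (normr_ge0 M2) (normr_ge0 M3) (normr_ge0 M4) (normr_ge0 M5).
have [m2 m3 m4 m5] := And4 (ler_norm M2) (ler_norm M3) (ler_norm M4) (ler_norm M5).
exists (`|M2| + `|M3| + L * `|M4| + `|M5| + L * C1 + lam * C1).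
  by rewrite !addr_ge0 ?mulr_ge0 ?(ltW lam0).
apply: eventually_imp2 H1 (H2 _ m2) => s h K1 K2 t x tx.
have [k3 k4] := K1 t x tx; have k2 := K2 t x tx.
have k5 := le_trans (H3 t x tx) m3.
have k6 := le_trans (H4 t x tx) m4; have k7 := le_trans (H5 t x tx) m5.
have a3 : `|L * A3 w lam s h t x| <= L * C1 by rewrite normrM (ger0_norm L0) ler_wpM2l.
have a4 : `|lam * A4 w lam s h t x| <= lam * C1.
  by rewrite normrM (gtr0_norm lam0) ler_pM2l.
have a6 : `|L * (th t * g0 x * (2 * beta * t) ^+ 2)| <= L * `|M4|.
  by rewrite normrM (ger0_norm L0) ler_wpM2l.
have Ln : 0 <= L * `|M4| by rewrite mulr_ge0.
have Lc : 0 <= L * C1 by rewrite mulr_ge0.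
have lc : 0 <= lam * C1 by rewrite mulr_ge0 // ltW.
split.
- rewrite /res1 -/L; apply: le_trans (ler_normB _ _) _.
  by apply: le_trans (lerD (le_trans (ler_normB _ _) (lerD k2 a3)) a4) _; lra.
- rewrite /res2 -/L; apply: le_trans (ler_normD _ _) _.
  by apply: le_trans (lerD (le_trans (ler_normB _ _) (lerD k5 a6)) a3) _; lra.
- rewrite /res3; apply: le_trans (ler_normD _ _) _.
  apply: le_trans (lerD (le_trans (ler_normD _ _) (lerD _ k2)) k5) _.
    by rewrite normrN; exact: k7.
  by lra.
Qed.

Variables (N : nat) (s t : R) (V : nat -> R) (W Z : nat -> R).
Hypothesis s0 : 0 < s.
Local Notation h := (mesh R N).
Local Notation X := (node R N).

Let h0 : 0 < h. Proof. by rewrite /mesh invr_gt0. Qed.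

Lemma nodeS j : X j.+1 = X j + h.
Proof. by rewrite /node -natr1 mulrDl mul1r. Qed.

Lemma node_pred j : (0 < j)%N -> X j.-1 = X j - h.
Proof. by case: j => // j _; rewrite nodeS addrK. Qed.

Local Notation mn1 := (main1 h s V Z (fun i => cm s h t (X i)) (fun i => cq s h t (X i))).
Local Notation mn2 := (main2 h s V W (fun i => cp t (X i)) (fun i => ca t (X i))
  (fun i => cb s h t (X i))).

Lemma P_h1_residual j :
  Z j - (1 + A0 w lam s h t (X j)) * lap_h N V j
  + s ^+ 2 * lam ^+ 2 * (phi w lam t (X j) ^+ 2 * dt_w w t (X j) ^+ 2
     - A2 w lam s h t (X j)) * V j
  = mn1 j + s * res1 s h t (X j) * V j.
Proof.
rewrite A0E // mulrBr A2E // phiE dt_wE /main1 /res1 /lap_h /lapl /coef_q /theta1.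
ring.
Qed.

Lemma P_h2_residual j :
  - (s * lam ^+ 2) * (phi w lam t (X j) * `|dt_w w t (X j)| ^+ 2
     - A3 w lam s h t (X j)) * V j
  - 2 * s * lam * (phi w lam t (X j) * dt_w w t (X j) * W j
     - A1 w lam s h t (X j) * d_h N V j)
  = mn2 j + s * res2 s h t (X j) * V j.
Proof.
rewrite /main2 /res2 -A1E // real_normK ?num_real // phiE dt_wE /coef_a /theta1.
rewrite /d_h /cdif; ring.
Qed.

(** The left-hand side is [P_h] with d_tt (rho v) expanded by the Leibniz rule. Division by rho
    leaves ratios of neighbouring values, which are [Eexp]. *)
Lemma P_h_residual j : (0 < j)%N ->
  let r i := rho w lam s t (X i) in let a := s * (th1 t * g0 (X j)) in
  (r j)^-1 * ((a ^+ 2 - s * (th2 t * g0 (X j))) * r j * V j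
     - 2 * (a * r j) * W j + r j * Z j - lap_h N (fun i => r i * V i) j)
  = mn1 j + mn2 j + s * res3 s h t (X j) * V j.
Proof.
move=> j0 r a; have hn : h != 0 by rewrite gt_eqF.
have sn : s != 0 by rewrite gt_eqF.
have rn : r j != 0 by rewrite gt_eqF // expR_gt0.
have rR : r j.+1 = Eexp (s * h) (gr h t (X j)) * r j.
  by rewrite -rho_right // /r nodeS divfK.
have rL : r j.-1 = Eexp (s * h) (gl h t (X j)) * r j.
  by rewrite -rho_left // /r node_pred // divfK.
rewrite /lap_h rR rL /main1 /main2 /res3 /lapl /cdif /coef_m /coef_b /coef_q /coef_a.
rewrite /E1 /E2 /a; field.
by rewrite hn sn rn.
Qed.

End Residuals.

(** * The energy and the pointwise inequality *)

Section EnergyDerivative.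
Context {R : realType} (T : R) (N : nat) (h s : R).
Local Notation ac := (ac_on (- T) T).

Lemma ac_ext (f f' g g' : R -> R) : f =1 f' -> g =1 g' -> ac f g -> ac f' g'.
Proof. by move=> /funext -> /funext ->. Qed.

Lemma ac_sub (f1 g1 f2 g2 : R -> R) : ac f1 g1 -> ac f2 g2 ->
  ac (fun t => f1 t - f2 t) (fun t => g1 t - g2 t).
Proof.
move=> H1 /(ac_scale (-1)) H2.
by apply: ac_ext (ac_add H1 H2) => t; rewrite mulN1r.
Qed.

Variables (v w z m p q a b mt pt qt at' bt : R -> nat -> R).
Hypothesis acv : forall j, (j <= N.+1)%N -> ac (v ^~ j) (w ^~ j).
Hypothesis acw : forall j, (j <= N.+1)%N -> ac (w ^~ j) (z ^~ j).
Hypothesis acm : forall j, ac (m ^~ j) (mt ^~ j).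
Hypothesis acp : forall j, ac (p ^~ j) (pt ^~ j).
Hypothesis acq : forall j, ac (q ^~ j) (qt ^~ j).
Hypothesis aca : forall j, ac (a ^~ j) (at' ^~ j).
Hypothesis acb : forall j, ac (b ^~ j) (bt ^~ j).

Lemma ac_energy : ac
  (fun t => energy N h s (v t) (w t) (m t) (p t) (q t) (a t) (b t))
  (fun t => denergy N h s (v t) (w t) (z t) (m t) (p t) (q t) (a t) (b t)
     (mt t) (pt t) (qt t) (at' t) (bt t)).
Proof.
have node j : (1 <= j < N.+1)%N -> ac
    (fun t => - s * p t j * v t j * w t j - s * a t j * w t j ^+ 2
     + 2 * s * b t j * cdif h (v t) j * w t j - s ^+ 3 * a t j * q t j * v t j ^+ 2)
    (fun t => - s * (pt t j * v t j * w t j + p t j * w t j ^+ 2 + p t j * v t j * z t j)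
     - s * (at' t j * w t j ^+ 2 + 2 * a t j * w t j * z t j)
     + 2 * s * (bt t j * cdif h (v t) j * w t j + b t j * cdif h (w t) j * w t j
                + b t j * cdif h (v t) j * z t j)
     - s ^+ 3 * ((at' t j * q t j + a t j * qt t j) * v t j ^+ 2
                 + 2 * a t j * q t j * v t j * w t j)).
  move=> /andP[j1 jN].
  have vj := acv (leqW jN); have wj := acw (leqW jN).
  have jP : (j.-1 <= N.+1)%N by rewrite (leq_trans (leq_pred _)) // leqW.
  have cv := ac_scale (2 * h)^-1 (ac_sub (acv (jN : (j.+1 <= N.+1)%N)) (acv jP)).
  have pvw := ac_mul (ac_mul (acp j) vj) wj.
  have aww := ac_mul (aca j) (ac_mul wj wj).
  have bvw := ac_mul (ac_mul (acb j) cv) wj.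
  have aqv := ac_mul (ac_mul (aca j) (acq j)) (ac_mul vj vj).
  apply: ac_ext (ac_sub (ac_add (ac_add (ac_scale (- s) pvw) (ac_scale (- s) aww))
    (ac_scale (2 * s) bvw)) (ac_scale (s ^+ 3) aqv)) => t; rewrite /cdif; ring.
have edge j : (0 <= j < N.+1)%N -> ac
    (fun t => avg (fun i => a t i * m t i) j * dif h (v t) j ^+ 2)
    (fun t => avg (fun i => at' t i * m t i + a t i * mt t i) j * dif h (v t) j ^+ 2
       + 2 * avg (fun i => a t i * m t i) j * dif h (v t) j * dif h (w t) j).
  move=> /andP[_ jN].
  have dv := ac_scale h^-1 (ac_sub (acv (jN : (j.+1 <= N.+1)%N)) (acv (ltnW jN))).
  have am := ac_scale 2^-1 (ac_add (ac_mul (aca j) (acm j)) (ac_mul (aca j.+1) (acm j.+1))).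
  apply: ac_ext (ac_mul am (ac_mul dv dv)) => t; rewrite /avg /dif; ring.
exact: ac_sub (ac_sum_nat node) (ac_scale s (ac_sum_nat edge)).
Qed.

End EnergyDerivative.

Section CorrectedComparison.
Context {R : realType} (T : R).
Local Notation mu := (@lebesgue_measure R).
Local Notation D := (time_itv T).

Definition ge0_measurable (f : R -> R) : Prop := measurable_fun D f /\ forall t, 0 <= f t.

(** M + e may be negative and the integral of M infinite, so e is split into its positive and
    negative parts. Their integrals are finite and equal, hence cancel after one part is added to
    each side. *)
Lemma ge0_le_integral_corrected (L M e : R -> R) :
  ge0_measurable L -> ge0_measurable M -> mu.-integrable D (EFin \o e) ->
  \int[mu]_(t in D) e t = 0 ->
  {ae mu, forall t, D t -> L t <= M t + e t} ->
  (\int[mu]_(t in D) (L t)%:E <= \int[mu]_(t in D) (M t)%:E)%E.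
Proof.
move=> [mL L0] [mM M0] ie e0 ae; have mD : measurable D by exact: measurable_itv.
have me : measurable_fun D e by move/integrableP : ie => [/measurable_EFinP].
have mn : measurable_fun D (fun t => `|e t|) by exact: measurableT_comp.
pose en t := (`|e t| - e t) / 2; pose ep t := (`|e t| + e t) / 2.
have en0 t : 0 <= en t by rewrite divr_ge0 // subr_ge0 ler_norm.
have ep0 t : 0 <= ep t.
  by have := ler_norm (- e t); rewrite normrN => ?; rewrite divr_ge0 //; lra.
have inn := integrable_norm ie.
have ien : mu.-integrable D (EFin \o en).
  rewrite (_ : _ \o _ = EFin \o fun t => 2^-1 * (`|e t| - e t)).
    by apply: integrableZlR => //; exact: integrableBR.
  by apply/funext => t; rewrite /en /= mulrC.
have iep : mu.-integrable D (EFin \o ep).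
  rewrite (_ : _ \o _ = EFin \o fun t => 2^-1 * (`|e t| + e t)).
    by apply: integrableZlR => //; exact: integrableDR.
  by apply/funext => t; rewrite /ep /= mulrC.
have E : (\int[mu]_(t in D) (ep t)%:E = \int[mu]_(t in D) (en t)%:E)%E.
  rewrite -[LHS]fineK ?integrable_fin_num // -[RHS]fineK ?integrable_fin_num //.
  congr EFin; apply/eqP; rewrite -subr_eq0 -RintegralB // -e0; apply/eqP.
  by apply: eq_Rintegral => t _; rewrite /ep /en; field.
have men : measurable_fun D en by move/integrableP : ien => [/measurable_EFinP].
have mep : measurable_fun D ep by move/integrableP : iep => [/measurable_EFinP].
have fen : (\int[mu]_(t in D) (en t)%:E)%E \is a fin_num by exact: integrable_fin_num.
rewrite -(leeD2rE _ _ fen) -{2}E.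
rewrite -!ge0_integralD //; try by [move=> t _; rewrite lee_fin|exact/measurable_EFinP].
apply: ae_ge0_le_integral => //.
- by move=> t _; rewrite lee_fin addr_ge0.
- by apply/measurable_EFinP; exact: measurable_funD.
- by move=> t _; rewrite lee_fin addr_ge0.
- by apply/measurable_EFinP; exact: measurable_funD.
- apply: ae_imp ae => t h Dt; rewrite lee_fin.
  by have := h Dt; rewrite /en /ep; lra.
Qed.

End CorrectedComparison.

Section CoefficientTimeDerivatives.
Context {R : realType} (T beta x0 C0 lam s h x : R).
Local Notation th1 := (theta1 beta C0 lam).
Local Notation th2 := (theta2 beta C0 lam).
Local Notation g0 := (gauss x0 lam).
Local Notation gr := (gright beta x0 C0 lam h).
Local Notation gl := (gleft beta x0 C0 lam h).
Local Notation grt := (gright_t beta x0 C0 lam h).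
Local Notation glt := (gleft_t beta x0 C0 lam h).
Hypotheses (s0 : 0 < s) (h0 : 0 < h) (T0 : 0 < T).

Let tau0 : s * h != 0. Proof. by rewrite mulf_neq0 // gt_eqF. Qed.

Let Dgr (t : R) : is_derive t 1 (fun t => gr t x) (grt t x).
Proof.
have D := is_derive_theta beta C0 lam t.
by rewrite /gright /gright_t; apply: is_derive_eq; rewrite /GRing.scale /=; ring.
Qed.

Let Dgl (t : R) : is_derive t 1 (fun t => gl t x) (glt t x).
Proof.
have D := is_derive_theta beta C0 lam t.
by rewrite /gleft /gleft_t; apply: is_derive_eq; rewrite /GRing.scale /=; ring.
Qed.

Let Dgrt (t : R) : derivable (fun t => grt t x) t 1.
Proof.
have D := is_derive_theta1 beta C0 lam t; rewrite /gright_t; exact: ex_derive.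
Qed.

Let Dglt (t : R) : derivable (fun t => glt t x) t 1.
Proof.
have D := is_derive_theta1 beta C0 lam t; rewrite /gleft_t; exact: ex_derive.
Qed.

Section Composite.
Variables (g gt : R -> R).
Hypotheses (Dg : forall t : R, is_derive t 1 g (gt t)) (cgt : continuous gt).

Let comp (F dF : R -> R) : (forall y : R, is_derive y 1 F (dF y)) -> forall t : R,
  is_derive t 1 (fun t => F (g t)) (dF (g t) * gt t).
Proof. by move=> DF t; exact: (@is_derive1_comp _ F g t _ _ (DF _) (Dg t)). Qed.

Lemma is_derive_Eexp_comp (t : R) : is_derive t 1 (fun t => Eexp (s * h) (g t))
  (- (s * h) * Eexp (s * h) (g t) * gt t).
Proof. exact: comp (is_derive_Eexp _) t. Qed.

Lemma is_derive_E1_comp (t : R) : is_derive t 1 (fun t => E1 (s * h) (g t))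
  (Eexp (s * h) (g t) * gt t).
Proof. exact: (comp (fun y => is_derive_E1 y tau0) t). Qed.

Lemma is_derive_E2_comp (t : R) : is_derive t 1 (fun t => E2 (s * h) (g t))
  (E1 (s * h) (g t) * gt t).
Proof. exact: (comp (fun y => is_derive_E2 y tau0) t). Qed.

Lemma continuous_Eexp_comp : continuous (fun t => Eexp (s * h) (g t) * gt t).
Proof.
move=> t; apply: cvgM; last exact: cgt.
exact: is_derive_continuous is_derive_Eexp_comp _.
Qed.

Lemma continuous_E1_comp : continuous (fun t => E1 (s * h) (g t) * gt t).
Proof.
move=> t; apply: cvgM; last exact: cgt.
exact: is_derive_continuous is_derive_E1_comp _.
Qed.

End Composite.

Let cgrt := derivable_continuous Dgrt.
Let cglt := derivable_continuous Dglt.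
Let cE := continuous_Eexp_comp Dgr cgrt.
Let cE' := continuous_Eexp_comp Dgl cglt.
Let cE1 := continuous_E1_comp Dgr cgrt.
Let cE1' := continuous_E1_comp Dgl cglt.

Let TT : - T < T. Proof. by rewrite gtrN. Qed.

Lemma ac_coef_m : ac_on (- T) T (fun t => coef_m beta x0 C0 lam s h t x)
  (fun t => coef_mt beta x0 C0 lam s h t x).
Proof.
apply: ac_derive TT _ _ => t.
  have D1 := is_derive_Eexp_comp Dgr t; have D2 := is_derive_Eexp_comp Dgl t.
  by rewrite /coef_m /coef_mt; apply: is_derive_eq; rewrite /GRing.scale /=; field.
rewrite /coef_mt; apply: cvgM; last exact: cvg_cst.
by apply: cvgM; [exact: cvg_cst|apply: cvgD; [exact: cE|exact: cE']].
Qed.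

Lemma ac_coef_b : ac_on (- T) T (fun t => coef_b beta x0 C0 lam s h t x)
  (fun t => coef_bt beta x0 C0 lam s h t x).
Proof.
apply: ac_derive TT _ _ => t.
  have D1 := is_derive_E1_comp Dgr t; have D2 := is_derive_E1_comp Dgl t.
  by rewrite /coef_b /coef_bt; apply: is_derive_eq; rewrite /GRing.scale /=; field.
rewrite /coef_bt; apply: cvgM; last exact: cvg_cst.
by apply: cvgB; [exact: cE|exact: cE'].
Qed.

Lemma ac_coef_q : ac_on (- T) T (fun t => coef_q beta x0 C0 lam s h t x)
  (fun t => coef_qt beta x0 C0 lam s h t x).
Proof.
apply: ac_derive TT _ _ => t.
  have D1 := is_derive_E2_comp Dgr t; have D2 := is_derive_E2_comp Dgl t.
  have D3 := is_derive_theta1 beta C0 lam t.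
  by rewrite /coef_q /coef_qt; apply: is_derive_eq; rewrite /GRing.scale /=; ring.
rewrite /coef_qt; apply: cvgB; last by apply: cvgD; [exact: cE1|exact: cE1'].
have c1 := is_derive_continuous (is_derive_theta1 beta C0 lam).
have c2 := is_derive_continuous (is_derive_theta2 beta C0 lam).
apply: cvgM; [apply: cvgM; [exact: cvg_cst|]|]; apply: cvgM;
  by [exact: cvg_cst|exact: c1|exact: c2].
Qed.

Lemma ac_coef_a : ac_on (- T) T (fun t => coef_a beta x0 C0 lam t x)
  (fun t => coef_at beta x0 C0 lam t x).
Proof.
apply: ac_derive TT _ _ => t.
  have D3 := is_derive_theta1 beta C0 lam t.
  by rewrite /coef_a /coef_at; apply: is_derive_eq; rewrite /GRing.scale /=; ring.
rewrite /coef_at; apply: cvgM; last exact: cvg_cst.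
exact: is_derive_continuous (is_derive_theta2 beta C0 lam) _.
Qed.

Lemma ac_coef_p : ac_on (- T) T (fun t => coef_p beta x0 C0 lam t x)
  (fun t => coef_pt beta x0 C0 lam t x).
Proof.
apply: ac_derive TT _ _ => t.
  have D1 := is_derive_theta beta C0 lam t; have D2 := is_derive_theta2 beta C0 lam t.
  by rewrite /coef_p /coef_pt; apply: is_derive_eq; rewrite /GRing.scale /=; ring.
have D1 := is_derive_theta1 beta C0 lam t; have D2 := is_derive_theta beta C0 lam t.
apply: derivable_continuous => {D1 D2 t} t; rewrite /coef_pt /theta3.
have D1 := is_derive_theta1 beta C0 lam t; have D2 := is_derive_theta beta C0 lam t.
exact: ex_derive.
Qed.

Lemma is_derive_rho (t : R) : is_derive t 1
  (fun t => rho (psi beta x0 C0) lam s t x)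
  (- (s * (th1 t * g0 x)) * rho (psi beta x0 C0) lam s t x).
Proof.
have D := is_derive_theta beta C0 lam t.
rewrite /rho; under [X in is_derive _ _ X]eq_fun do rewrite phiE.
by apply: is_derive_eq; rewrite phiE /GRing.scale /=; ring.
Qed.

Lemma is_derive_rho_t (t : R) : is_derive t 1
  (fun t => - (s * (th1 t * g0 x)) * rho (psi beta x0 C0) lam s t x)
  (((s * (th1 t * g0 x)) ^+ 2 - s * (th2 t * g0 x)) * rho (psi beta x0 C0) lam s t x).
Proof.
have D := is_derive_rho t; have D1 := is_derive_theta1 beta C0 lam t.
by apply: is_derive_eq; rewrite /GRing.scale /=; ring.
Qed.

Lemma continuous_rho_tt : continuous (fun t : R =>
  ((s * (th1 t * g0 x)) ^+ 2 - s * (th2 t * g0 x)) * rho (psi beta x0 C0) lam s t x).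
Proof.
apply: derivable_continuous => t; have D := is_derive_rho t.
have D1 := is_derive_theta1 beta C0 lam t; have D2 := is_derive_theta2 beta C0 lam t.
exact: ex_derive.
Qed.

End CoefficientTimeDerivatives.

(** * Choice of lambda and of the other constants *)

Section PointwiseCarleman.
Context {R : realType} (T beta x0 C0 : R).
Hypotheses (hT : 0 < T) (hbeta : 0 < beta < 1) (hx0 : x0 < 0).
Hypothesis hpsi : forall t x : R, - T <= t <= T -> 0 <= x <= 1 ->
  1 <= psi beta x0 C0 t x.

Section Limits.
Variables (lam t x : R).
Local Notation th := (theta beta C0 lam).
Local Notation th1 := (theta1 beta C0 lam).
Local Notation th2 := (theta2 beta C0 lam).
Local Notation g0 := (gauss x0 lam).
Local Notation g1 := (gauss1 x0 lam).
Local Notation g2 := (gauss2 x0 lam).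
Local Notation cp := (coef_p beta x0 C0 lam).
Local Notation ph := (th t * g0 x).
Local Notation X := ((2 * beta * t) ^+ 2 - (2 * (x - x0)) ^+ 2).

(** This identity and the next two are the hypotheses of [cell_form_ge] for k = lam^2 phi, y1 =
    psi_t, y2 = psi_x and kap = lam (1 - beta) phi. *)
Lemma lim_time_form : cp t x + th2 t * g0 x + th t * g2 x =
  2 * (lam ^+ 2 * ph) * (- 2 * beta * t) ^+ 2 + 2 * (lam * (1 - beta) * ph).
Proof. by rewrite /coef_p /theta2 /gauss2; ring. Qed.

Lemma lim_space_form : - cp t x + th2 t * g0 x + th t * g2 x =
  2 * (lam ^+ 2 * ph) * (2 * (x - x0)) ^+ 2 + 2 * (lam * (1 - beta) * ph).
Proof. by rewrite /coef_p /theta2 /gauss2; ring. Qed.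

Lemma lim_cross_form : th1 t * g1 x = lam ^+ 2 * ph * (- 2 * beta * t) * (2 * (x - x0)).
Proof. by rewrite /theta1 /gauss1; ring. Qed.

Lemma lim_zero_form : limK beta x0 C0 lam t x - limQB beta x0 C0 lam t x =
  lam ^+ 3 * ph ^+ 3 * (2 * lam * X ^+ 2 - (6 * beta + 2) * X
     + (4 - 4 * beta) * (2 * (x - x0)) ^+ 2).
Proof. by rewrite /limK /limQB /coef_p /theta1 /theta2 /gauss1 /gauss2; ring. Qed.

End Limits.

Lemma phi_ge1 lam t x : 0 < lam -> box T t x ->
  1 <= theta beta C0 lam t * gauss x0 lam x.
Proof.
move=> l0 [tT x01]; rewrite -phiE /phi -expR0 ler_expR.
by rewrite mulr_ge0 ?(ltW l0) // (le_trans ler01) // hpsi.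
Qed.

(* (6 beta + 2)^2 < 64 lam (1 - beta) x0^2 makes the quadratic polynomial in X
   of [lim_zero_form] positive once (x - x0)^2 is replaced by x0^2. *)
Let lam := ((1 - beta) * x0 ^+ 2)^-1.

Let k0 : 0 < (1 - beta) * x0 ^+ 2.
Proof.
have /andP[_ b1] := hbeta.
by rewrite mulr_gt0 ?subr_gt0 // exprn_even_gt0 //= lt_eqF.
Qed.

Let lam0 : 0 < lam. Proof. by rewrite invr_gt0. Qed.

Lemma zero_form_ge t x : box T t x ->
  8 * lam ^+ 3 * ((1 - beta) * x0 ^+ 2) <=
  limK beta x0 C0 lam t x - limQB beta x0 C0 lam t x.
Proof.
move=> bx; rewrite lim_zero_form; have ph := phi_ge1 lam0 bx.
have [_ /andP[x_0 _]] := bx; have /andP[b0 b1] := hbeta.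
set p := theta _ _ _ _ * _ in ph *; set X := _ ^+ 2 - _ ^+ 2.
have kk := k0; set K := (1 - beta) * x0 ^+ 2 in kk *.
have y4 : 4 * x0 ^+ 2 <= (2 * (x - x0)) ^+ 2.
  have h2 : 0 <= x - 2 * x0 by have := hx0; lra.
  have := mulr_ge0 x_0 h2.
  by move=> ?; lra.
have lK : lam * K = 1 by rewrite mulVf // gt_eqF.
have lp := lam0; move: (lam) lK lp => l lK lp.
(* By y4 the last term of the form is at least 16 K: half of it balances the linear term in X here,
   the other half is the claimed bound. Completing the square uses l * K = 1 and beta < 1. *)
have quad : 0 <= 2 * l * X ^+ 2 - (6 * beta + 2) * X + 8 * K.
  have -> : 2 * l * X ^+ 2 - (6 * beta + 2) * X + 8 * K =
     2 * l * ((X - (3 * beta + 1) / 2 * K) ^+ 2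
       + (4 - ((3 * beta + 1) / 2) ^+ 2) * K ^+ 2).
    transitivity (2 * l * X ^+ 2 - (6 * beta + 2) * (l * K) * X + 8 * (l * K) * K).
      by rewrite lK; ring.
    by field.
  rewrite mulr_ge0 ?mulr_ge0 ?(ltW lp) // addr_ge0 ?sqr_ge0 // mulr_ge0 ?sqr_ge0 //.
  by have := mulr_ge0 (ltW b0) (ltW b0); nra.
have e : 8 * K <= 2 * l * X ^+ 2 - (6 * beta + 2) * X
    + (4 - 4 * beta) * (2 * (x - x0)) ^+ 2.
  have := ler_wpM2l (_ : 0 <= 4 - 4 * beta) y4.
  rewrite subr_ge0 ler_piMr ?(ltW b1) // => /(_ isT).
  rewrite /K in quad *; nra.
have p3 : 1 <= p ^+ 3 by rewrite exprn_ege1.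
have l3 : 0 < l ^+ 3 by rewrite exprn_gt0.
rewrite (_ : 8 * l ^+ 3 * K = l ^+ 3 * (1 * (8 * K))); last by ring.
by rewrite -[leRHS]mulrA ler_pM2l // ler_pM // mulr_ge0 // ltW.
Qed.

Lemma dgauss_left_right h x : 0 < h -> x0 <= x ->
  gauss x0 lam (x - h) <= gauss x0 lam (x + h).
Proof.
move=> h0 xx; rewrite ler_expR ler_wpM2l ?(ltW lam0) //.
by have := mulr_ge0 (ltW h0) (_ : 0 <= x - x0); rewrite subr_ge0 => /(_ xx); lra.
Qed.

Lemma E1_homo (tau y y' : R) : 0 < tau -> y <= y' -> E1 tau y <= E1 tau y'.
Proof.
move=> t0 yy; rewrite /E1 /Eexp ler_pM2r ?invr_gt0 // lerD2l lerN2 ler_expR lerN2.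
by rewrite ler_pM2l.
Qed.

(** This is the sign of the left boundary term. The weight increases to the right of x0, so [gleft]
    <= [gright], and [E1] is increasing. *)
Lemma coef_m_b_ge0 s h t x : 0 < s -> 0 < h -> x0 <= x ->
  0 <= coef_m beta x0 C0 lam s h t x * coef_b beta x0 C0 lam s h t x.
Proof.
move=> s0 h0 xx; apply: mulr_ge0.
  by rewrite divr_ge0 // addr_ge0 // expR_ge0.
rewrite divr_ge0 // subr_ge0; apply: E1_homo; first exact: mulr_gt0.
rewrite /gleft /gright -mulrN ler_wpM2l ?expR_ge0 // /dgauss subrK -mulNr.
rewrite ler_pM2r ?invr_gt0 // opprB lerD2r.
exact: dgauss_left_right.
Qed.

Lemma pointwise_carleman : exists c C eta : R,
  [/\ 0 < c, 0 <= C, 0 < eta & forall (N : nat) (s : R), eta^-1 < s ->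
    s * mesh R N < eta -> 0 < s /\
  forall (t : R) (v w z : nat -> R), - T <= t <= T ->
  v 0%N = 0 -> v N.+1 = 0 -> w 0%N = 0 -> w N.+1 = 0 ->
  let h := mesh R N in let X := node R N in
  let m i := coef_m beta x0 C0 lam s h t (X i) in
  let p i := coef_p beta x0 C0 lam t (X i) in
  let q i := coef_q beta x0 C0 lam s h t (X i) in
  let a i := coef_a beta x0 C0 lam t (X i) in
  let b i := coef_b beta x0 C0 lam s h t (X i) in
  2 * c * (s * (\sum_(1 <= j < N.+1) w j ^+ 2)
           + s * (\sum_(0 <= j < N.+1) dif h v j ^+ 2)
           + s ^+ 3 * (\sum_(1 <= j < N.+1) v j ^+ 2))
  + \sum_(1 <= j < N.+1) (main1 h s v z m q j
      + s * res1 beta x0 C0 lam s h t (X j) * v j) ^+ 2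
  + \sum_(1 <= j < N.+1) (main2 h s v w p a b j
      + s * res2 beta x0 C0 lam s h t (X j) * v j) ^+ 2
  <= 4 * (\sum_(1 <= j < N.+1) (main1 h s v z m q j + main2 h s v w p a b j
        + s * res3 beta x0 C0 lam s h t (X j) * v j) ^+ 2)
     + 4 * C * s * (\sum_(0 <= j < N.+1) (h * dif h w j) ^+ 2)
     + 4 * C * (s / h) * dif h v N ^+ 2
     - 4 * denergy N h s v w z m p q a b
        (fun i => coef_mt beta x0 C0 lam s h t (X i))
        (fun i => coef_pt beta x0 C0 lam t (X i))
        (fun i => coef_qt beta x0 C0 lam s h t (X i))
        (fun i => coef_at beta x0 C0 lam t (X i))
        (fun i => coef_bt beta x0 C0 lam s h t (X i))].
Proof.
have [C Cp [bl Hbd Hcl]] := coeffs_eventually_close T beta x0 C0 lam.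
have [Cr Cr0 Hres] := residuals_bounded T beta x0 C0 lam0.
have /andP[b0 b1] := hbeta.
(* The first entry bounds kap from below, as phi >= 1; the second is half the bound of
   [zero_form_ge], because 2 * c <= K - QB is required. *)
pose c := Num.min (lam * (1 - beta)) (4 * lam ^+ 3 * ((1 - beta) * x0 ^+ 2)).
have c0 : 0 < c.
  rewrite lt_min mulr_gt0 ?subr_gt0 //= mulr_gt0 ?k0 // mulr_gt0 // exprn_gt0 //.
have c1 : c <= lam * (1 - beta) by rewrite ge_min lexx.
have c2 : 2 * c <= 8 * lam ^+ 3 * ((1 - beta) * x0 ^+ 2).
  have -> : 8 * lam ^+ 3 * ((1 - beta) * x0 ^+ 2) =
    2 * (4 * lam ^+ 3 * ((1 - beta) * x0 ^+ 2)) by ring.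
  by rewrite ler_pM2l // ge_min lexx orbT.
have C11 : 0 < 3 * C + 11 by rewrite addr_gt0 // mulr_gt0.
pose d := Num.min 1 (c / (3 * C + 11)).
have d0 : 0 < d by rewrite lt_min ltr01 divr_gt0.
have d1 : d <= 1 by rewrite ge_min lexx.
have dc : (3 * C + 11) * d <= c.
  by rewrite mulrC -ler_pdivlMr // ge_min lexx orbT.
(* Used as the delta of [eventually_small]: 1 <= delta * s then gives the condition 4 * Cr ^+ 2 <= c
   * s on the residuals. *)
have r0 : 0 < c / (4 * Cr ^+ 2 + 1).
  by rewrite divr_gt0 // ltr_wpDl // mulr_ge0 // sqr_ge0.
have [eta eta0 H] := eventually_and (eventually_and Hbd (Hcl d d0))
  (eventually_and Hres (eventually_and (eventually_small d0) (eventually_small r0))).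
exists c, C, eta; split=> //; first exact: ltW.
move=> N s es sh; have h0 : 0 < mesh R N by rewrite invr_gt0.
have [[K1 K2] [K3 [[s0 _ sd hd ds] [_ _ _ _ rs]]]] := H s _ es h0 sh.
split=> // t v w z tT v0 vN w0 wN; cbv zeta; set h := mesh R N; set X := node R N.
have bx j : (j <= N.+1)%N -> box T t (X j).
  move=> jN; split=> //; rewrite mulr_ge0 ?(ltW h0) //=.
  by rewrite /X /node /mesh ler_pdivrMr // mul1r ler_nat.
have XN : X N.+1 = X N + h by rewrite /X /node -natr1 mulrDl mul1r.
apply: (pointwise_estimate (Cr := Cr) z h0 s0 c0 (ltW Cp) _ v0 vN w0 wN).
- have d4 : 0 < 4 * Cr ^+ 2 + 1 by rewrite ltr_wpDl // mulr_ge0 // sqr_ge0.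
  move: rs; rewrite mulrAC ler_pdivlMr // mul1r => h1.
  by apply: le_trans h1; rewrite lerDl.
- move=> j jN; have bj := bx j (leqW jN).
  have [l1 l2] := bl t _ bj; have p1 := phi_ge1 lam0 bj.
  have z1 := zero_form_ge bj.
  have k_0 : 0 <= lam ^+ 2 * (theta beta C0 lam t * gauss x0 lam (X j)).
    by rewrite mulr_ge0 ?sqr_ge0 // (le_trans ler01).
  have cl := K2 t j bj.
  apply: (cell_form_ge v w h0 s0 _ ds sd (ltW Cp) l1 l2 k_0
    (lim_time_form lam t (X j)) (lim_space_form lam t (X j)) (lim_cross_form lam t (X j))
    _ _ dc cl).
  + by rewrite (ltW d0).
  + by apply: le_trans c1 _; rewrite ler_peMr // mulr_ge0 ?(ltW lam0) // subr_ge0 ltW.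
  + exact: le_trans c2 z1.
- apply: coef_m_b_ge0 => //; rewrite /X /node mul0r; exact: ltW.
- by rewrite XN; apply: K1; apply: bx.
- move=> j /andP[j0 jN]; exact: K3 (bx j (leqW jN)).
Qed.

End PointwiseCarleman.

(** * Integration in time *)

Lemma finite_L2_integrable {R : realType} d (X : measurableType d)
    (m : {measure set X -> \bar R}) (D : set X) (f : X -> R) :
  measurable D -> measurable_fun D f -> m.-integrable D (EFin \o (fun=> 1)) ->
  (\int[m]_(x in D) (`|f x| ^+ 2)%:E < +oo)%E -> m.-integrable D (EFin \o f).
Proof.
move=> mD mf i1 sf.
have i2 : m.-integrable D (EFin \o (fun t => `|f t| ^+ 2)).
  apply/integrableP; split.
    by apply/measurable_EFinP; apply: measurable_funX; exact: measurableT_comp.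
  by under eq_integral do rewrite /= ger0_norm ?exprn_ge0//.
apply: le_integrable (integrableDR mD i1 i2) => //; first exact/measurable_EFinP.
move=> t _; rewrite /= lee_fin [X in _ <= X]ger0_norm ?addr_ge0 ?exprn_ge0//.
by have := sqr_ge0 (`|f t| - 2^-1); rewrite sqrrB => ?; have := normr_ge0 (f t); lra.
Qed.

Section TraceData.
Context {R : realType} (T : R).
Local Notation mu := (@lebesgue_measure R).
Local Notation D := (time_itv T).
Implicit Types f g : R -> R.

Lemma measurable_sum_nat m n (f : nat -> R -> R) :
  (forall i, (m <= i < n)%N -> measurable_fun D (f i)) ->
  measurable_fun D (fun t => \sum_(m <= i < n) f i t).
Proof.
move=> H; have -> : (fun t => \sum_(m <= i < n) f i t) =
    fun t => \sum_(m <= i < n) (if (m <= i < n)%N then f i t else 0).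
  by apply/funext => t; apply: eq_big_nat => i ->.
apply: measurable_sum => i; case: (boolP (m <= i < n)%N) => hi; first exact: H.
exact: measurable_cst.
Qed.

Lemma ac_measurable f g : 0 < T -> ac_on (- T) T f g -> measurable_fun D f.
Proof.
move=> T0 acf; have TT : - T <= T by rewrite ltW // gtrN.
apply: measurable_funS (_ : measurable_fun `[- T, T] f).
- exact: measurable_itv.
- by rewrite /time_itv; exact: subset_itv_oo_cc.
- by apply: subspace_continuous_measurable_fun => //; exact: ac_continuous TT acf.
Qed.

Lemma ac_integrable_fun f g : 0 < T -> ac_on (- T) T f g -> mu.-integrable D (EFin \o f).
Proof.
move=> T0 acf; have TT : - T <= T by rewrite ltW // gtrN.
apply: integrableS (_ : mu.-integrable `[- T, T] (EFin \o f)) => //.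
- exact: measurable_itv.
- by rewrite /time_itv; exact: subset_itv_oo_cc.
- apply: continuous_compact_integrable; first exact: segment_compact.
  exact: ac_continuous TT acf.
Qed.

Lemma integrable1_time_itv : mu.-integrable D (EFin \o (fun=> 1)).
Proof.
apply: integrableS (_ : mu.-integrable `[- T, T] (EFin \o (fun=> 1))) => //.
- exact: measurable_itv.
- by rewrite /time_itv; exact: subset_itv_oo_cc.
- apply: continuous_compact_integrable; first exact: segment_compact.
  by apply: continuous_subspaceT => x; exact: cvg_cst.
Qed.

Lemma square_integrable_integrable f : square_integrable T f ->
  mu.-integrable D (EFin \o f).
Proof.
move=> [mf sf].
apply: (@finite_L2_integrable R _ _ mu D f _ mf integrable1_time_itv sf).
exact: measurable_itv.
Qed.

Lemma weak_derivative_ae_r f g1 g2 : is_weak_derivative T f g1 ->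
  locally_integrable D g2 ->
  {ae mu, forall t, D t -> g1 t = g2 t} -> is_weak_derivative T f g2.
Proof.
move=> [lf [m1 o1 l1] fg] l2 ae; split => // chi tc; rewrite fg //; congr (- _).
have [m2 _ _] := l2; have [dc cc _] := tc.
have mc : measurable_fun D chi.
  apply: measurable_funTS; apply: continuous_measurable_fun.
  exact: derivable_continuous.
apply: Rintegral_ae; [exact: measurable_funM|exact: measurable_funM|].
by apply: ae_imp ae => t h Dt; rewrite h.
Qed.

Lemma weak_derivative_zero f g : is_weak_derivative T f g ->
  (forall t, D t -> f t = 0) -> {ae mu, forall t, D t -> g t = 0}.
Proof.
move=> fg f0; have [lf lg _] := fg.
have fz : is_weak_derivative T f (fun=> 0).
  split => //.
    by apply: open_integrable_locally; [exact: interval_open|exact: integrable0].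
  move=> chi _; rewrite (@eq_Rintegral _ _ _ mu D (fun=> 0)); last first.
    by move=> t /set_mem Dt; rewrite f0 // mul0r.
  rewrite [X in _ = - X](@eq_Rintegral _ _ _ mu D (fun=> 0)); last first.
    by move=> t _; rewrite mul0r.
  by rewrite Rintegral_cst ?mul0r ?oppr0 //; exact: measurable_itv.
exact: weak_derivative_unique fg fz.
Qed.

(** The second weak derivative is square integrable, hence integrable, so the first derivative and
    then f itself are primitives vanishing at both ends. *)
Lemma trace_data f : 0 < T ->
  weakly_differentiable T f -> weakly_differentiable T (weak_derive T f) ->
  square_integrable T (weak_derive T (weak_derive T f)) ->
  zero_trace T f -> zero_trace T (weak_derive T f) ->
  exists FG : (R -> R) * (R -> R),
  [/\ ac_on (- T) T FG.1 FG.2,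
      ac_on (- T) T FG.2 (weak_derive T (weak_derive T f)),
      [/\ FG.1 (- T) = 0, FG.1 T = 0, FG.2 (- T) = 0 & FG.2 T = 0],
      {ae mu, forall t, D t -> f t = FG.1 t} &
      {ae mu, forall t, D t -> weak_derive T f t = FG.2 t}].
Proof.
move=> T0 [g1 /weak_deriveP fw] [g2 /weak_deriveP wz] sz tf tw.
have iz := square_integrable_integrable sz.
have [G [acG G0 G1 aeG]] := trace_primitive T0 wz iz tw.
have iG := ac_integrable_fun T0 acG.
have lG : locally_integrable D G by apply: open_integrable_locally => //; exact: interval_open.
(* A weak derivative is only locally integrable by definition. Replacing it by the continuous G
   gives integrability up to the ends, so [trace_primitive] applies again. *)
have fG := weak_derivative_ae_r fw lG aeG.
have [F [acF F0 F1 aeF]] := trace_primitive T0 fG iG tf.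
by exists (F, G).
Qed.

Lemma ge0_measurable_add f g : ge0_measurable T f -> ge0_measurable T g ->
  ge0_measurable T (fun t => f t + g t).
Proof.
move=> [mf f0] [mg g0]; split; first exact: measurable_funD.
by move=> t; rewrite addr_ge0.
Qed.

Lemma ge0_measurable_scale c f : 0 <= c -> ge0_measurable T f ->
  ge0_measurable T (fun t => c * f t).
Proof.
move=> c0 [mf f0]; split; last by move=> t; rewrite mulr_ge0.
by apply: measurable_funM => //; exact: measurable_cst.
Qed.

Lemma ge0_measurable_sqr f : measurable_fun D f -> ge0_measurable T (fun t => `|f t| ^+ 2).
Proof.
move=> mf; split; last by move=> t; rewrite exprn_ge0.
by apply: measurable_funX; exact: measurableT_comp.
Qed.

Lemma ge0_measurable_sum_sqr m n c (f : R -> nat -> R) : 0 <= c ->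
  (forall i, (m <= i < n)%N -> measurable_fun D (f ^~ i)) ->
  ge0_measurable T (fun t => c * \sum_(m <= i < n) `|f t i| ^+ 2).
Proof.
move=> c0 mf; apply: ge0_measurable_scale => //; split.
  by apply: measurable_sum_nat => i /mf/ge0_measurable_sqr[].
by move=> t; apply: sumr_ge0 => i _; rewrite exprn_ge0.
Qed.

Lemma time_int_add f g : ge0_measurable T f -> ge0_measurable T g ->
  (time_int T f + time_int T g)%E = time_int T (fun t => f t + g t).
Proof.
move=> [mf f0] [mg g0]; rewrite /time_int -ge0_integralD //.
- exact: measurable_itv.
- by move=> t _; rewrite lee_fin.
- exact/measurable_EFinP.
- by move=> t _; rewrite lee_fin.
- exact/measurable_EFinP.
Qed.

Lemma time_int_scale c f : 0 <= c -> ge0_measurable T f ->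
  (c%:E * time_int T f)%E = time_int T (fun t => c * f t).
Proof.
move=> c0 [mf f0]; rewrite /time_int -ge0_integralZl_EFin //.
- exact: measurable_itv.
- by move=> t _; rewrite lee_fin.
- exact/measurable_EFinP.
Qed.

Lemma energy_zero N h s (v w m p q a b : nat -> R) :
  (forall j, (j <= N.+1)%N -> v j = 0) -> (forall j, (j <= N.+1)%N -> w j = 0) ->
  energy N h s v w m p q a b = 0.
Proof.
move=> v0 w0; rewrite /energy.
rewrite [X in X - _]big_nat_cond [X in X - _]big1 => [|j /andP[/andP[_ jN] _]].
  rewrite [X in s * X]big_nat_cond [X in s * X]big1 ?mulr0 ?subr0 //.
  move=> j /andP[/andP[_ jN] _].
  by rewrite /dif (v0 j.+1) // (v0 j (ltnW jN)) subrr mul0r expr0n mulr0.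
by rewrite (v0 _ (ltnW jN)) (w0 _ (ltnW jN)) expr0n !mulr0 !subr0 addr0.
Qed.

End TraceData.

Section WeakDiscreteFunctions.
Context {R : realType} (T beta x0 C0 lam s : R) (N : nat) (v : R -> nat -> R).
Local Notation mu := (@lebesgue_measure R).
Local Notation D := (time_itv T).
Local Notation h := (mesh R N).
Local Notation X := (node R N).
Local Notation wt := (psi beta x0 C0).
Local Notation w := (dt T v).
Local Notation z := (dt T (dt T v)).
Local Notation cm := (fun t i => coef_m beta x0 C0 lam s h t (X i)).
Local Notation cp := (fun t i => coef_p beta x0 C0 lam t (X i)).
Local Notation cq := (fun t i => coef_q beta x0 C0 lam s h t (X i)).
Local Notation ca := (fun t i => coef_a beta x0 C0 lam t (X i)).
Local Notation cb := (fun t i => coef_b beta x0 C0 lam s h t (X i)).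
Local Notation mn1 t := (main1 h s (v t) (z t) (cm t) (cq t)).
Local Notation mn2 t := (main2 h s (v t) (w t) (cp t) (ca t) (cb t)).
Hypotheses (T0 : 0 < T) (lam0 : 0 < lam) (s0 : 0 < s).
Hypothesis Hv : forall j : nat, (j <= N.+1)%N ->
  [/\ weakly_differentiable T (fun t => v t j),
      weakly_differentiable T (fun t => dt T v t j) &
      square_integrable T (fun t => dt T (dt T v) t j)].
Hypothesis Hends : forall t : R, - T < t < T -> v t 0%N = 0 /\ v t N.+1 = 0.
Hypothesis Htr : forall j : nat, (j <= N.+1)%N ->
  zero_trace T (fun t => v t j) /\ zero_trace T (fun t => dt T v t j).

Let h0 : 0 < h. Proof. by rewrite /mesh invr_gt0. Qed.

Lemma ae_forall_le n (P : nat -> R -> Prop) :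
  (forall j, (j <= n)%N -> {ae mu, forall t, P j t}) ->
  {ae mu, forall t, forall j, (j <= n)%N -> P j t}.
Proof.
move=> H; apply: ae_foralln => j; case: (leqP j n) => jn.
  by apply: ae_imp (H j jn) => t.
by apply: aeW.
Qed.

Lemma weak_derivative_v j : (j <= N.+1)%N -> is_weak_derivative T (v ^~ j) (w ^~ j).
Proof. by move=> jN; have [[g /weak_deriveP]] := Hv jN. Qed.

Lemma weak_derivative_w j : (j <= N.+1)%N -> is_weak_derivative T (w ^~ j) (z ^~ j).
Proof. by move=> jN; have [_ [g /weak_deriveP]] := Hv jN. Qed.

(** At the end nodes v vanishes for every t in the interval, but its weak derivative is determined
    only almost everywhere. *)
Lemma ends_ae : {ae mu, forall t, D t -> w t 0%N = 0 /\ w t N.+1 = 0}.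
Proof.
have H j : (j <= N.+1)%N -> (forall t, D t -> v t j = 0) ->
    {ae mu, forall t, D t -> w t j = 0}.
  by move=> jN; exact: weak_derivative_zero (weak_derivative_v jN).
have Dv t : D t -> v t 0%N = 0 /\ v t N.+1 = 0.
  by rewrite /time_itv /= in_itv /=; exact: Hends.
apply: ae_imp2 (H 0%N (leq0n _) (fun t Dt => (Dv t Dt).1))
  (H N.+1 (leqnn _) (fun t Dt => (Dv t Dt).2)) => t H1 H2 Dt.
by split; [exact: H1|exact: H2].
Qed.

Lemma regular_representative : exists V W : R -> nat -> R,
  [/\ forall j, (j <= N.+1)%N -> ac_on (- T) T (V ^~ j) (W ^~ j),
      forall j, (j <= N.+1)%N -> ac_on (- T) T (W ^~ j) (z ^~ j),
      forall j, (j <= N.+1)%N -> [/\ V (- T) j = 0, V T j = 0, W (- T) j = 0 & W T j = 0] &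
      {ae mu, forall t, D t -> v t = V t /\ w t = W t}].
Proof.
have H j : exists FG : (R -> R) * (R -> R), (j <= N.+1)%N ->
  [/\ ac_on (- T) T FG.1 FG.2, ac_on (- T) T FG.2 (z ^~ j),
      [/\ FG.1 (- T) = 0, FG.1 T = 0, FG.2 (- T) = 0 & FG.2 T = 0],
      {ae mu, forall t, D t -> v t j = FG.1 t} &
      {ae mu, forall t, D t -> w t j = FG.2 t}].
  case: (leqP j N.+1) => jN; last by exists (fun=> 0, fun=> 0).
  have [a1 a2 a3] := Hv jN; have [b1 b2] := Htr jN.
  by have [FG HF] := trace_data T0 a1 a2 a3 b1 b2; exists FG.
have [F HF] := choice H.
(* Beyond index N+1 the original values are kept, so that v t = V t holds between whole sequences
   and can be rewritten. *)
pose V t j := if (j <= N.+1)%N then (F j).1 t else v t j.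
pose W t j := if (j <= N.+1)%N then (F j).2 t else w t j.
have VE j : (j <= N.+1)%N -> V ^~ j = (F j).1.
  by move=> jN; apply/funext => t; rewrite /V jN.
have WE j : (j <= N.+1)%N -> W ^~ j = (F j).2.
  by move=> jN; apply/funext => t; rewrite /W jN.
exists V, W; split.
- by move=> j jN; rewrite (VE _ jN) (WE _ jN); have [] := HF j jN.
- by move=> j jN; rewrite (WE _ jN); have [] := HF j jN.
- by move=> j jN; rewrite /V /W jN; have [_ _ []] := HF j jN.
- have A1 : {ae mu, forall t, forall j, (j <= N.+1)%N -> D t -> v t j = (F j).1 t}.
    by apply: ae_forall_le => j jN; have [] := HF j jN.
  have A2 : {ae mu, forall t, forall j, (j <= N.+1)%N -> D t -> w t j = (F j).2 t}.
    by apply: ae_forall_le => j jN; have [] := HF j jN.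
  apply: ae_imp2 A1 A2 => t H1 H2 Dt.
  split; apply/funext => j; rewrite /V /W.
    by case: ifP => // jN; exact: H1.
  by case: ifP => // jN; exact: H2.
Qed.

(** The energy of the regular representative is absolutely continuous and zero at both end times;
    its derivative agrees almost everywhere with [denergy] of the given data. *)
Lemma energy_flux : exists e : R -> R,
  [/\ mu.-integrable D (EFin \o e), \int[mu]_(t in D) e t = 0 &
    {ae mu, forall t, D t -> e t =
      denergy N h s (v t) (w t) (z t) (cm t) (cp t) (cq t) (ca t) (cb t)
        (fun i => coef_mt beta x0 C0 lam s h t (X i))
        (fun i => coef_pt beta x0 C0 lam t (X i))
        (fun i => coef_qt beta x0 C0 lam s h t (X i))
        (fun i => coef_at beta x0 C0 lam t (X i))
        (fun i => coef_bt beta x0 C0 lam s h t (X i))}].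
Proof.
have [V [W [acV acW tr ae]]] := regular_representative.
have TT : - T <= T by rewrite ltW // gtrN.
have acE := ac_energy h s acV acW (fun j => ac_coef_m beta x0 C0 lam s h (X j) T0)
  (fun j => ac_coef_p beta x0 C0 lam (X j) T0)
  (fun j => ac_coef_q beta x0 C0 lam (X j) s0 h0 T0)
  (fun j => ac_coef_a beta x0 C0 lam (X j) T0)
  (fun j => ac_coef_b beta x0 C0 lam (X j) s0 h0 T0).
have [ie _] := acE.
set e := (fun t : R => denergy _ _ _ _ _ _ _ _ _ _ _ _ _ _ _ _) in acE ie.
have ieD : mu.-integrable D (EFin \o e).
  apply: integrableS ie => //; first exact: measurable_itv.
  by rewrite /time_itv; exact: subset_itv_oo_cc.
exists e; split => //.
- rewrite (Rintegral_time_itv (ltW T0) ieD); apply: (ac_trace0 TT acE).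
    by apply: energy_zero => j jN; have [] := tr j jN.
  by apply: energy_zero => j jN; have [] := tr j jN.
- by apply: ae_imp ae => t H Dt; have [-> ->] := H Dt.
Qed.

Lemma P_h1E t j : P_h1 wt lam s T N v t j =
  mn1 t j + s * res1 beta x0 C0 lam s h t (X j) * v t j.
Proof. exact: P_h1_residual. Qed.

Lemma P_h2E t j : P_h2 wt lam s T N v t j =
  mn2 t j + s * res2 beta x0 C0 lam s h t (X j) * v t j.
Proof. exact: P_h2_residual. Qed.

Lemma measurable_v j : (j <= N.+1)%N -> measurable_fun D (v ^~ j).
Proof. by move=> /weak_derivative_v[[]]. Qed.

Lemma measurable_w j : (j <= N.+1)%N -> measurable_fun D (w ^~ j).
Proof. by move=> /weak_derivative_v[_ []]. Qed.

Lemma measurable_z j : (j <= N.+1)%N -> measurable_fun D (z ^~ j).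
Proof. by move=> /weak_derivative_w[_ []]. Qed.

Let mcont (f : R -> R) : continuous f -> measurable_fun D f.
Proof. by move=> cf; apply: measurable_funTS; exact: continuous_measurable_fun. Qed.

Let mcst (c : R) : measurable_fun D (fun=> c).
Proof. exact: measurable_cst. Qed.

Let mscale (c : R) f : measurable_fun D f -> measurable_fun D (fun t => c * f t).
Proof. exact: measurable_funM. Qed.

(** [P_h] involves the chosen weak derivatives of rho v, so the Leibniz rule, and with it the
    decomposition, holds almost everywhere only. *)
Lemma P_h_weak j : (0 < j)%N -> (j <= N)%N ->
  measurable_fun D (fun t => P_h wt lam s T N v t j) /\
  {ae mu, forall t, D t -> P_h wt lam s T N v t j =
    mn1 t j + mn2 t j + s * res3 beta x0 C0 lam s h t (X j) * v t j}.
Proof.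
move=> j0 jN; have jN1 := leqW jN.
have [m2 ae2] := weak_derive2_mul (@is_derive_rho R beta x0 C0 lam s (X j))
  (@is_derive_rho_t R beta x0 C0 lam s (X j)) (@continuous_rho_tt R beta x0 C0 lam s (X j))
  (weak_derivative_v jN1) (weak_derivative_w jN1).
have crho i : continuous (fun t : R => rho wt lam s t (X i)).
  exact: is_derive_continuous (@is_derive_rho R beta x0 C0 lam s (X i)).
have mrv i : (i <= N.+1)%N -> measurable_fun D (fun t => rho wt lam s t (X i) * v t i).
  move=> iN; apply: measurable_funM; last exact: measurable_v.
  exact: mcont (crho i).
split.
  rewrite /P_h /lap_h; apply: measurable_funM.
    apply: mcont => t; apply: cvgV; last exact: crho.
    by rewrite gt_eqF // expR_gt0.
  apply: measurable_funB; first exact: m2.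
  apply: measurable_funM; last exact: mcst.
  apply: measurable_funD; last first.
    by apply: mrv; rewrite (leq_trans (leq_pred _)).
  apply: measurable_funB; first exact: mrv.
  by apply: mscale; exact: mrv.
apply: ae_imp ae2 => t H Dt.
rewrite -(P_h_residual beta x0 C0 lam N t (v t) (w t) (z t) s0 j0) /P_h; congr (_ * (_ - _)).
by rewrite [LHS]H //; ring.
Qed.

Lemma P_h_ae : {ae mu, forall t, D t -> forall j, (1 <= j < N.+1)%N ->
  P_h wt lam s T N v t j =
    mn1 t j + mn2 t j + s * res3 beta x0 C0 lam s h t (X j) * v t j}.
Proof.
apply: (@ae_imp _ (fun t => forall j, (j <= N)%N -> (0 < j)%N -> D t ->
    P_h wt lam s T N v t j =
    mn1 t j + mn2 t j + s * res3 beta x0 C0 lam s h t (X j) * v t j)).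
  by move=> t H Dt j /andP[j0 jN]; exact: H.
apply: ae_forall_le => -[|j] jN; first exact: aeW.
by have [_] := P_h_weak (ltn0Sn j) jN; apply: ae_imp => t H _.
Qed.

Lemma measurable_gright x : measurable_fun D (fun t => gright beta x0 C0 lam h t x).
Proof.
apply: mcont => t; rewrite /gright; apply: cvgM; last exact: cvg_cst.
exact: is_derive_continuous (is_derive_theta beta C0 lam) _.
Qed.

Lemma measurable_gleft x : measurable_fun D (fun t => gleft beta x0 C0 lam h t x).
Proof.
apply: mcont => t; rewrite /gleft; apply: cvgN; apply: cvgM; last exact: cvg_cst.
exact: is_derive_continuous (is_derive_theta beta C0 lam) _.
Qed.

Lemma measurable_P_h1 j : (j <= N)%N ->
  measurable_fun D (fun t => P_h1 wt lam s T N v t j).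
Proof.
move=> jN; have jN1 := leqW jN; have jP := leq_trans (leq_pred j) jN1.
have mv := measurable_v jN1.
rewrite (_ : (fun t => _) = fun t => mn1 t j + s * res1 beta x0 C0 lam s h t (X j) * v t j);
  last by apply/funext => t; exact: P_h1E.
apply: measurable_funD.
- rewrite /main1 /lapl; apply: measurable_funD.
    apply: measurable_funB; first exact: measurable_z.
    apply: measurable_funM; first exact: ac_measurable T0 (ac_coef_m _ _ _ _ _ _ _ T0).
    apply: measurable_funM; last exact: mcst.
    apply: measurable_funD; last exact: measurable_v.
    apply: measurable_funB; first exact: measurable_v.
    exact: mscale.
  apply: measurable_funM => //; apply: mscale.
  exact: ac_measurable T0 (ac_coef_q _ _ _ _ _ s0 h0 T0).
- apply: measurable_funM => //; apply: mscale.
  rewrite /res1; apply: measurable_funB; last first.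
    apply: mscale.
    by apply: measurable_funTS; exact: measurable_A4.
  apply: measurable_funB; last first.
    apply: mscale.
    by apply: measurable_funTS; exact: measurable_A3.
  apply: measurable_funM; last exact: mcst.
  by apply: measurable_funD; [exact: measurable_gright|exact: measurable_gleft].
Qed.

Lemma measurable_P_h2 j : (j <= N)%N ->
  measurable_fun D (fun t => P_h2 wt lam s T N v t j).
Proof.
move=> jN; have jN1 := leqW jN; have jP := leq_trans (leq_pred j) jN1.
have mv := measurable_v jN1.
have mcp := ac_measurable T0 (ac_coef_p beta x0 C0 lam (X j) T0).
rewrite (_ : (fun t => _) = fun t => mn2 t j + s * res2 beta x0 C0 lam s h t (X j) * v t j);
  last by apply/funext => t; exact: P_h2E.
apply: measurable_funD.
- rewrite /main2 /cdif; apply: measurable_funB.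
    by apply: measurable_funM => //; apply: measurable_funM => //; exact: mcst.
  apply: mscale.
  apply: measurable_funB.
    apply: measurable_funM; last exact: measurable_w.
    exact: ac_measurable T0 (ac_coef_a _ _ _ _ _ T0).
  apply: measurable_funM; first exact: ac_measurable T0 (ac_coef_b _ _ _ _ _ s0 h0 T0).
  apply: measurable_funM; last exact: mcst.
  by apply: measurable_funB; exact: measurable_v.
- apply: measurable_funM => //; apply: mscale.
  rewrite /res2; apply: measurable_funD; last first.
    apply: mscale.
    by apply: measurable_funTS; exact: measurable_A3.
  apply: measurable_funB => //.
  apply: mscale.
  apply: mcont => t; apply: cvgM.
    apply: cvgM; last exact: cvg_cst.
    exact: is_derive_continuous (is_derive_theta beta C0 lam) _.
  by rewrite /GRing.exp /=; apply: cvgM; apply: cvgM; by [exact: cvg_cst|exact: cvg_id].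
Qed.

End WeakDiscreteFunctions.

(** Multiplication by h turns sums into discrete integrals and the boundary weight s / h into s;
    division by k gives every term on the left the coefficient 1. *)
Lemma absorb_constants {R : realFieldType} (k c C s h A P Q E d e : R) :
  0 < k -> k <= 2 * c -> k <= 1 -> 0 < h -> 0 < s -> 0 <= C ->
  0 <= A -> 0 <= P -> 0 <= Q -> 0 <= E ->
  2 * c * A + P <= 4 * Q + 4 * C * s * E + 4 * C * (s / h) * d ^+ 2 - 4 * e ->
  h * (A + P) <= 4 * (1 + C) / k * (h * Q + s * d ^+ 2 + s * (h * E))
    - 4 / k * h * e.
Proof.
move=> k0 kc k1 h0 s0 C0 A0 P0 Q0 E0 H.
rewrite -(ler_pM2l k0).
have -> : k * (4 * (1 + C) / k * (h * Q + s * d ^+ 2 + s * (h * E)) - 4 / k * h * e)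
  = 4 * (1 + C) * (h * Q + s * d ^+ 2 + s * (h * E)) - 4 * h * e.
  by field; rewrite gt_eqF.
have H1 : h * (2 * c * A + P) <= h * (4 * Q + 4 * C * s * E + 4 * C * (s / h) * d ^+ 2 - 4 * e).
  by rewrite ler_pM2l.
have e1 : h * (4 * Q + 4 * C * s * E + 4 * C * (s / h) * d ^+ 2 - 4 * e) =
  4 * (h * Q) + 4 * C * (s * (h * E)) + 4 * C * (s * d ^+ 2) - 4 * h * e.
  by field; rewrite gt_eqF.
have H2 : k * (h * (A + P)) <= h * (2 * c * A + P).
  rewrite mulrCA ler_pM2l // mulrDr lerD // ?ler_wpM2r //.
  by rewrite -[leRHS]mul1r ler_wpM2r.
have a1 : 0 <= C * (h * Q) by rewrite !mulr_ge0 // ltW.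
have a2 : 0 <= s * (h * E) by rewrite !mulr_ge0 // ltW.
have a3 : 0 <= s * d ^+ 2 by rewrite mulr_ge0 ?sqr_ge0 // ltW.
by rewrite e1 in H1; lra.
Qed.

Lemma sum_ooE {R : realType} N (u u' : nat -> R) :
  (forall j, (1 <= j < N.+1)%N -> u j = u' j) ->
  sum_oo N (fun j => `|u j| ^+ 2) = mesh R N * \sum_(1 <= j < N.+1) u' j ^+ 2.
Proof.
move=> H; congr (_ * _); apply: eq_big_nat => j /H ->.
exact: real_normK (num_real _).
Qed.

Lemma sum_coE {R : realType} N (u u' : nat -> R) :
  (forall j, (0 <= j < N.+1)%N -> u j = u' j) ->
  sum_co N (fun j => `|u j| ^+ 2) = mesh R N * \sum_(0 <= j < N.+1) u' j ^+ 2.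
Proof.
move=> H; congr (_ * _); apply: eq_big_nat => j /H ->.
exact: real_normK (num_real _).
Qed.

Theorem lemma2p13 (R : realType) (T beta x0 C0 : R)
  (hT : 0 < T) (hbeta : 0 < beta < 1) (hx0 : x0 < 0) (hC0 : 0 < C0)
  (hpsi : forall t x : R, - T <= t <= T -> 0 <= x <= 1 ->
            1 <= psi beta x0 C0 t x) :
  exists lambda s0 eps0 M0 : R,
    [/\ 0 < lambda, 0 < s0, 0 < eps0 & 0 < M0] /\
    forall (N : nat) (s : R), s0 < s < eps0 / mesh R N ->
    forall v : R -> nat -> R,
      (forall j : nat, (j <= N.+1)%N ->
         [/\ weakly_differentiable T (fun t => v t j),
             weakly_differentiable T (fun t => dt T v t j) &
             square_integrable T (fun t => dt T (dt T v) t j)]) ->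
      (forall t : R, - T < t < T -> v t 0%N = 0 /\ v t N.+1 = 0) ->
      (forall j : nat, (j <= N.+1)%N ->
         zero_trace T (fun t => v t j) /\
         zero_trace T (fun t => dt T v t j)) ->
      let w := psi beta x0 C0 in
      (s%:E * sq_oo T N (dt T v)
       + s%:E * sq_co T N (fun t => dplus_h N (v t))
       + (s ^+ 3)%:E * sq_oo T N v
       + sq_oo T N (P_h1 w lambda s T N v)
       + sq_oo T N (P_h2 w lambda s T N v)
       <= M0%:E * sq_oo T N (P_h w lambda s T N v)
          + (M0 * s)%:E * time_int T (fun t => `|dminus_h N (v t) N.+1| ^+ 2)%R
          + (M0 * s)%:E * sq_co T N
              (fun t j => mesh R N * dplus_h N (dt T v t) j)%R)%E.
Proof.
have [c [C [eta [c0 Cge0 eta0 PW]]]] := pointwise_carleman hbeta hx0 hpsi.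
set lam := ((1 - beta) * x0 ^+ 2)^-1 in PW.
have lam0 : 0 < lam.
  have /andP[_ b1] := hbeta.
  by rewrite invr_gt0 mulr_gt0 ?subr_gt0 // exprn_even_gt0 //= lt_eqF.
(* In [pointwise_carleman] the energy terms have coefficient 2 c and the two squares coefficient
   1. *)
pose k := Num.min (2 * c) 1; pose M0 := 4 * (1 + C) / k.
have k0 : 0 < k by rewrite lt_min mulr_gt0 //=.
have M00 : 0 < M0 by rewrite divr_gt0 // mulr_gt0 // ltr_wpDr.
(* The single threshold eta serves twice, as s > eta^-1 and as s h < eta. *)
exists lam, eta^-1, eta, M0; split; first by split => //; rewrite invr_gt0.
move=> N s /andP[s1 s2] v Hv Hends Htr /=.
have h0 : 0 < mesh R N by rewrite invr_gt0.
have sh : s * mesh R N < eta by rewrite -ltr_pdivlMr.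
have [s0 {}PW] := PW N s s1 sh.
set pw := psi beta x0 C0.
have [e [ie e0 ae_e]] := energy_flux beta x0 C0 lam hT s0 Hv Htr.
have ae0 := ends_ae Hv Hends.
have aeP := P_h_ae beta x0 C0 lam s0 Hv.
have Ms0 : 0 <= M0 * s by rewrite mulr_ge0 // ltW.
have h0' := ltW h0.
have n1 : ge0_measurable T (fun t => sum_oo N (fun j => `|dt T v t j| ^+ 2)).
  apply: ge0_measurable_sum_sqr => // j /andP[_ jN].
  apply: (measurable_w Hv); exact: leqW.
have mdif (u : R -> nat -> R) j : (j <= N)%N ->
    (forall i, (i <= N.+1)%N -> measurable_fun (time_itv T) (u ^~ i)) ->
    measurable_fun (time_itv T) (fun t => dplus_h N (u t) j).
  move=> jN mu; apply: measurable_funM; last exact: measurable_cst.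
  by apply: measurable_funB; apply: mu => //; exact: leqW.
have n2 : ge0_measurable T (fun t => sum_co N (fun j => `|dplus_h N (v t) j| ^+ 2)).
  apply: ge0_measurable_sum_sqr => // j /andP[_ jN].
  by apply: mdif => // i iN; exact: (measurable_v Hv).
have n3 : ge0_measurable T (fun t => sum_oo N (fun j => `|v t j| ^+ 2)).
  apply: ge0_measurable_sum_sqr => // j /andP[_ jN].
  apply: (measurable_v Hv); exact: leqW.
have n4 : ge0_measurable T (fun t => sum_oo N (fun j =>
    `|P_h1 pw lam s T N v t j| ^+ 2)).
  apply: ge0_measurable_sum_sqr => // j /andP[_ jN].
  exact: measurable_P_h1.
have n5 : ge0_measurable T (fun t => sum_oo N (fun j =>
    `|P_h2 pw lam s T N v t j| ^+ 2)).
  apply: ge0_measurable_sum_sqr => // j /andP[_ jN].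
  exact: measurable_P_h2.
have n6 : ge0_measurable T (fun t => sum_oo N (fun j =>
    `|P_h pw lam s T N v t j| ^+ 2)).
  apply: ge0_measurable_sum_sqr => // j /andP[j0 jN].
  by have [] := P_h_weak beta x0 C0 lam s0 Hv j0 jN.
have n7 : ge0_measurable T (fun t => `|dminus_h N (v t) N.+1| ^+ 2).
  apply: ge0_measurable_sqr; apply: (mdif v N) => // i iN; exact: (measurable_v Hv).
have n8 : ge0_measurable T (fun t => sum_co N (fun j =>
    `|mesh R N * dplus_h N (dt T v t) j| ^+ 2)).
  apply: ge0_measurable_sum_sqr => // j /andP[_ jN].
  apply: measurable_funM; first exact: measurable_cst.
  by apply: mdif => // i iN; exact: (measurable_w Hv).
have m1 := ge0_measurable_scale (ltW s0) n1.
have m2 := ge0_measurable_scale (ltW s0) n2.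
have m3 := ge0_measurable_scale (exprn_ge0 3 (ltW s0)) n3.
have m6 := ge0_measurable_scale (ltW M00) n6.
have m7 := ge0_measurable_scale Ms0 n7.
have m8 := ge0_measurable_scale Ms0 n8.
have m12 := ge0_measurable_add m1 m2.
have m13 := ge0_measurable_add m12 m3.
have m14 := ge0_measurable_add m13 n4.
have m15 := ge0_measurable_add m14 n5.
have m67 := ge0_measurable_add m6 m7.
have m68 := ge0_measurable_add m67 m8.
(* Each side becomes one integral of a nonnegative measurable function, so that comparing integrands
   suffices. *)
rewrite /sq_oo /sq_co (time_int_scale (ltW s0) n1) (time_int_scale (ltW s0) n2).
rewrite (time_int_scale (exprn_ge0 3 (ltW s0)) n3) (time_int_scale (ltW M00) n6).
rewrite (time_int_scale Ms0 n7) (time_int_scale Ms0 n8).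
rewrite (time_int_add m1 m2) (time_int_add m12 m3) (time_int_add m13 n4).
rewrite (time_int_add m14 n5) (time_int_add m6 m7) (time_int_add m67 m8).
have mD : measurable (time_itv T) by exact: measurable_itv.
(* The correction is the time derivative of the energy with the factor it has in
   [absorb_constants]. *)
apply: (ge0_le_integral_corrected (e := fun t => - (4 / k * mesh R N) * e t) m15 m68).
- exact: integrableZlR.
- by rewrite RintegralZl // e0 mulr0.
apply: ae_imp2 (ae_imp2 (fun t H1 H2 => conj H1 H2) ae_e ae0) aeP => t [He H0] HP Dt.
have tT : - T < t < T by move: Dt; rewrite /time_itv /= in_itv.
have tT' : - T <= t <= T by case/andP: tT => *; rewrite !ltW.
have [v0 vN] := Hends _ tT; have [w0 wN] := H0 Dt.
have := PW t (v t) (dt T v t) (dt T (dt T v) t) tT' v0 vN w0 wN; cbv zeta.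
rewrite -He //.
move=> H.
rewrite (sum_ooE (fun j _ => erefl (dt T v t j))) (sum_coE (fun j _ => erefl (dplus_h N (v t) j))).
rewrite (sum_ooE (fun j _ => erefl (v t j))) (sum_ooE (HP Dt)).
rewrite (sum_ooE (fun j _ => P_h1E T beta x0 C0 lam N v s0 t j)).
rewrite (sum_ooE (fun j _ => P_h2E T beta x0 C0 N v lam0 s0 t j)).
rewrite (sum_coE (fun j _ => erefl (mesh R N * dplus_h N (dt T v t) j))).
rewrite (real_normK (num_real _)).
rewrite -addrA in H.
have sq m n (u : nat -> R) : 0 <= \sum_(m <= j < n) u j ^+ 2.
  by apply: sumr_ge0 => j _; exact: sqr_ge0.
have kc : k <= 2 * c by rewrite ge_min lexx.
have k1 : k <= 1 by rewrite ge_min lexx orbT.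
have A0 : 0 <= s * (\sum_(1 <= j < N.+1) dt T v t j ^+ 2)
    + s * (\sum_(0 <= j < N.+1) dif (mesh R N) (v t) j ^+ 2)
    + s ^+ 3 * (\sum_(1 <= j < N.+1) v t j ^+ 2).
  by rewrite !addr_ge0 // mulr_ge0 ?exprn_ge0 // ltW.
have := absorb_constants k0 kc k1 h0 s0 Cge0 A0 (addr_ge0 (sq _ _ _) (sq _ _ _))
  (sq _ _ _) (sq _ _ _) H.
rewrite -/M0 /dif /dplus_h /dminus_h /= => F.
apply: le_trans (le_trans F _); rewrite le_eqVlt; apply/orP; left; apply/eqP; ring.
Qed.
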